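(* Let $\mathcal A$ be a unital Banach $*$-algebra and let $(\mathcal N,F_0)$ be an odd $\theta_q$-summable Breuer-Fredholm module for $\mathcal A$ for some $q$ with $0<q\le 1$. Let $P=\frac12(1+F_0)$. For each unitary $u\in\mathcal A$ with $[F_0,u]\in Li_0^{q/2}$, the path $F_t^u=F_0+t(uF_0u^*-F_0)$, $t\in[0,1]$, lies in the self-adjoint Breuer-Fredholm operators, and $$\operatorname{ind}(PuP)=sf(\{F_t^u\})=\frac{1}{C_{0,q}}\int_0^1\tau\Big(\frac{d}{dt}(F_t^u)\,e^{-|1-(F_t^u)^2|^{-1/q}}\Big)dt,$$ where $C_{0,q}=\int_{-1}^1e^{-(1-u^2)^{-1/q}}\,du$.
   Context: $\mathcal N$ is a semifinite von Neumann algebra (separable predual) with faithful normal semifinite trace $\tau$. For $S\in\mathcal N$, $t>0$: $\mu_t(S)=\inf\{\|SE\| : E\in\mathcal N\text{ a projection},\ \tau(1-E)\le t\}$. For $0<p\le1$, $Li_0^p=\{T\in\mathcal N:\mu_t(T)=o((1/\log t)^p)\text{ as }t\to\infty\}$. The function $x\mapsto e^{-x^{-1/q}}$ on $[0,\infty)$ is $0$ at $x=0$. $\mathcal K_{\mathcal N}$ is the norm-closed two-sided ideal generated by the elements of finite trace, $\pi:\mathcal N\to\mathcal N/\mathcal K_{\mathcal N}$ the quotient map; $T\in\mathcal N$ is Breuer-Fredholm if $\pi(T)$ is invertible. An odd $\theta_q$-summable Breuer-Fredholm module for $\mathcal A$ is a pair $(\mathcal N,F_0)$ where $\mathcal A$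 is continuously represented in $\mathcal N$ (elements of $\mathcal A$ are identified with their images, unitaries with unitaries), $F_0\in\mathcal N$ is self-adjoint with $F_0^2=1$, $[F_0,a]\in\mathcal K_{\mathcal N}$ for all $a\in\mathcal A$, and $[F_0,a]\in Li_0^{q/2}$ for a dense set of $a\in\mathcal A$. $\operatorname{ind}(PuP)$ is the Breuer-Fredholm index of $PuP$ as an element of $P\mathcal NP$: $\tau$ of the projection onto its kernel in $PH$ minus $\tau$ of the projection onto the kernel of its adjoint $Pu^*P$ in $PH$. Spectral flow: for a norm-continuous path $\{F_t\}_{t\in[a,b]}$ of self-adjoint Breuer-Fredholm operators let $P_t=\chi_{[0,\infty)}(F_t)$; $t\mapsto\pi(P_t)$ is continuous; for a fine enough partition (so that $\pi(P_t)$ varies by less than $1$ on each subinterval), $sf(\{F_t\})=\sum_i\operatorname{ind}(P_{t_{i-1}}P_{t_i})$, where $\operatorname{ind}(PQ)=\tau([\operatorname{ran}Q\cap\ker P])-\tau([\ker Q\cap\operatorname{ran}P])$ is the index of $PQ:\operatorname{ran}Q\to\operatorname{ran}P$. If all $F_t\in F_a+\mathcal K_{\mathcal N}$, this equals $\operatorname{ind}(P_aP_b)$. *)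

(* Defs.v *)
From HB Require Import structures.
From mathcomp Require Import all_boot all_order all_algebra.
From mathcomp Require Import all_classical all_reals all_analysis.
From mathcomp Require Import complex.

Set Implicit Arguments.
Unset Strict Implicit.
Unset Printing Implicit Defensive.

Import Order.TTheory GRing.Theory Num.Theory.
Import numFieldNormedType.Exports.

Local Open Scope classical_set_scope.
Local Open Scope ring_scope.
Local Open Scope complex_scope.

(* Num.Theory shadows these projections R[i] -> R. *)
Local Notation Re := complex.Re.
Local Notation Im := complex.Im.

(* The norm of a [normedModType R[i]] takes its values in R[i]; they are real
   and nonnegative, and are projected to R by [Re] below. *)

(* Makes the notation [f =o_+oo g] available. *)
Canonical pinfty_filter_on (R : numFieldType) := FilterType (pinfty_nbhs R) _.

(* A {dot} form is linear in its first argument, positive definite, and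
   conjugate-symmetric. *)
HB.mixin Record isHilbert (R : realType) H & CompleteNormedModule R[i] H := {
  hdot : {dot H for Num.conj} ;
  sqr_norm_hdot : forall x : H, `|x| ^+ 2 = hdot x x }.

#[short(type="hilbertType")]
HB.structure Definition Hilbert (R : realType) :=
  {H of CompleteNormedModule R[i] H & isHilbert R H}.

(* Operators are plain functions H -> H, with the pointwise module structure
   and composition; membership in B(H) is the predicate [bounded_op]. *)
Section Operators.
Context {R : realType} {H : hilbertType R}.
Implicit Types S T P E : H -> H.

Definition bounded_op T := linear T /\ continuous T.

Definition opnorm T : R := sup [set Re `|T x| | x in [set x : H | `|x| <= 1]].

Definition adjoint T : H -> H :=
  xget 0 [set S | bounded_op S /\ forall x y, hdot (T x) y = hdot x (S y)].

Definition selfadjoint T := bounded_op T /\ adjoint T = T.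

(* [0 <= z] in R[i] says that z is real and nonnegative. *)
Definition positive_op T := bounded_op T /\ forall x, 0 <= hdot (T x) x.

Definition op_le S T := positive_op (T - S).

Definition projection P := selfadjoint P /\ P \o P = P.

Definition ker T : set H := [set x | T x = 0].

Definition proj_onto (V : set H) : H -> H :=
  xget 0 [set P | projection P /\ range P = V].

Definition commutator S T : H -> H := (S \o T) - (T \o S).

(* The spectral measure of a self-adjoint T at x: the measure on
   [- ||T||, ||T||] with \int p dm = <p(T) x, x> for every polynomial p. *)
Definition spectral_measure_at T (x : H)
    (m : {measure set (measurableTypeR R) -> \bar R}) :=
  [/\ (m setT < +oo)%E, m (~` `[- opnorm T, opnorm T]) = 0%E &
      forall n, hdot (iter n T x) x
                = (\int[m]_(y in `[- opnorm T, opnorm T]) (y ^+ n))%:C].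

(* Borel functional calculus g(T), for T self-adjoint and g Borel, bounded on
   bounded sets: <g(T) x, x> = \int g dm, with m the spectral measure at x. *)
Definition fun_calc (g : R -> R) T : H -> H :=
  xget 0 [set S | bounded_op S /\
    forall x, exists2 m, spectral_measure_at T x m &
      hdot (S x) x = (\int[m]_(y in `[- opnorm T, opnorm T]) g y)%:C].

Definition op_abs T : H -> H := fun_calc Num.sqrt (adjoint T \o T).

Definition op_derive (F : R -> H -> H) (t : R) : H -> H :=
  xget 0 [set D | bounded_op D /\
    opnorm ((h^-1)%:C *: (F (t + h) - F t) - D) @[h --> 0^'] --> (0 : R)].

Definition norm_continuous_on (a b : R) (F : R -> H -> H) :=
  forall t, t \in `[a, b] ->
    opnorm (F s - F t) @[s --> within `[a, b] (nbhs t)] --> (0 : R).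

End Operators.

Section VonNeumannAlgebra.
Context {R : realType} {H : hilbertType R}.
Implicit Types (N D J : set (H -> H)) (S T : H -> H).

Definition commutant N : set (H -> H) :=
  [set S | bounded_op S /\ forall T, N T -> S \o T = T \o S].

Record von_neumann_algebra N : Prop := {
  vna_bounded : forall T, N T -> bounded_op T ;
  vna_adjoint : forall T, N T -> N (adjoint T) ;
  vna_bicommutant : commutant (commutant N) = N }.

(* The predual consists of the sigma-weakly continuous functionals on N; only
   the values of w on N matter. *)
Definition predual N : set ((H -> H) -> R[i]) :=
  [set w | exists xi eta : nat -> H,
    [/\ cvgn (series (fun n => Re `|xi n| ^+ 2)),
        cvgn (series (fun n => Re `|eta n| ^+ 2)) &
        forall T, N T ->
          Re `|w T - \sum_(i < n) hdot (T (xi i)) (eta i)|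
            @[n --> \oo] --> (0 : R)]].

Definition separable_predual N := exists ws : nat -> (H -> H) -> R[i],
  (forall k, predual N (ws k)) /\
  forall w, predual N w -> forall e : R, 0 < e ->
    exists k, forall T, N T -> opnorm T <= 1 -> Re `|w T - ws k T| <= e.

Definition pos_part N : set (H -> H) := [set T | N T /\ positive_op T].

Definition directed D :=
  D !=set0 /\ forall S T, D S -> D T -> exists2 U, D U & op_le S U /\ op_le T U.

Definition is_lub_in N D T :=
  [/\ pos_part N T, forall S, D S -> op_le S T &
      forall U, pos_part N U -> (forall S, D S -> op_le S U) -> op_le T U].

(* Only the values of tau on the positive part of N matter. *)
Record fns_trace N (tau : (H -> H) -> \bar R) : Prop := {
  trace_ge0 : forall T, pos_part N T -> (0 <= tau T)%E ;
  traceD : forall S T, pos_part N S -> pos_part N T ->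
    tau (S + T) = (tau S + tau T)%E ;
  traceZ : forall (a : R) T, 0 <= a -> pos_part N T ->
    tau (a%:C *: T) = (a%:E * tau T)%E ;
  trace_tracial : forall T, N T -> tau (adjoint T \o T) = tau (T \o adjoint T) ;
  trace_faithful : forall T, pos_part N T -> tau T = 0%E -> T = 0 ;
  trace_normal : forall D T, D `<=` pos_part N -> directed D ->
    is_lub_in N D T -> tau T = ereal_sup (tau @` D) ;
  trace_semifinite : forall T, pos_part N T -> T <> 0 ->
    exists S, [/\ pos_part N S, S <> 0, op_le S T & (tau S < +oo)%E] }.

Variables (N : set (H -> H)) (tau : (H -> H) -> \bar R).

Definition trace_class : set (H -> H) :=
  [set T | N T /\ (tau (op_abs T) < +oo)%E].

Definition finite_pos : set (H -> H) :=
  [set T | pos_part N T /\ (tau T < +oo)%E].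

(* The linear extension of tau to the trace class operators. *)
Definition trace T : R[i] :=
  xget 0 [set z | exists T1 T2 T3 T4,
    [/\ finite_pos T1 /\ finite_pos T2, finite_pos T3 /\ finite_pos T4,
        T = (T1 - T2) + 'i *: (T3 - T4) &
        z = (fine (tau T1) - fine (tau T2))
            +i* (fine (tau T3) - fine (tau T4))]].

Record closed_ideal J : Prop := {
  ideal_sub : J `<=` N ;
  ideal0 : J 0 ;
  idealD : forall S T, J S -> J T -> J (S + T) ;
  ideal_comp : forall S T, N S -> J T -> J (S \o T) /\ J (T \o S) ;
  ideal_closed : forall T, N T ->
    (forall e : R, 0 < e -> exists2 S, J S & opnorm (T - S) < e) -> J T }.

Definition compact_ideal : set (H -> H) :=
  [set T | N T /\ forall J, closed_ideal J -> trace_class `<=` J -> J T].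

(* Invertibility of pi(T) in N / K_N. *)
Definition breuer_fredholm T :=
  N T /\ exists S, [/\ N S, compact_ideal ((T \o S) - id) &
                       compact_ideal ((S \o T) - id)].

(* The norm of pi(T) in N / K_N. *)
Definition quotient_norm T : R := inf [set opnorm (T - S) | S in compact_ideal].

Definition mu (t : R) S : R :=
  inf [set opnorm (S \o E) | E in
        [set E | [/\ N E, projection E & (tau (id - E)%R <= t%:E)%E]]].

Definition Li0 (p : R) : set (H -> H) :=
  [set T | N T /\
    (mu^~ T : R -> R^o) =o_+oo (fun t => (ln t)^-1 `^ p : R^o)].

(* Index of X as an element of P N P; its value is finite only if both
   terms are, since +oo - +oo = -oo in \bar R. *)
Definition corner_index (P X : H -> H) : \bar R :=
  (tau (proj_onto (ker X `&` range P))
   - tau (proj_onto (ker (adjoint X) `&` range P)))%E.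

(* Index of P Q : ran Q -> ran P. *)
Definition pair_index (P Q : H -> H) : \bar R :=
  (tau (proj_onto (range Q `&` ker P))
   - tau (proj_onto (ker Q `&` range P)))%E.

Definition spectral_proj (F : R -> H -> H) (t : R) : H -> H :=
  fun_calc \1_(`[0, +oo[) (F t).

Record fredholm_path (a b : R) (F : R -> H -> H) : Prop := {
  path_selfadjoint : forall t, t \in `[a, b] -> selfadjoint (F t) ;
  path_fredholm : forall t, t \in `[a, b] -> breuer_fredholm (F t) ;
  path_continuous : norm_continuous_on a b F }.

(* The subdivision points are a :: s, the last of them being b. *)
Definition fine_partition (a b : R) (F : R -> H -> H) (s : seq R) :=
  itv_partition a b s /\
  forall i, (i < size s)%N ->
    forall x y, x \in `[nth b (a :: s) i, nth b s i] ->
                y \in `[nth b (a :: s) i, nth b s i] ->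
      quotient_norm (spectral_proj F x - spectral_proj F y) < 1.

Definition partition_index (a b : R) (F : R -> H -> H) (s : seq R) : \bar R :=
  (\sum_(i < size s) pair_index (spectral_proj F (nth b (a :: s) i))
                                (spectral_proj F (nth b s i)))%E.

(* Fine partitions exist, and they all give the value k. *)
Definition is_spectral_flow (a b : R) (F : R -> H -> H) (k : \bar R) :=
  [/\ fredholm_path a b F, exists s, fine_partition a b F s &
      forall s, fine_partition a b F s -> partition_index a b F s = k].

End VonNeumannAlgebra.

(* Unital complex Banach *-algebras, the involution not being assumed to be
   isometric. *)
Record banach_star_algebra (R : realType) (A : completeNormedModType R[i]) := {
  bmul : A -> A -> A ;
  bone : A ;
  bstar : A -> A ;
  bmulA : associative bmul ;
  bmul1l : left_id bone bmul ;
  bmul1r : right_id bone bmul ;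
  bmulPl : forall (c : R[i]) x y z,
    bmul (c *: x + y) z = c *: bmul x z + bmul y z ;
  bmulPr : forall (c : R[i]) x y z,
    bmul z (c *: x + y) = c *: bmul z x + bmul z y ;
  bnormM : forall x y, `|bmul x y| <= `|x| * `|y| ;
  bstarK : involutive bstar ;
  bstarP : forall (c : R[i]) x y,
    bstar (c *: x + y) = (Num.conj c) *: bstar x + bstar y ;
  bstarM : forall x y, bstar (bmul x y) = bmul (bstar y) (bstar x) }.

Definition bunitary (R : realType) (A : completeNormedModType R[i])
    (B : banach_star_algebra A) (u : A) :=
  bmul B u (bstar B u) = bone B /\ bmul B (bstar B u) u = bone B.

Section FredholmModule.
Context {R : realType} {H : hilbertType R} {A : completeNormedModType R[i]}.
Variables (B : banach_star_algebra A).
Variables (N : set (H -> H)) (tau : (H -> H) -> \bar R).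

(* Continuous unital *-homomorphisms A -> N. *)
Record representation (rho : A -> H -> H) : Prop := {
  rep_mem : forall a, N (rho a) ;
  rep_linear : forall (c : R[i]) a b, rho (c *: a + b) = c *: rho a + rho b ;
  repM : forall a b, rho (bmul B a b) = rho a \o rho b ;
  rep1 : rho (bone B) = id ;
  rep_star : forall a, rho (bstar B a) = adjoint (rho a) ;
  rep_continuous : forall a, opnorm (rho b - rho a) @[b --> a] --> (0 : R) }.

Record odd_theta_summable_module (q : R) (rho : A -> H -> H) (F0 : H -> H)
    : Prop := {
  fm_rep : representation rho ;
  fm_mem : N F0 ;
  fm_selfadjoint : selfadjoint F0 ;
  fm_sqr : F0 \o F0 = id ;
  fm_compact : forall a, compact_ideal N tau (commutator F0 (rho a)) ;
  fm_summable : dense [set a : A | Li0 N tau (q / 2) (commutator F0 (rho a))] }.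

End FredholmModule.

Section Formula.
Context {R : realType} {H : hilbertType R}.

(* x |-> exp (- x^(-1/q)), extended by 0 at 0. *)
Definition heat (q x : R) : R :=
  if x == 0 then 0 else expR (- (x `^ (- q^-1))).

Definition C0 (q : R) : R :=
  \int[lebesgue_measure]_(x in `[-1, 1]) heat q (1 - x ^+ 2).

Definition flow_path (F0 u : H -> H) (t : R) : H -> H :=
  F0 + t%:C *: ((u \o F0 \o adjoint u) - F0).

Definition flow_op (q : R) (F : R -> H -> H) (t : R) : H -> H :=
  op_derive F t \o fun_calc (heat q) (op_abs (id - (F t \o F t))).

Definition Cintegrable (a b : R) (f : R -> R[i]) :=
  lebesgue_measure.-integrable `[a, b] (fun t => (Re (f t))%:E) /\
  lebesgue_measure.-integrable `[a, b] (fun t => (Im (f t))%:E).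

Definition Cintegral (a b : R) (f : R -> R[i]) : R[i] :=
  (\int[lebesgue_measure]_(t in `[a, b]) Re (f t))
  +i* (\int[lebesgue_measure]_(t in `[a, b]) Im (f t)).

End Formula.

(* Main.v *)
(* Let F1 = u F0 u*, D = F1 - F0 and S = F0 + F1.  Then S D = - D S,
   S^2 + D^2 = 4, 1 - F_t^2 = t (1 - t) D^2 and F_t = S / 2 + (t - 1/2) D.

   The integrand is the trace of an odd function f of D.  Conjugation by the
   sign of S exchanges f(D) and f(- D) off the kernel of 4 - D^2, so that only
   the eigenspaces of D for 2 and - 2 contribute; with E_a the projection onto
   the eigenspace for a, the trace is f(2) (tau E_2 - tau E_{-2}).  The
   substitution x = 2 t - 1 turns the integral into
   C_{0,q} (tau E_2 - tau E_{-2}).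

   The kernel of P u P in the range of P is u* (ran E_2), and that of its adjoint
   is ran E_{-2}.  For s < t the intersections of the ranges and kernels of P_s
   and P_t are trivial, or eigenspaces of D for 2 or - 2 when 1/2 lies between s
   and t, so that the index of a partition telescopes to the same number.

   Summability: as [F0, u] is in Li_0^{q/2}, the growth of tau (1_{|D| >= c}) as c
   tends to 0 is compensated by the decay of exp (- x^(-1/q)) at 0. *)
Require Import Defs.
From HB Require Import structures.
From mathcomp Require Import all_boot all_order all_algebra.
From mathcomp Require Import all_classical all_reals all_analysis.
From mathcomp Require Import measurable_realfun complex ring lra.

Set Implicit Arguments.
Unset Strict Implicit.
Unset Printing Implicit Defensive.

Import Order.TTheory GRing.Theory Num.Theory.
Import numFieldNormedType.Exports.

Local Open Scope classical_set_scope.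
Local Open Scope ring_scope.
Local Open Scope complex_scope.

Local Notation Re := complex.Re.
Local Notation Im := complex.Im.

(** * Real inner product and bounded operators *)

(** [fun_calc], [adjoint], [trace] and [op_derive] choose a witness with [xget 0], so nothing can be
    computed until existence and uniqueness of the witness are known. For [fun_calc], existence
    means building spectral measures from moments: positivity of p(T), for p nonnegative on the norm
    interval, comes from factoring polynomials over the complex numbers, and the measure from a
    distribution function. Uniqueness is determinacy by moments, proved for all [sigma_functional]s,
    so that the rules of the calculus reduce to comparisons of powers. On the trace side the
    obstacle is that tau may be infinite: the cancellation between f(D) and f(- D) is legitimate
    only once f is dominated by a weight of finite trace, chosen independent of t. The exponent q /
    2 is the one that D^2 requires: at |D| = 2 n^(- q / 2) the weight equals 2 exp (- n), while
    evaluating the singular values at exp (n / 2) bounds the trace of the spectral projection by a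
    multiple of exp (n / 2). *)

Section ComplexNumbers.
Variable R : realType.
Implicit Types (a b : R) (z w : R[i]).

Lemma ReD z w : Re (z + w) = Re z + Re w. Proof. by case: z w => [? ?] []. Qed.
Lemma ReN z : Re (- z) = - Re z. Proof. by case: z. Qed.
Lemma ReZ a z : Re (a%:C * z) = a * Re z.
Proof. by case: z => x y /=; rewrite mul0r subr0. Qed.
Lemma Re_iM z : Re ('i * z) = - Im z.
Proof. by case: z => x y /=; rewrite mul0r sub0r mul1r. Qed.
Lemma conjCE z : Num.conj z = conjc z. Proof. by []. Qed.
Lemma Re_conj z : Re (Num.conj z) = Re z.
Proof. by rewrite conjCE; case: z. Qed.
Lemma Im_conj z : Im (Num.conj z) = - Im z.
Proof. by rewrite conjCE; case: z. Qed.

Lemma normRC a : `|a%:C| = `|a|%:C :> R[i].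
Proof. by rewrite normc_def /= expr0n /= addr0 sqrtr_sqr. Qed.

Lemma normi : `|'i| = 1 :> R[i].
Proof. by rewrite normc_def /= expr0n /= add0r expr1n sqrtr1. Qed.

End ComplexNumbers.

Section RealInnerProduct.
Context {R : realType} {H : hilbertType R}.
Implicit Types x y z : H.

(* The calculus below only sees the underlying real Hilbert space; complex
   linearity is recovered from invariance under multiplication by ['i]. *)
Definition rip x y : R := Re (hdot x y).
Definition hnrm x : R := Re `|x|.

Lemma hdotC x y : hdot x y = Num.conj (hdot y x).
Proof. by rewrite (hermC (hdot : {dot H for Num.conj})) expr0 mul1r. Qed.

Lemma hdotZl (c : R[i]) x y : hdot (c *: x) y = c * hdot x y.
Proof. exact: (@linearl_subproof _ _ _ _ _ _ (hdot : {dot H for Num.conj}) y c x). Qed.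

Lemma ripC x y : rip x y = rip y x.
Proof. by rewrite /rip hdotC Re_conj. Qed.
Lemma ripDl x y z : rip (x + y) z = rip x z + rip y z.
Proof. by rewrite /rip linearDl ReD. Qed.
Lemma ripDr x y z : rip z (x + y) = rip z x + rip z y.
Proof. by rewrite ripC ripDl !(ripC z). Qed.
Lemma ripZl (a : R) x y : rip (a%:C *: x) y = a * rip x y.
Proof. by rewrite /rip (hdotZl _ x y) ReZ. Qed.
Lemma ripZr (a : R) x y : rip x (a%:C *: y) = a * rip x y.
Proof. by rewrite ripC ripZl ripC. Qed.
Lemma ripNl x y : rip (- x) y = - rip x y.
Proof. by rewrite /rip linearNl ReN. Qed.
Lemma ripNr x y : rip x (- y) = - rip x y.
Proof. by rewrite ripC ripNl ripC. Qed.
Lemma ripBl x y z : rip (x - y) z = rip x z - rip y z.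
Proof. by rewrite ripDl ripNl. Qed.
Lemma ripBr x y z : rip z (x - y) = rip z x - rip z y.
Proof. by rewrite ripDr ripNr. Qed.
Lemma rip0l y : rip 0 y = 0.
Proof. by rewrite /rip linear0l. Qed.
Lemma rip0r y : rip y 0 = 0.
Proof. by rewrite ripC rip0l. Qed.
Lemma rip_il x y : rip ('i *: x) y = - rip x ('i *: y).
Proof.
rewrite (ripC x) /rip (hdotZl _ x y) (hdotZl _ y x) !Re_iM hdotC.
by rewrite Im_conj.
Qed.
Lemma rip_ii x y : rip ('i *: x) ('i *: y) = rip x y.
Proof. by rewrite rip_il scalerA -expr2 sqr_i scaleN1r ripNr opprK. Qed.
Lemma rip_ir x y : rip x ('i *: y) = - rip ('i *: x) y.
Proof. by rewrite rip_il opprK. Qed.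

Lemma hdotE x y : hdot x y = rip x y +i* rip x ('i *: y).
Proof.
rewrite (ripC x ('i *: y)) /rip (hdotZl _ y x) Re_iM -Im_conj -hdotC.
by case: (hdot x y).
Qed.

Lemma hnrmE x : `|x| = (hnrm x)%:C.
Proof.
have := normr_ge0 x; rewrite /hnrm; case: (`|x|) => a b.
by rewrite lecE /= => /andP[/eqP-> _].
Qed.

Lemma hnrm_ge0 x : 0 <= hnrm x.
Proof. by have := normr_ge0 x; rewrite hnrmE ler0c. Qed.

Lemma sqr_hnrm x : hnrm x ^+ 2 = rip x x.
Proof.
by have := sqr_norm_hdot x; rewrite hnrmE /rip => <-; rewrite -rmorphXn.
Qed.

Lemma rip_ge0 x : 0 <= rip x x.
Proof. by rewrite -sqr_hnrm sqr_ge0. Qed.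

Lemma hnrm_eq0 x : (hnrm x == 0) = (x == 0).
Proof.
by rewrite -(normr_eq0 x) hnrmE -[0 in RHS]/(0%:C) (inj_eq (@complexI R)).
Qed.

Lemma hnrm0 : hnrm 0 = 0. Proof. by apply/eqP; rewrite hnrm_eq0. Qed.

Lemma rip_eq0 x : rip x x = 0 -> x = 0.
Proof. by rewrite -sqr_hnrm => /eqP; rewrite sqrf_eq0 hnrm_eq0 => /eqP. Qed.

Lemma rip_eq x y : (forall z, rip x z = rip y z) -> x = y.
Proof.
move=> h; apply/eqP; rewrite -subr_eq0; apply/eqP/rip_eq0.
by rewrite ripBl h subrr.
Qed.

Lemma hnrmD x y : hnrm (x + y) <= hnrm x + hnrm y.
Proof. by have := ler_normD x y; rewrite !hnrmE -rmorphD /= lecR. Qed.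
Lemma hnrmN x : hnrm (- x) = hnrm x.
Proof. by rewrite /hnrm normrN. Qed.
Lemma hnrmB x y : hnrm (x - y) <= hnrm x + hnrm y.
Proof. by rewrite (le_trans (hnrmD _ _)) // hnrmN. Qed.
Lemma hnrmZ (c : R[i]) x : hnrm (c *: x) = Re `|c| * hnrm x.
Proof.
rewrite {1}/hnrm normrZ hnrmE.
by rewrite normc_def /= mulr0 subr0.
Qed.
Lemma hnrmZR (c : R) x : hnrm (c%:C *: x) = `|c| * hnrm x.
Proof. by rewrite hnrmZ normRC. Qed.
Lemma hnrmi x : hnrm ('i *: x) = hnrm x.
Proof. by rewrite hnrmZ normi /= mul1r. Qed.

Lemma sqr_hnrmD x y :
  hnrm (x + y) ^+ 2 = hnrm x ^+ 2 + 2 * rip x y + hnrm y ^+ 2.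
Proof. rewrite !sqr_hnrm ripDl !ripDr (ripC y x); ring. Qed.

Lemma sqr_hnrmB x y :
  hnrm (x - y) ^+ 2 = hnrm x ^+ 2 - 2 * rip x y + hnrm y ^+ 2.
Proof. rewrite !sqr_hnrm ripBl !ripBr (ripC y x); ring. Qed.

Lemma cauchy_schwarz x y : `|rip x y| <= hnrm x * hnrm y.
Proof.
have H1 a b : 0 <= a ^+ 2 * rip x x + 2 * a * b * rip x y + b ^+ 2 * rip y y.
  have -> : a ^+ 2 * rip x x + 2 * a * b * rip x y + b ^+ 2 * rip y y =
     rip (a%:C *: x + b%:C *: y) (a%:C *: x + b%:C *: y).
    rewrite ripDl !ripDr !ripZl !ripZr (ripC y x); ring.
  exact: rip_ge0.
have H2 : rip x y ^+ 2 <= (hnrm x * hnrm y) ^+ 2.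
  rewrite exprMn !sqr_hnrm.
  have [/rip_eq0 ->|y0] := eqVneq (rip y y) 0; first by rewrite !rip0r expr0n/= mulr0.
  have yp : 0 < rip y y by rewrite lt0r y0 rip_ge0.
  have := H1 (rip y y) (- rip x y).
  have -> : rip y y ^+ 2 * rip x x + 2 * rip y y * - rip x y * rip x y +
    (- rip x y) ^+ 2 * rip y y = rip y y * (rip x x * rip y y - rip x y ^+ 2) by ring.
  by rewrite pmulr_rge0 // subr_ge0.
by rewrite -(ler_pXn2r (n:=2)) ?nnegrE ?mulr_ge0 ?hnrm_ge0// real_normK ?num_real.
Qed.

Lemma rip_le x y : rip x y <= hnrm x * hnrm y.
Proof. by rewrite (le_trans (ler_norm _)) ?cauchy_schwarz. Qed.

Lemma hnrm_le_rip x (K : R) : 0 <= K ->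
  (forall y, rip x y <= K * hnrm y) -> hnrm x <= K.
Proof.
move=> K0 /(_ x); rewrite -sqr_hnrm expr2.
have [->//|x0] := eqVneq (hnrm x) 0.
by rewrite ler_pM2r // lt0r x0 hnrm_ge0.
Qed.

(** Radii of balls in [H] live in [R[i]]; a positive element there has zero imaginary part, so real
    epsilons suffice. *)
Lemma hnrm_complete (v : nat -> H) :
  (forall e : R, 0 < e -> exists N, forall m n, (N <= m)%N -> (N <= n)%N ->
     hnrm (v m - v n) < e) ->
  exists l, forall e : R, 0 < e -> exists N, forall n, (N <= n)%N ->
     hnrm (v n - l) < e.
Proof.
move=> h.
have cv : cvg (v @ \oo).
  apply/cauchy_cvgP/cauchy_exP => e; rewrite ltcE /= => /andP[/eqP Ie e0].
  have [N HN] := h _ e0.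
  exists (v N), N => // n /= Nn; rewrite -ball_normE /ball_ /= hnrmE.
  by rewrite ltcE /= Ie eqxx /= HN.
exists (lim (v @ \oo)) => e e0.
have e0' : 0 < e%:C :> R[i] by rewrite ltcR.
have [N _ HN] := @cvgr_dist_lt _ _ _ _ _ _ _ cv e%:C e0'.
exists N => n Nn; rewrite -opprB hnrmN.
by have := HN n Nn; rewrite /= hnrmE ltcR.
Qed.

End RealInnerProduct.

Section LinearMaps.
Context {R : realType} {H : hilbertType R}.
Implicit Types (x y : H) (T S : H -> H).

Lemma opDE T S x : (T + S) x = T x + S x. Proof. by []. Qed.
Lemma opNE T x : (- T) x = - T x. Proof. by []. Qed.
Lemma opBE T S x : (T - S) x = T x - S x. Proof. by []. Qed.
Lemma opZE (c : R[i]) T x : (c *: T) x = c *: T x. Proof. by []. Qed.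

Section Lin.
Variables (T : H -> H) (lT : linear T).
Lemma lin0 : T 0 = 0.
Proof. by have := lT (-1) 0 0; rewrite scaler0 addr0 scaleN1r addNr. Qed.
Lemma linD x y : T (x + y) = T x + T y.
Proof. by have := lT 1 x y; rewrite !scale1r. Qed.
Lemma linZ c x : T (c *: x) = c *: T x.
Proof. by have := lT c x 0; rewrite lin0 !addr0. Qed.
Lemma linN x : T (- x) = - T x.
Proof. by rewrite -scaleN1r linZ scaleN1r. Qed.
Lemma linB x y : T (x - y) = T x - T y.
Proof. by rewrite linD linN. Qed.
End Lin.

Lemma real_linear T : (forall x y, T (x + y) = T x + T y) ->
  (forall (a : R) x, T (a%:C *: x) = a%:C *: T x) ->
  (forall x, T ('i *: x) = 'i *: T x) -> linear T.
Proof.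
move=> TD TZ Ti c x y; rewrite TD (complexE c) !scalerDl TD -!scalerA.
by rewrite TZ Ti TZ.
Qed.

Lemma bounded_opP T : bounded_op T <->
  linear T /\ exists2 K : R, 0 <= K & forall x, hnrm (T x) <= K * hnrm x.
Proof.
split=> [[lT cT]|[lT [K K0 hK]]].
  pose L : {linear H -> H} := HB.pack T (GRing.isLinear.Build _ _ _ _ T lT).
  split=> //; have : bounded_near L (nbhs (0 : H)).
    by apply: continuous_linear_bounded; exact: cT.
  move/(@linear_boundedP _ H H L) => [M [Mr hM]].
  (* Every real above [k] is a bound; this one is also nonnegative. *)
  move: Mr => /complex_realP[k Mk]; exists (`|k| + 1) => [|x]; first by rewrite addr_ge0.
  have : M < (`|k| + 1)%:C by rewrite Mk ltcR ltr_pwDr // ler_norm.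
  by move/hM => /(_ x); rewrite /= !hnrmE -rmorphM /= lecR.
split=> //.
pose L : {linear H -> H} := HB.pack T (GRing.isLinear.Build _ _ _ _ T lT).
apply: (@bounded_linear_continuous _ H H L).
apply/(@linear_boundedP _ H H L); exists K%:C; split.
  by apply/complex_realP; exists K.
move=> z; rewrite ltcE /= => /andP[/eqP Iz Kz] x /=.
rewrite !hnrmE (_ : z = (Re z)%:C); last by case: z Iz {Kz} => a b /= ->.
by rewrite -rmorphM /= lecR (le_trans (hK x)) // ler_wpM2r ?hnrm_ge0 // ltW.
Qed.

Lemma bop_lin T : bounded_op T -> linear T. Proof. by case. Qed.
Hint Resolve bop_lin : core.

Lemma bopM (T S : H -> H) : bounded_op T -> bounded_op S -> bounded_op (T \o S).
Proof.
move=> /bounded_opP[lT [K K0 hK]] /bounded_opP[lS [L L0 hL]].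
apply/bounded_opP; split=> [c x y|] /=; first by rewrite lS lT.
exists (K * L) => [|x /=]; first exact: mulr_ge0.
by rewrite (le_trans (hK _)) // -mulrA ler_wpM2l.
Qed.

Lemma bopD T S : bounded_op T -> bounded_op S -> bounded_op (T + S).
Proof.
move=> /bounded_opP[lT [K K0 hK]] /bounded_opP[lS [L L0 hL]].
apply/bounded_opP; split=> [c x y|].
  by rewrite !opDE lT lS scalerDr addrACA.
exists (K + L) => [|x]; first exact: addr_ge0.
by rewrite opDE (le_trans (hnrmD _ _)) // mulrDl lerD.
Qed.

Lemma bopZ (c : R[i]) T : bounded_op T -> bounded_op (c *: T).
Proof.
move=> /bounded_opP[lT [K K0 hK]].
apply/bounded_opP; split=> [d x y|].
  by rewrite !opZE lT scalerDr !scalerA mulrC.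
exists (Re `|c| * K) => [|x].
  by rewrite mulr_ge0 // normc_def sqrtr_ge0.
rewrite opZE hnrmZ -mulrA ler_wpM2l // normc_def /=.
exact: sqrtr_ge0.
Qed.

Lemma bopN T : bounded_op T -> bounded_op (- T).
Proof. by move=> /(bopZ (-1)); rewrite scaleN1r. Qed.

Lemma bopB T S : bounded_op T -> bounded_op S -> bounded_op (T - S).
Proof. by move=> hT hS; apply: bopD => //; exact: bopN. Qed.

Lemma bop_id : bounded_op (id : H -> H).
Proof. by apply/bounded_opP; split=> //; exists 1 => // x; rewrite mul1r. Qed.

Lemma bop0 : bounded_op (0 : H -> H).
Proof.
apply/bounded_opP; split=> [c x y|]; first by rewrite scaler0 addr0.
by exists 0 => // x; rewrite mul0r hnrm0.
Qed.

Lemma bop_iter n T : bounded_op T -> bounded_op (iter n T).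
Proof.
move=> hT; elim: n => [|n ih]; first exact: bop_id.
by rewrite (_ : iter n.+1 T = T \o iter n T) //; exact: bopM.
Qed.

Let ball1 (x : H) : (`|x| <= 1) = (hnrm x <= 1).
Proof. by rewrite hnrmE -[1 in LHS]/(1%:C) lecR. Qed.

Lemma opnorm_le T (K : R) : 0 <= K ->
  (forall x, hnrm (T x) <= K * hnrm x) -> opnorm T <= K.
Proof.
move=> K0 hK; rewrite /opnorm; apply: ge_sup.
  by exists (hnrm (T 0)); exists 0 => //=; rewrite ball1 hnrm0.
move=> _ [x + <-]; rewrite /= ball1 => x1.
by rewrite (le_trans (hK x)) // ler_piMr.
Qed.

Lemma le_opnorm T x : bounded_op T -> hnrm (T x) <= opnorm T * hnrm x.
Proof.
move=> /bounded_opP[lT [K K0 hK]].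
have [x0|x0] := eqVneq (hnrm x) 0.
  have /eqP := x0; rewrite hnrm_eq0 => /eqP->.
  by rewrite (lin0 lT) hnrm0 mulr0.
have xp : 0 < hnrm x by rewrite lt0r x0 hnrm_ge0.
rewrite -ler_pdivrMr //.
have -> : hnrm (T x) / hnrm x = hnrm (T (((hnrm x)^-1)%:C *: x)).
  by rewrite (linZ lT) hnrmZR ger0_norm ?invr_ge0 ?hnrm_ge0 // mulrC.
apply: ub_le_sup.
  exists K => _ [y + <-]; rewrite /= ball1 => y1.
  by rewrite (le_trans (hK y)) // ler_piMr.
exists (((hnrm x)^-1)%:C *: x) => //=.
by rewrite ball1 hnrmZR ger0_norm ?invr_ge0 ?hnrm_ge0 // mulVf.
Qed.

Lemma opnorm_ge0 T : bounded_op T -> 0 <= opnorm T.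
Proof.
move=> /bounded_opP[lT [K K0 hK]].
apply: (@le_trans _ _ (hnrm (T 0))); first exact: hnrm_ge0.
apply: ub_le_sup; last by exists 0 => //=; rewrite ball1 hnrm0.
exists K => _ [y + <-]; rewrite /= ball1 => y1.
by rewrite (le_trans (hK y)) // ler_piMr.
Qed.

End LinearMaps.
#[global] Hint Resolve bop_lin : core.

(** * Riesz representation and operators defined by real forms *)

Section Riesz.
Context {R : realType} {H : hilbertType R}.
Implicit Types (x y : H) (T S : H -> H).

(** At t = - b / (a + 1) the expression equals - (b / (a + 1))^2 (a + 2), which is negative unless b
    = 0. Dividing by a + 1 covers the case a = 0. *)
Lemma ge0_quadratic (a b : R) :
  (forall t : R, 0 <= t ^+ 2 * a + 2 * t * b) -> b = 0.
Proof.
move=> h; have a0 : 0 <= a by have := h 1; have := h (-1); lra.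
apply/eqP; apply/negP => /negP b0.
have := h (- b / (a + 1)).
have a1 : a + 1 != 0 by rewrite gt_eqF // ltr_pwDr.
have -> : (- b / (a + 1)) ^+ 2 * a + 2 * (- b / (a + 1)) * b =
  - ((b / (a + 1)) ^+ 2 * (a + 2)) by field.
rewrite oppr_ge0 leNgt pmulr_lgt0 ?exprn_even_gt0 //=; last by lra.
by rewrite mulf_neq0 // invr_neq0.
Qed.

(** Direct method: the representing vector minimises J v = |v|^2 - 2 phi v. The parallelogram
    identity makes a minimising sequence Cauchy, and the vanishing first variation at its limit is
    the representation. *)
Lemma riesz (phi : H -> R) (K : R) :
  (forall x y, phi (x + y) = phi x + phi y) ->
  (forall (a : R) x, phi (a%:C *: x) = a * phi x) ->
  (forall x, `|phi x| <= K * hnrm x) ->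
  exists z, forall v, phi v = rip z v.
Proof.
move=> phiD phiZ phiK.
pose J v := hnrm v ^+ 2 - 2 * phi v.
have J_ge v : - K ^+ 2 <= J v.
  have := phiK v; rewrite ler_norml => /andP[_ h].
  have : 0 <= (hnrm v - K) ^+ 2 by exact: sqr_ge0.
  rewrite /J; nra.
pose m := inf (range J).
have hinf : has_inf (range J).
  by split; [exists (J 0); exists 0|exists (- K ^+ 2) => _ [v _ <-]].
have m_le v : m <= J v by apply: ge_inf; [exact: hinf.2|exists v].
have : forall n, exists v, J v < m + n.+1%:R^-1.
  move=> n; have [|_ [v _ <-] hv] := @inf_adherent _ _ (n.+1%:R^-1) _ hinf.
    by rewrite invr_gt0.
  by exists v.
move=> /choice[v Jv].
have par x y : hnrm (x - y) ^+ 2 =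
    2 * J x + 2 * J y - 4 * J ((2^-1)%:C *: (x + y)).
  rewrite /J phiZ phiD hnrmZR exprMn sqr_hnrmB sqr_hnrmD.
  by rewrite ger0_norm ?invr_ge0 ?ler0n //; field.
have cau x y : hnrm (x - y) ^+ 2 <= 2 * (J x - m) + 2 * (J y - m).
  by rewrite par; have := m_le ((2^-1)%:C *: (x + y)); lra.
have inv_small (e : R) : 0 < e -> exists N, forall n, (N <= n)%N -> n.+1%:R^-1 < e.
  move=> e0; exists (Num.bound e^-1) => n hn.
  rewrite -[e]invrK ltf_pV2 ?posrE ?invr_gt0 // (lt_le_trans (archi_boundP _)) ?invr_ge0 ?ltW//.
  by rewrite ltr_nat ltnS.
have [z hz] : exists l, forall e : R, 0 < e -> exists N, forall n, (N <= n)%N ->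
     hnrm (v n - l) < e.
  apply: hnrm_complete => e e0.
  have [N hN] := inv_small (e ^+ 2 / 4) ltac:(by rewrite divr_gt0 ?exprn_gt0).
  exists N => p n Np Nn.
  rewrite -(ltr_pXn2r (n:=2)) ?nnegrE ?hnrm_ge0 ?ltW //.
  apply: le_lt_trans (cau _ _) _.
  move: (Jv p) (Jv n) (hN _ Np) (hN _ Nn).
  by move: (p.+1%:R^-1) (n.+1%:R^-1) => a b; lra.
exists z => w; apply/esym/eqP; rewrite -subr_eq0; apply/eqP.
apply: (@ge0_quadratic (hnrm w ^+ 2)) => t.
(* Continuity of [J] is avoided: if the variation E at [z] is negative, half of - E absorbs the
   defect of [J (v n)] and the other half the distance from [v n] to [z], so that [J (v n + t w)]
   falls below the infimum. *)
rewrite leNgt; apply/negP => neg.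
set E := _ + _ in neg.
have E0 : 0 < - E by rewrite oppr_gt0.
have [N1 hN1] := inv_small (- E / 2) ltac:(by rewrite divr_gt0).
pose c := 2 * `|t| * hnrm w + 1.
have c0 : 0 < c by rewrite ltr_pwDr // !mulr_ge0 ?hnrm_ge0.
have [N2 hN2] := hz (- E / 2 / c) ltac:(by rewrite !divr_gt0).
pose n := maxn N1 N2.
have A1 := hN1 n (leq_maxl _ _); have A2 := hN2 n (leq_maxr _ _).
have A3 := m_le (v n + t%:C *: w); have A4 := Jv n.
have A5 : J (v n + t%:C *: w) = J (v n) + (t ^+ 2 * hnrm w ^+ 2 +
    2 * t * (rip (v n) w - phi w)).
  rewrite /J sqr_hnrmD phiD phiZ ripZr hnrmZR exprMn real_normK ?num_real//; ring.
have A6 : rip (v n) w = rip z w + rip (v n - z) w by rewrite ripBl; ring.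
have A7 : 2 * t * rip (v n - z) w <= - E / 2.
  apply: le_trans (ler_norm _) _; rewrite normrM normrM (ger0_norm (ler0n _ 2)).
  apply: (@le_trans _ _ (2 * `|t| * (hnrm (v n - z) * hnrm w))).
    by rewrite ler_wpM2l ?mulr_ge0 // cauchy_schwarz.
  rewrite mulrCA (le_trans (y := hnrm (v n - z) * c)) //.
    by rewrite ler_wpM2l ?hnrm_ge0 // /c lerDl.
  by rewrite -ler_pdivlMr // ltW.
have A8 : E = t ^+ 2 * hnrm w ^+ 2 + 2 * t * (rip z w - phi w) by [].
rewrite A6 in A5; rewrite A5 in A3; move: A1 A3 A4 A7 A8.
by clearbody E; move: (n.+1%:R^-1) => a; lra.
Qed.

(* Invariance of the real form [b] under multiplication by ['i] makes the
   operator it represents complex linear. *)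
Lemma bilinear_op (b : H -> H -> R) (K : R) : 0 <= K ->
  (forall x x' y, b (x + x') y = b x y + b x' y) ->
  (forall x y y', b x (y + y') = b x y + b x y') ->
  (forall (a : R) x y, b (a%:C *: x) y = a * b x y) ->
  (forall (a : R) x y, b x (a%:C *: y) = a * b x y) ->
  (forall x y, b ('i *: x) ('i *: y) = b x y) ->
  (forall x y, `|b x y| <= K * hnrm x * hnrm y) ->
  exists2 S, bounded_op S /\ opnorm S <= K & forall x y, rip (S x) y = b x y.
Proof.
move=> K0 bDl bDr bZl bZr bi bK.
have : forall x, exists z, forall y, rip z y = b x y.
  move=> x; have [|||z hz] := @riesz (b x) (K * hnrm x) => //.
  by exists z => y; rewrite hz.
move=> /choice[S hS]; exists S => //.
have lS : linear S.
  apply: real_linear => [x y|a x|x]; apply: rip_eq => z.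
  - by rewrite ripDl !hS bDl.
  - by rewrite ripZl !hS bZl.
  - rewrite rip_il !hS -[b x _]bi scalerA -expr2 sqr_i scaleN1r.
    have -> : - z = (-1)%:C *: z by rewrite rmorphN1 scaleN1r.
    by rewrite bZr mulN1r opprK.
have hK x : hnrm (S x) <= K * hnrm x.
  apply: hnrm_le_rip; first by rewrite mulr_ge0 ?hnrm_ge0.
  by move=> y; rewrite hS (le_trans (ler_norm _)).
split; last exact: opnorm_le.
by apply/bounded_opP; split=> //; exists K.
Qed.

End Riesz.

(** * Adjoints, self-adjoint operators and projections *)

Section Adjoint.
Context {R : realType} {H : hilbertType R}.
Implicit Types (x y : H) (T S P Q : H -> H).

Lemma rip_adjoint_hdot T S : linear S -> (forall x y, rip (T x) y = rip x (S y)) ->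
  forall x y, hdot (T x) y = hdot x (S y).
Proof. by move=> lS h x y; rewrite !hdotE !h (linZ lS). Qed.

Lemma adjoint_exists T : bounded_op T ->
  exists2 S, bounded_op S & forall x y, rip (T x) y = rip x (S y).
Proof.
move=> hT; have lT := bop_lin hT.
have [||||||S [hS _] hr] :=
  @bilinear_op R H (fun x y => rip x (T y)) (opnorm T) (opnorm_ge0 hT).
- by move=> x x' y; rewrite ripDl.
- by move=> x y y'; rewrite (linD lT) ripDr.
- by move=> a x y; rewrite ripZl.
- by move=> a x y; rewrite (linZ lT) ripZr.
- by move=> x y; rewrite (linZ lT) rip_ii.
- move=> x y; rewrite (le_trans (cauchy_schwarz _ _)) // mulrAC mulrC.
  by rewrite ler_wpM2r ?hnrm_ge0 // le_opnorm.
by exists S => // x y; rewrite ripC -hr ripC.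
Qed.

Lemma adjoint_spec T : bounded_op T ->
  bounded_op (adjoint T) /\ forall x y, hdot (T x) y = hdot x (adjoint T y).
Proof.
move=> hT; have [S hS hr] := adjoint_exists hT.
have h : [set S | bounded_op S /\ forall x y, hdot (T x) y = hdot x (S y)] S.
  by split=> //; apply: rip_adjoint_hdot => //; exact: bop_lin.
exact: (xgetI 0 h).
Qed.

Lemma bop_adjoint T : bounded_op T -> bounded_op (adjoint T).
Proof. by move=> /adjoint_spec[]. Qed.

Lemma rip_adjointr T x y : bounded_op T -> rip (T x) y = rip x (adjoint T y).
Proof. by move=> /adjoint_spec[_ h]; rewrite /rip h. Qed.

Lemma rip_adjointl T x y : bounded_op T -> rip (adjoint T x) y = rip x (T y).
Proof. by move=> hT; rewrite ripC -rip_adjointr // ripC. Qed.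

Lemma adjoint_eq T S : bounded_op T ->
  (forall x y, rip (T x) y = rip x (S y)) -> adjoint T = S.
Proof.
move=> hT h; apply/funext => y; apply: rip_eq => x.
by rewrite ripC -rip_adjointr // h ripC.
Qed.

Lemma adjointK T : bounded_op T -> adjoint (adjoint T) = T.
Proof.
move=> hT; apply: adjoint_eq; first exact: bop_adjoint.
by move=> x y; rewrite rip_adjointl.
Qed.

Lemma adjointM T S : bounded_op T -> bounded_op S ->
  adjoint (T \o S) = adjoint S \o adjoint T.
Proof.
move=> hT hS; apply: adjoint_eq; first exact: bopM.
by move=> x y /=; rewrite !rip_adjointr.
Qed.

Lemma adjointD T S : bounded_op T -> bounded_op S ->
  adjoint (T + S) = adjoint T + adjoint S.
Proof.
move=> hT hS; apply: adjoint_eq; first exact: bopD.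
by move=> x y; rewrite !opDE ripDl ripDr !rip_adjointr.
Qed.

Lemma adjointB T S : bounded_op T -> bounded_op S ->
  adjoint (T - S) = adjoint T - adjoint S.
Proof.
move=> hT hS; apply: adjoint_eq; first exact: bopB.
by move=> x y; rewrite !opBE ripBl ripBr !rip_adjointr.
Qed.

Lemma selfadjointP T : selfadjoint T <->
  bounded_op T /\ forall x y, rip (T x) y = rip x (T y).
Proof.
split=> [[hT aT]|[hT h]]; split=> //; last exact: adjoint_eq.
by move=> x y; rewrite rip_adjointr // aT.
Qed.

Lemma sa_bop T : selfadjoint T -> bounded_op T. Proof. by case. Qed.
Lemma sa_rip T x y : selfadjoint T -> rip (T x) y = rip x (T y).
Proof. by move=> /selfadjointP[]. Qed.

Lemma saD T S : selfadjoint T -> selfadjoint S -> selfadjoint (T + S).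
Proof.
move=> [hT aT] [hS aS]; split; first exact: bopD.
by rewrite adjointD // aT aS.
Qed.

Lemma saB T S : selfadjoint T -> selfadjoint S -> selfadjoint (T - S).
Proof.
move=> [hT aT] [hS aS]; split; first exact: bopB.
by rewrite adjointB // aT aS.
Qed.

Lemma saZ (a : R) T : selfadjoint T -> selfadjoint (a%:C *: T).
Proof.
move=> sT; apply/selfadjointP; split; first exact/bopZ/sa_bop.
by move=> x y; rewrite !opZE ripZl ripZr sa_rip.
Qed.

Lemma sa_id : selfadjoint (id : H -> H).
Proof. by apply/selfadjointP; split=> //; exact: bop_id. Qed.

Lemma sa0 : selfadjoint (0 : H -> H).
Proof.
apply/selfadjointP; split=> [|x y]; first exact: bop0.
by rewrite rip0l rip0r.
Qed.

Lemma saM T S : selfadjoint T -> selfadjoint S -> T \o S = S \o T ->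
  selfadjoint (T \o S).
Proof.
move=> [hT aT] [hS aS] c; split; first exact: bopM.
by rewrite adjointM // aT aS.
Qed.

Lemma sa_conj T S : bounded_op S -> selfadjoint T ->
  selfadjoint (S \o T \o adjoint S).
Proof.
move=> hS sT; apply/selfadjointP; split.
  by apply: bopM; [apply: bopM => //; exact: sa_bop|exact: bop_adjoint].
by move=> x y /=; rewrite rip_adjointr // sa_rip // rip_adjointl.
Qed.

Lemma sa_iter n T : selfadjoint T -> selfadjoint (iter n T).
Proof.
move=> sT; apply/selfadjointP; split; first exact/bop_iter/sa_bop.
elim: n => //= n ih x y; rewrite sa_rip // ih -iterSr //.
Qed.

(** The hypothesis says that [hdot (T x) x] is real. Expanding it at z + w, and then replacing w by
    a multiple of 'i, polarises it into symmetry; this is why positivity alone already implies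
    self-adjointness. *)
Lemma sym_of_real T : bounded_op T -> (forall x, rip (T x) ('i *: x) = 0) ->
  selfadjoint T.
Proof.
move=> hT h; have lT := bop_lin hT; apply/selfadjointP; split=> // x y.
have pol z w : rip (T z) ('i *: w) = - rip (T w) ('i *: z).
  have := h (z + w); rewrite scalerDr (linD lT) ripDl !ripDr !h; lra.
have := pol x (- ('i *: y)).
rewrite scalerN scalerA -expr2 sqr_i scaleN1r opprK => ->.
by rewrite (linN lT) ripNl opprK (linZ lT) rip_ii ripC.
Qed.

Lemma sa_quad_eq0 T : selfadjoint T -> (forall x, rip (T x) x = 0) -> T = 0.
Proof.
move=> sT h; apply/funext => x; apply: rip_eq => y; rewrite rip0l.
have := h (x + y); rewrite (linD (bop_lin (sa_bop sT))) ripDl !ripDr !h.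
rewrite [rip (T y) x]ripC -(sa_rip x y sT); lra.
Qed.

Lemma sa_hdot T x : selfadjoint T -> hdot (T x) x = (rip (T x) x)%:C.
Proof.
move=> sT; rewrite hdotE; congr Complex.
have := sa_rip x ('i *: x) sT; rewrite (linZ (bop_lin (sa_bop sT))).
have := rip_ir x (T x); rewrite (ripC ('i *: x)); lra.
Qed.

Lemma positive_opP T :
  positive_op T <-> selfadjoint T /\ forall x, 0 <= rip (T x) x.
Proof.
split=> [[hT h]|[sT h]].
  split=> [|x].
    apply: sym_of_real => // x.
    by have := h x; rewrite hdotE lecE /= => /andP[/eqP].
  by have := h x; rewrite hdotE lecE /= => /andP[_].
by split=> [|x]; [exact: sa_bop|rewrite sa_hdot // ler0c].
Qed.

Lemma projectionP (P : H -> H) : projection P <->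
  selfadjoint P /\ forall x, P (P x) = P x.
Proof.
split=> -[sP h]; split=> //; last exact/funext.
by move=> x; rewrite -[in RHS]h.
Qed.

Lemma range_proj P x : projection P -> range P x <-> P x = x.
Proof.
move=> /projectionP[_ h]; split=> [[y _ <-]|<-]; first by rewrite h.
by exists x.
Qed.

Lemma proj_id : projection (id : H -> H).
Proof. by split=> //; exact: sa_id. Qed.

Lemma proj0 : projection (0 : H -> H).
Proof. by split=> //; exact: sa0. Qed.

Lemma projC P : projection P -> projection (id - P).
Proof.
move=> /projectionP[sP h]; apply/projectionP; split.
  by apply: saB => //; exact: sa_id.
by move=> x; rewrite !opBE /= (linB (bop_lin (sa_bop sP))) h subrr subr0.
Qed.

Lemma rip_proj P x : projection P -> rip (P x) x = hnrm (P x) ^+ 2.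
Proof. by move=> /projectionP[sP h]; rewrite sqr_hnrm -sa_rip ?h. Qed.

Lemma proj_pos P : projection P -> positive_op P.
Proof.
move=> hP; apply/positive_opP; split; first by case: hP.
by move=> x; rewrite rip_proj // sqr_ge0.
Qed.

Lemma proj_pythagoras P x : projection P ->
  hnrm x ^+ 2 = hnrm (P x) ^+ 2 + hnrm (x - P x) ^+ 2.
Proof. by move=> hP; rewrite sqr_hnrmB -(rip_proj x hP) (ripC x); lra. Qed.

Lemma proj_le P x : projection P -> hnrm (P x) <= hnrm x.
Proof.
move=> hP; rewrite -(ler_pXn2r (n:=2)) ?nnegrE ?hnrm_ge0 //.
by rewrite (proj_pythagoras x hP) lerDl sqr_ge0.
Qed.

Lemma proj_range_inj P Q : projection P -> projection Q ->
  range P = range Q -> P = Q.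
Proof.
move=> hP hQ rPQ; have [[bP aP] _] := hP; have [[bQ aQ] _] := hQ.
have PQ : P \o Q = Q.
  by apply/funext => x /=; apply/(range_proj _ hP); rewrite rPQ; exists x.
have QP : Q \o P = P.
  by apply/funext => x /=; apply/(range_proj _ hQ); rewrite -rPQ; exists x.
by rewrite -QP -[in LHS]aQ -[in LHS]aP -adjointM // PQ aQ.
Qed.

Lemma proj_ontoE P (V : set H) : projection P ->
  (forall x, P x = x <-> V x) -> proj_onto V = P.
Proof.
move=> hP hV; have rP : range P = V.
  by apply/seteqP; split=> x; rewrite -hV => /(range_proj _ hP).
have h : [set P | projection P /\ range P = V] P by [].
rewrite /proj_onto; have [hQ rQ] := xgetI 0 h.
by apply: proj_range_inj => //; rewrite rQ.
Qed.

End Adjoint.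

(** * Functionals determined by their moments *)

Section LocallyBounded.
Context {R : realType}.
Implicit Types (f g h : R -> R) (K M a : R).

(** Boundedness on every symmetric interval, rather than on one spectrum, makes the class the same
    for all operators and stable under composition. *)
Definition lbfun f := measurable_fun [set: measurableTypeR R] f /\
  forall K, exists C, forall y, `|y| <= K -> `|f y| <= C.

Lemma lb_cst a : lbfun (fun=> a).
Proof. by split; [exact: measurable_cst|move=> K; exists `|a|]. Qed.

Lemma lb_id : lbfun id.
Proof. by split; [exact: measurable_id|move=> K; exists K]. Qed.

Lemma lbD f g : lbfun f -> lbfun g -> lbfun (f \+ g).
Proof.
move=> [mf bf] [mg bg]; split; first exact: measurable_funD.
move=> K; have [C hC] := bf K; have [D hD] := bg K; exists (C + D) => y yK /=.
by rewrite (le_trans (ler_normD _ _)) // lerD ?hC ?hD.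
Qed.

Lemma lbM f g : lbfun f -> lbfun g -> lbfun (f \* g).
Proof.
move=> [mf bf] [mg bg]; split; first exact: measurable_funM.
move=> K; have [C hC] := bf K; have [D hD] := bg K; exists (C * D) => y yK /=.
by rewrite normrM ler_pM ?hC ?hD.
Qed.

Lemma lbZ a f : lbfun f -> lbfun (fun y => a * f y).
Proof. by move=> hf; exact: (lbM (lb_cst a) hf). Qed.

Lemma lbN f : lbfun f -> lbfun (fun y => - f y).
Proof.
move=> hf; rewrite (_ : (fun y => - f y) = (fun y => -1 * f y)); first exact: lbZ.
by apply/funext => y; rewrite mulN1r.
Qed.

Lemma lbB f g : lbfun f -> lbfun g -> lbfun (f \- g).
Proof. by move=> hf hg; exact: (lbD hf (lbN hg)). Qed.

Lemma lb_comp f g : lbfun f -> lbfun g -> lbfun (f \o g).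
Proof.
move=> [mf bf] [mg bg]; split; first exact: measurableT_comp.
by move=> K; have [C hC] := bg K; have [D hD] := bf C; exists D => y /hC/hD.
Qed.

Lemma lbX n f : lbfun f -> lbfun (fun y => f y ^+ n).
Proof.
move=> hf; elim: n => [|n ih].
  rewrite (_ : (fun y => f y ^+ 0) = fun=> 1); first exact: lb_cst.
  by apply/funext => y; rewrite expr0.
rewrite (_ : (fun y => f y ^+ n.+1) = f \* (fun y => f y ^+ n)); first exact: lbM.
by apply/funext => y; rewrite exprS.
Qed.

Lemma lb_expr n : lbfun (fun y => y ^+ n).
Proof. exact/lbX/lb_id. Qed.

Lemma lb_indic (S : set (measurableTypeR R)) : measurable S -> lbfun (\1_S).
Proof.
move=> mS; split; first exact: measurable_indic.
by move=> K; exists 1 => y _; rewrite indicE; case: (_ \in _); rewrite ?normr1 ?normr0.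
Qed.

Lemma lb_norm f : lbfun f -> lbfun (fun y => `|f y|).
Proof.
move=> hf; have hn : lbfun (@Num.norm _ R : R -> R).
  split; first exact: (@normr_measurable R setT).
  by move=> K; exists K => y; rewrite normr_id.
exact: lb_comp hn hf.
Qed.

Lemma lb_sum (I : Type) (r : seq I) (F : I -> R -> R) :
  (forall i, lbfun (F i)) -> lbfun (fun y => \sum_(i <- r) F i y).
Proof.
move=> hF; elim: r => [|i r ih].
  rewrite (_ : (fun y => \sum_(i <- [::]) F i y) = fun=> 0); first exact: lb_cst.
  by apply/funext => y; rewrite big_nil.
rewrite (_ : (fun y => \sum_(j <- i :: r) F j y) =
  F i \+ (fun y => \sum_(i <- r) F i y)); first exact: lbD.
by apply/funext => y; rewrite big_cons.
Qed.

Lemma lb_poly (p : {poly R}) : lbfun (fun y => p.[y]).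
Proof.
rewrite (_ : (fun y => _) = fun y => \sum_(i < size p) p`_i * y ^+ i).
  by apply: lb_sum => i; apply/lbZ/lb_expr.
by apply/funext => y; rewrite horner_coef.
Qed.

(* Linear functionals that are continuous for bounded pointwise convergence
   on [- M, M], such as integration against a finite measure on [- M, M]. *)
Record sigma_functional M (l : (R -> R) -> R) : Prop := {
  sfD : forall f g, lbfun f -> lbfun g -> l (f \+ g) = l f + l g ;
  sfZ : forall a f, lbfun f -> l (fun y => a * f y) = a * l f ;
  sf_cvg : forall (f_ : nat -> R -> R) f K, (forall n, lbfun (f_ n)) -> lbfun f ->
    (forall n y, `|y| <= M -> `|f_ n y| <= K) ->
    (forall y, `|y| <= M -> f_ n y @[n --> \oo] --> f y) ->
    l (f_ n) @[n --> \oo] --> l f }.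

Section Uniqueness.
Variables (M : R) (l : (R -> R) -> R) (hl : sigma_functional M l).

Lemma sf0 : l (fun=> 0) = 0.
Proof.
rewrite -[RHS](mul0r (l (fun=> 0))) -(sfZ hl 0 (lb_cst 0)).
by congr l; apply/funext => y; rewrite mul0r.
Qed.

(** The constant sequence [f] converges to [g] on [- M, M], the only place where convergence is
    asked for, so [l f] converges to [l g]. *)
Lemma sf_ext f g : lbfun f -> lbfun g ->
  (forall y, `|y| <= M -> f y = g y) -> l f = l g.
Proof.
move=> hf hg e; have [C hC] := hf.2 M.
have h1 : l f @[n --> \oo] --> l g.
  apply: (sf_cvg hl (f_ := fun=> f) (K := C)) => // y yM.
  by rewrite -(e y yM); exact: cvg_cst.
have h2 : l f @[n --> \oo] --> l f by exact: cvg_cst.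
exact: (cvg_unique _ h2 h1).
Qed.

Lemma sf_sum (I : Type) (r : seq I) (F : I -> R -> R) :
  (forall i, lbfun (F i)) ->
  l (fun y => \sum_(i <- r) F i y) = \sum_(i <- r) l (F i).
Proof.
move=> hF; elim: r => [|i r ih].
  rewrite big_nil -[RHS]sf0; congr (l _); apply/funext => y.
  by rewrite big_nil.
rewrite big_cons -ih -(sfD hl) //; last exact: lb_sum.
by congr l; apply/funext => y; rewrite big_cons.
Qed.

Lemma sf_eq0_cvg (f_ : nat -> R -> R) f K :
  (forall n, lbfun (f_ n)) -> lbfun f ->
  (forall n y, `|y| <= M -> `|f_ n y| <= K) ->
  (forall y, `|y| <= M -> f_ n y @[n --> \oo] --> f y) ->
  (forall n, l (f_ n) = 0) -> l f = 0.
Proof.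
move=> lf_ lf bf cf l0; have := sf_cvg hl lf_ lf bf cf.
under eq_fun do rewrite l0.
by move=> h; apply/esym/(cvg_unique _ _ h) => //; exact: cvg_cst.
Qed.

Hypothesis lX : forall n, l (fun y => y ^+ n) = 0.

Lemma sf_poly (p : {poly R}) : l (fun y => p.[y]) = 0.
Proof.
rewrite (_ : (fun y => _) = fun y => \sum_(i < size p) p`_i * y ^+ i); last first.
  by apply/funext => y; rewrite horner_coef.
rewrite sf_sum => [|i]; last exact/lbZ/lb_expr.
by apply: big1 => i _; rewrite (sfZ hl) ?lX ?mulr0 //; exact: lb_expr.
Qed.

End Uniqueness.
End LocallyBounded.

(* The iterates of the smoothstep polynomial converge on [0, 1] to a step
   function with jump at 1/2, whose value at the jump is again 1/2. *)
Section SmoothStep.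
Context {R : realType}.
Implicit Types (z c : R).

Definition smooth z : R := z ^+ 2 * (3 - 2 * z).

Lemma smooth_itv z : 0 <= z <= 1 -> 0 <= smooth z <= 1.
Proof.
rewrite /smooth => /andP[z0 z1]; apply/andP; split.
  by rewrite mulr_ge0 ?sqr_ge0 //; lra.
have -> : z ^+ 2 * (3 - 2 * z) = 1 - (1 - z) ^+ 2 * (1 + 2 * z) by ring.
by rewrite gerBl mulr_ge0 ?sqr_ge0 //; lra.
Qed.

Lemma smoothC z : smooth (1 - z) = 1 - smooth z.
Proof. rewrite /smooth; ring. Qed.

Lemma iter_smooth_itv n z : 0 <= z <= 1 -> 0 <= iter n smooth z <= 1.
Proof. by move=> hz; elim: n => //= n; exact: smooth_itv. Qed.

Lemma iter_smoothC n z : iter n smooth (1 - z) = 1 - iter n smooth z.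
Proof. by elim: n => //= n ->; rewrite smoothC. Qed.

Lemma iter_smooth_half n : iter n smooth 2^-1 = 2^-1.
Proof. elim: n => //= n ->; by rewrite /smooth; field. Qed.

(* smooth z / z = 3 z - 2 z^2 increases on [0, 1/2] to its value 1. *)
Lemma iter_smooth_le n z c : 0 <= z <= c -> c < 2^-1 ->
  iter n smooth z <= (3 * c - 2 * c ^+ 2) ^+ n * c.
Proof.
move=> /andP[z0 zc] c2.
suff : 0 <= iter n smooth z /\ iter n smooth z <= (3 * c - 2 * c ^+ 2) ^+ n * c by case.
have r0 : 0 <= 3 * c - 2 * c ^+ 2 by rewrite expr2; nra.
have r1 : 3 * c - 2 * c ^+ 2 <= 1 by rewrite expr2; nra.
elim: n => [|n [ih1 ih2]]; first by rewrite expr0 mul1r.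
have ihc : iter n smooth z <= c.
  by rewrite (le_trans ih2) // ler_piMl ?exprn_ile1 //; lra.
rewrite iterS; set w := iter n smooth z in ih1 ih2 ihc *.
split; first by rewrite /smooth mulr_ge0 ?sqr_ge0 //; lra.
rewrite exprS -mulrA; apply: (@le_trans _ _ ((3 * c - 2 * c ^+ 2) * w)).
  rewrite /smooth (_ : w ^+ 2 * _ = (w * (3 - 2 * w)) * w); last by ring.
  by rewrite ler_wpM2r // !expr2; nra.
by rewrite ler_wpM2l.
Qed.

Lemma smooth_rate c : 0 <= c < 2^-1 ->
  (3 * c - 2 * c ^+ 2) ^+ n * c @[n --> \oo] --> (0 : R).
Proof.
move=> /andP[c0 c2]; rewrite -[X in _ --> X](mul0r c); apply: cvgMl.
apply: cvg_expr; rewrite ger0_norm expr2; nra.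
Qed.

Lemma iter_smooth_cvg0 z : 0 <= z < 2^-1 -> iter n smooth z @[n --> \oo] --> (0 : R).
Proof.
move=> hz; have := smooth_rate hz; have /andP[z0 z2] := hz.
apply: squeeze_cvgr; last exact: cvg_cst.
near=> n; apply/andP; split.
  by have /andP[] : 0 <= iter n smooth z <= 1 by apply: iter_smooth_itv; lra.
by apply: iter_smooth_le; rewrite ?z0 ?lexx.
Unshelve. all: by end_near. Qed.

Lemma iter_smooth_cvg1 z : 2^-1 < z <= 1 -> iter n smooth z @[n --> \oo] --> (1 : R).
Proof.
move=> hz; have h : 0 <= 1 - z < 2^-1 by lra.
have := iter_smooth_cvg0 h.
under eq_fun do rewrite iter_smoothC.
move=> hc.
have h2 : (1 - (1 - iter n smooth z)) @[n --> \oo] --> (1 - 0 : R).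
  by apply: cvgB => //; exact: cvg_cst.
have e : (fun n => 1 - (1 - iter n smooth z)) = (fun n => iter n smooth z).
  by apply/funext => n; ring.
by rewrite e subr0 in h2.
Qed.

Lemma iter_smooth_poly n (p : {poly R}) :
  exists r : {poly R}, forall y, r.[y] = iter n smooth p.[y].
Proof.
elim: n => [|n [r hr]]; first by exists p.
exists (r ^+ 2 * (3%:P - 2%:P * r)) => y.
by rewrite !hornerE hr /= /smooth.
Qed.

End SmoothStep.

Section MomentUniqueness.
Import HBSimple HBNNSimple.
Context {R : realType}.
Implicit Types (f g h : R -> R) (K M a c : R).
Variables (M : R) (l : (R -> R) -> R) (hl : sigma_functional M l).
Hypothesis lX : forall n, l (fun y => y ^+ n) = 0.

Let lb_half c : lbfun (fun y => 2^-1 * (\1_(`[c, +oo[) y + \1_(`]c, +oo[) y)).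
Proof. by apply: lbZ; apply: lbD; apply: lb_indic; exact: measurable_itv. Qed.

(** The affine polynomial [p] maps [- M, M] into [0, 1] and [c] to 1/2; [K] is large enough for this
    whatever the position of [c]. Its smoothstep iterates are polynomials, killed by [l], and tend
    to the step with value 1/2 at [c], which is the mean of the indicators of the closed and the
    open ray. *)
Lemma sf_half_step c : l (fun y => 2^-1 * (\1_(`[c, +oo[) y + \1_(`]c, +oo[) y)) = 0.
Proof.
pose K := `|M| + `|c| + 1.
have K0 : 0 < K by rewrite ltr_pwDr // addr_ge0.
pose p : {poly R} := ((2 * K)^-1)%:P * ('X - c%:P) + (2^-1)%:P.
have pE y : p.[y] = (2 * K)^-1 * (y - c) + 2^-1 by rewrite !hornerE.
have p01 y : `|y| <= M -> 0 <= p.[y] <= 1.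
  move=> yM; have : `|(2 * K)^-1 * (y - c)| <= 2^-1.
    rewrite normrM ger0_norm ?invr_ge0 ?mulr_ge0 ?(ltW K0) // invfM -mulrA.
    rewrite ler_piMr ?invr_ge0 // mulrC ler_pdivrMr // mul1r.
    rewrite (le_trans (ler_normB _ _)) // /K.
    by have := ler_norm M; lra.
  by rewrite ler_norml pE => /andP[h1 h2]; lra.
have /choice[r hr] := fun n => iter_smooth_poly n p.
apply: (sf_eq0_cvg hl (f_ := fun n y => (r n).[y]) (K := 1)) => //.
- by move=> n; exact: lb_poly.
- move=> n y yM; rewrite hr.
  by have /andP[h0 h1] := iter_smooth_itv n (p01 y yM); rewrite ger0_norm.
- move=> y yM; under eq_fun do rewrite hr.
  have pl : (p.[y] < 2^-1) = (y < c).
    by rewrite pE gtrDr pmulr_rlt0 ?subr_lt0 // invr_gt0 mulr_gt0.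
  have pg : (2^-1 < p.[y]) = (c < y).
    by rewrite pE ltrDr pmulr_rgt0 ?subr_gt0 // invr_gt0 mulr_gt0.
  rewrite !indicE !mem_setE !in_itv /= !andbT.
  have /andP[h0 h1] := p01 y yM.
  have [yc|yc|yc] := ltgtP c y.
  + rewrite (_ : 2^-1 * _ = 1 :> R); last by rewrite /=; field.
    apply: iter_smooth_cvg1; by rewrite pg yc.
  + by rewrite addr0 mulr0; apply: iter_smooth_cvg0; rewrite h0 pl.
  + have -> : p.[y] = 2^-1 by rewrite pE yc subrr mulr0 add0r.
    rewrite addr0 mulr1; under eq_fun do rewrite iter_smooth_half; exact: cvg_cst.
- by move=> n; exact: (sf_poly hl).
Qed.

(** Moving the jump to c - 1 / (n + 1) gets rid of the value 1/2 at [c]: the limit is the indicator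
    of the closed ray itself. *)
Lemma sf_ray c : l (\1_(`[c, +oo[)) = 0.
Proof.
apply: (sf_eq0_cvg hl (K := 1) (f_ := fun n y =>
  2^-1 * (\1_(`[c - n.+1%:R^-1, +oo[) y + \1_(`]c - n.+1%:R^-1, +oo[) y))) => //.
- by apply: lb_indic; exact: measurable_itv.
- move=> n y _; rewrite !indicE.
  by do 2 case: (_ \in _) => /=; rewrite ger0_norm; lra.
- move=> y _; rewrite indicE mem_setE in_itv /= andbT.
  have [cy|yc] := leP c y.
    apply: cvg_near_cst; near=> n; rewrite !indicE !mem_setE !in_itv /= !andbT.
    have hlt : c - n.+1%:R^-1 < y by rewrite ltrBlDr (le_lt_trans cy) // ltrDl.
    by rewrite hlt (ltW hlt) /=; lra.
  apply: cvg_near_cst.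
  near=> n; rewrite !indicE !mem_setE !in_itv /= !andbT.
  have hlt : y < c - n.+1%:R^-1.
    rewrite ltrBrDl -ltrBrDr; near: n.
    have cy : 0 < c - y by rewrite subr_gt0.
    exact: (near_infty_natSinv_lt (PosNum cy)).
  by rewrite (leNgt _ y) hlt (lt_gtF hlt) /=; lra.
- by move=> n; exact: sf_half_step.
Unshelve. all: by end_near. Qed.

(** Dynkin's theorem: closed rays form a generating family stable under intersection, complements
    follow from l(1) = 0, and disjoint unions from bounded convergence of the partial sums. *)
Lemma sf_indic (S : set (measurableTypeR R)) : measurable S -> l (\1_S) = 0.
Proof.
have l1 : l (fun=> 1) = 0.
  by rewrite -[RHS](lX 0); congr (l _); apply/funext => y; rewrite expr0.
move=> mS.
suff : forall S, <<s @RGenCInfty.G R>> S -> l (\1_S) = 0.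
  have mS' : (@ocitv R).-sigma.-measurable S by exact: mS.
  by apply; rewrite (RGenCInfty.measurableE R) in mS'.
clear S mS; apply: (@dynkin_induction _ (measurableTypeR R) (@RGenCInfty.G R)
  (fun S => l (\1_S) = 0) (RGenCInfty.measurableE R)).
- move=> _ _ [a ->] [b ->]; exists (Num.max a b).
  apply/seteqP; split=> y /=; rewrite !in_itv /= !andbT ge_max.
    by case=> -> ->.
  by move=> /andP[].
- by rewrite -[RHS]l1; congr (l _); apply/funext => y; rewrite indicT.
- by move=> _ [a ->]; exact: sf_ray.
- move=> T mT lT.
  have e : (fun=> 1 : R) = \1_T \+ \1_(~` T).
    apply/funext => y /=; rewrite !indicE in_setC.
    by case: (_ \in _); rewrite /= ?addr0 ?add0r.
  move: l1; rewrite e (sfD hl) ?lT ?add0r //; apply: lb_indic => //.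
  exact: measurableC.
- move=> F mF tF lF.
  have sumE n : (fun y => \sum_(i < n) \1_(F i) y : R) =
      \1_(\big[setU/set0]_(i < n) F i).
    elim: n => [|n ih].
      by apply/funext => y; rewrite !big_ord0 indicE in_set0.
    apply/funext => y; rewrite !big_ord_recr /=.
    have := congr1 (fun f : R -> R => f y) ih => /= ->.
    rewrite !indicE in_setU.
    case: (boolP (y \in F n)) => Fn; rewrite ?orbT ?addr0 ?orbF //.
    suff /negbTE-> : y \notin \big[setU/set0]_(i < n) F i by rewrite add0r.
    rewrite notin_setE -bigcup_mkord => -[k /= kn Fk].
    have := tF _ _ I I (ex_intro _ y (conj Fk (set_mem Fn))).
    by move: kn => /[swap] ->; rewrite ltnn.
  apply: (sf_eq0_cvg hl (f_ := fun n y => \sum_(i < n) \1_(F i) y) (K := 1)).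
  + by move=> n; apply: lb_sum => i; exact: lb_indic.
  + by apply: lb_indic; exact: bigcupT_measurable.
  + move=> n y _; rewrite (congr1 (fun f : R -> R => f y) (sumE n)) indicE.
    by case: (_ \in _); rewrite ?normr1 ?normr0.
  + move=> y _; rewrite indicE; case: (boolP (y \in _)).
      rewrite inE => -[k _ Fk]; apply: cvg_near_cst; near=> n.
      rewrite (congr1 (fun f : R -> R => f y) (sumE n)) indicE mem_set //.
      by rewrite -bigcup_mkord; exists k => //=; near: n; exists k.+1.
    rewrite notin_setE => nF; apply: cvg_near_cst; near=> n.
    rewrite (congr1 (fun f : R -> R => f y) (sumE n)) indicE memNset //.
    by rewrite -bigcup_mkord => -[k _ Fk]; apply: nF; exists k.
  + by move=> n; rewrite (sf_sum hl) ?big1 // => i; exact: lb_indic.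
Unshelve. all: by end_near. Qed.

(** After a shift by its bound on [- M, M], [f] is a bounded increasing limit of simple functions
    there, and these are combinations of indicators. *)
Theorem sf_moments f : lbfun f -> l f = 0.
Proof.
move=> hf; have [C hC] := hf.2 M.
(* The absolute value changes nothing on [- M, M] and makes the function nonnegative on the whole
   line, as approximation by simple functions requires. *)
pose g y := `|f y + C|.
have C0 y : `|y| <= M -> 0 <= f y + C.
  by move=> /hC; rewrite ler_norml => /andP[]; lra.
have lbg : lbfun g by apply: lb_norm; apply: lbD => //; exact: lb_cst.
suff lg : l g = 0.
  have e : l g = l (f \+ (fun=> C)).
    apply: (sf_ext hl) => //; first by apply: lbD => //; exact: lb_cst.
    by move=> y /C0 h; rewrite /g ger0_norm.
  have lC : l (fun=> C) = 0.
    by have := sf_poly hl lX C%:P; under eq_fun do rewrite hornerC.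
  by move: lg; rewrite e (sfD hl) // ?lC ?addr0 //; exact: lb_cst.
have mg : measurable_fun [set: measurableTypeR R] (EFin \o g).
  by apply/measurable_EFinP; exact: lbg.1.
pose s n := nnsfun_approx measurableT mg n.
have g0 y : [set: measurableTypeR R] y -> (0 <= (EFin \o g) y)%E.
  by move=> _; rewrite lee_fin /g.
have sE n : (s n : measurableTypeR R -> R) = fun y => \sum_(a <- finmap.enum_fset (fset_set (range (s n))))
    a * \1_(s n @^-1` [set a]) y.
  by apply/funext => y; rewrite {1}fimfunE fsbig_finite //=.
have ms n a : measurable (s n @^-1` [set a]).
  by apply: measurable_sfunP; exact: measurable_set1.
have lbs n : lbfun (s n).
  by rewrite sE; apply: lb_sum => a; apply/lbZ/lb_indic.
have sg y : s n y @[n --> \oo] --> g y.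
  have hc := cvg_nnsfun_approx measurableT mg g0 (x := y) I.
  exact: (fine_cvg hc).
have [D hD] := lbg.2 M.
apply: (sf_eq0_cvg hl (f_ := fun n => s n : measurableTypeR R -> R) (K := D)) => //.
- move=> n y yM; rewrite ger0_norm ?fun_ge0 //.
  apply: le_trans (hD y yM); rewrite ger0_norm /g ?normr_ge0 // -/(g y).
  rewrite -(cvg_lim _ (sg y)) //.
  apply: (@nondecreasing_cvgn_le _ (fun n => s n y) _ _ n).
    by move=> a b ab; have /lefP/(_ y) := nd_nnsfun_approx measurableT mg ab.
  by apply/cvg_ex; exists (g y); exact: sg.
- move=> n; rewrite sE (sf_sum hl).
    by apply: big1 => a _; rewrite (sfZ hl) ?sf_indic ?mulr0 //; exact: lb_indic.
  by move=> a; apply/lbZ/lb_indic.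
Qed.

End MomentUniqueness.

(** * Operations on functionals, and integration as an example *)

Section SigmaFunctionals.
Context {R : realType}.
Implicit Types (f g h : R -> R) (K M a c : R) (l : (R -> R) -> R).

(** Brings functionals attached to operators of different norms to one common interval, where their
    moments can be compared. *)
Lemma sf_wide M M' l : M <= M' -> sigma_functional M l -> sigma_functional M' l.
Proof.
move=> MM' hl; split; [exact: sfD hl|exact: sfZ hl|].
move=> f_ f K lf_ lf bf cf; apply: (sf_cvg hl (K := K)) => //.
  by move=> n y yM; apply: bf; exact: le_trans MM'.
by move=> y yM; apply: cf; exact: le_trans MM'.
Qed.

Lemma sf_plus M l1 l2 : sigma_functional M l1 -> sigma_functional M l2 ->
  sigma_functional M (fun f => l1 f + l2 f).
Proof.
move=> h1 h2; split.
- by move=> f g lf lg; rewrite (sfD h1) // (sfD h2) // addrACA.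
- by move=> a f lf; rewrite (sfZ h1) // (sfZ h2) // mulrDr.
- move=> f_ f K lf_ lf bf cf; apply: cvgD.
    exact: (sf_cvg h1 lf_ lf bf cf).
  exact: (sf_cvg h2 lf_ lf bf cf).
Qed.

Lemma sf_scale M a l : sigma_functional M l -> sigma_functional M (fun f => a * l f).
Proof.
move=> hl; split.
- by move=> f g lf lg; rewrite (sfD hl) // mulrDr.
- by move=> b f lf; rewrite (sfZ hl) // mulrCA.
- move=> f_ f K lf_ lf bf cf; apply: cvgMr.
  exact: (sf_cvg hl lf_ lf bf cf).
Qed.

Lemma sf_minus M l1 l2 : sigma_functional M l1 -> sigma_functional M l2 ->
  sigma_functional M (fun f => l1 f - l2 f).
Proof.
move=> h1 /(sf_scale (-1)) h2; rewrite (_ : (fun f => l1 f - l2 f) =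
  (fun f => l1 f + -1 * l2 f)); first exact: sf_plus.
by apply/funext => f; rewrite mulN1r.
Qed.

Lemma sf_weight M g l : lbfun g -> sigma_functional M l ->
  sigma_functional M (fun f => l (f \* g)).
Proof.
move=> lg hl; split.
- move=> f h lf lh; rewrite -(sfD hl); [|exact: lbM..].
  by congr (l _); apply/funext => y /=; rewrite mulrDl.
- move=> a f lf; rewrite -(sfZ hl); last exact: lbM.
  by congr (l _); apply/funext => y /=; rewrite mulrA.
- move=> f_ f K lf_ lf bf cf; have [C hC] := lg.2 M.
  apply: (sf_cvg hl (K := K * C)).
  + by move=> n; exact: lbM.
  + exact: lbM.
  + by move=> n y yM; rewrite normrM ler_pM ?bf ?hC.
  + by move=> y yM; apply: cvgMl; exact: cf.
Qed.

Lemma sf_comp M M' g l : lbfun g -> (forall y, `|y| <= M -> `|g y| <= M') ->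
  sigma_functional M l -> sigma_functional M' (fun f => l (f \o g)).
Proof.
move=> lg gM hl; split.
- by move=> f h lf lh; rewrite -(sfD hl) //; exact: lb_comp.
- by move=> a f lf; rewrite -(sfZ hl) //; exact: lb_comp.
- move=> f_ f K lf_ lf bf cf; apply: (sf_cvg hl (K := K)).
  + by move=> n; exact: lb_comp.
  + exact: lb_comp.
  + by move=> n y /gM; exact: bf.
  + by move=> y /gM; exact: cf.
Qed.

Lemma sf_eval M c : `|c| <= M -> sigma_functional M (fun f => f c).
Proof. by move=> cM; split=> // f_ f K _ _ _; apply. Qed.

Section Integral.
Variables (m : {measure set (measurableTypeR R) -> \bar R}).
Hypothesis mfin : (m setT < +oo)%E.

Lemma measurable_sym_itv M : measurable (`[- M, M] : set (measurableTypeR R)).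
Proof. exact: measurable_itv. Qed.

Lemma measure_fin (S : set (measurableTypeR R)) : measurable S -> (m S < +oo)%E.
Proof. by move=> mS; apply: le_lt_trans mfin; apply: le_measure; rewrite ?inE. Qed.

Lemma in_sym_itv M y : (`[- M, M]%classic y) = (`|y| <= M).
Proof. by rewrite /= in_itv /= ler_norml. Qed.

Lemma lb_integrable M f : lbfun f -> m.-integrable `[- M, M] (EFin \o f).
Proof.
move=> lf; have [C hC] := lf.2 M.
apply: measurable_bounded_integrable.
- exact: measurable_sym_itv.
- by apply: measure_fin; exact: measurable_sym_itv.
- by apply: measurable_funTS; exact: lf.1.
- exists C; split=> [|z Cz y]; first exact: num_real.
  rewrite in_sym_itv => yM /=.
  by rewrite (le_trans (hC y yM)) // ltW.
Qed.

Lemma sf_integral M :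
  sigma_functional M (fun f => \int[m]_(y in `[- M, M]) f y).
Proof.
split.
- by move=> f g lf lg; rewrite -RintegralD //; exact: lb_integrable.
- by move=> a f lf; rewrite RintegralZl //; exact: lb_integrable.
- move=> f_ f K lf_ lf bf cf; apply: fine_cvg.
  rewrite fineK; last first.
    by apply: integrable_fin_num => //; exact: lb_integrable.
  apply: (@dominated_cvg _ _ _ m _ (measurable_sym_itv M)
     (fun n => EFin \o f_ n) (EFin \o f) (fun=> K%:E)).
  + by move=> n; apply/measurable_EFinP/measurable_funTS; exact: (lf_ n).1.
  + move=> y; rewrite in_sym_itv => yM.
    by apply: cvg_EFin; [exact: nearW|exact: cf].
  + by [].
  + by apply: lb_integrable; exact: lb_cst.
  + by move=> n y; rewrite in_sym_itv => yM; rewrite lee_fin bf.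
Qed.

Lemma le_lb_integral M f g : lbfun f -> lbfun g ->
  (forall y, `|y| <= M -> f y <= g y) ->
  \int[m]_(y in `[- M, M]) f y <= \int[m]_(y in `[- M, M]) g y.
Proof.
move=> lf lg fg; apply: le_Rintegral; [exact: measurable_sym_itv|exact: lb_integrable..|].
by move=> y; rewrite in_sym_itv; exact: fg.
Qed.

End Integral.
End SigmaFunctionals.

(* Riesz representation on an interval, for functionals on polynomials: the
   distribution function of the measure is the infimum of L p over the
   polynomials p dominating the indicator of ]-oo, c]. *)
Section PositiveFunctional.
Context {R : realType}.
Implicit Types (p q : {poly R}) (c y z e : R).
Variables (M : R) (L : {poly R} -> R).
Hypotheses (M0 : 0 <= M) (LD : forall p q, L (p + q) = L p + L q).
Hypothesis LZ : forall a p, L (a%:P * p) = a * L p.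
Hypothesis Lpos : forall p, (forall y, `|y| <= M -> 0 <= p.[y]) -> 0 <= L p.

Lemma pfN p : L (- p) = - L p.
Proof. by rewrite -mulN1r -[-1]/(- 1%:P) -polyCN LZ mulN1r. Qed.
Lemma pfB p q : L (p - q) = L p - L q.
Proof. by rewrite LD pfN. Qed.
Lemma pf0 : L 0 = 0.
Proof. by rewrite -[0 in LHS](mul0r 0) -[0 * _]/((0 : {poly R}) * 0) -polyC0 LZ mul0r. Qed.
Lemma pf_const a : L a%:P = a * L 1.
Proof. by rewrite -LZ mulr1. Qed.
Lemma pf_sum n (F : nat -> {poly R}) : L (\sum_(i < n) F i) = \sum_(i < n) L (F i).
Proof. by apply: big_morph; [exact: LD|exact: pf0]. Qed.
Lemma pf_le p q : (forall y, `|y| <= M -> p.[y] <= q.[y]) -> L p <= L q.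
Proof.
move=> pq; rewrite -subr_ge0 -pfB; apply: Lpos => y yM.
by rewrite hornerD hornerN subr_ge0 pq.
Qed.
Lemma pf1_ge0 : 0 <= L 1.
Proof. by apply: Lpos => y _; rewrite hornerC. Qed.

Definition dominating c : set {poly R} := [set p | forall y, `|y| <= M ->
  0 <= p.[y] /\ (y <= c -> 1 <= p.[y])].

Definition distr c : R := inf [set L p | p in dominating c].

Lemma distr_has_inf c : has_inf [set L p | p in dominating c].
Proof.
split; first by exists (L 1); exists 1 => // y _; rewrite hornerC.
by exists 0 => _ [p hp <-]; apply: Lpos => y /hp[].
Qed.

Lemma distr_le c p : dominating c p -> distr c <= L p.
Proof. by move=> hp; apply: ge_inf; [exact: (distr_has_inf c).2|exists p]. Qed.

Lemma distr_adherent c e : 0 < e -> exists2 p, dominating c p & L p < distr c + e.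
Proof.
by move=> e0; have [_ [p hp <-] h] := inf_adherent e0 (distr_has_inf c); exists p.
Qed.

Lemma distr_nd : nondecreasing distr.
Proof.
move=> c c' cc'; apply: lb_le_inf; first exact: (distr_has_inf c').1.
move=> _ [p hp <-]; apply: distr_le => y yM; have [h1 h2] := hp y yM.
by split=> // yc; apply: h2; exact: le_trans cc'.
Qed.

Lemma distr_lo c : c < - M -> distr c = 0.
Proof.
move=> cM; apply/eqP; rewrite eq_le; apply/andP; split; last first.
  apply: lb_le_inf; first exact: (distr_has_inf c).1.
  by move=> _ [p hp <-]; apply: Lpos => y /hp[].
rewrite -pf0; apply: distr_le => y; rewrite ler_norml horner0 => /andP[yM _].
by split=> // yc; move: yM; rewrite leNgt (le_lt_trans yc cM).
Qed.

Lemma distr_hi c : M <= c -> distr c = L 1.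
Proof.
move=> cM; apply/eqP; rewrite eq_le; apply/andP; split.
  by apply: distr_le => y _; rewrite hornerC.
apply: lb_le_inf; first exact: (distr_has_inf c).1.
move=> _ [p hp <-]; apply: pf_le => y yM; rewrite hornerC.
have [_ ->//] := hp y yM; rewrite (le_trans _ cM) //.
by move: yM; rewrite ler_norml => /andP[].
Qed.

(** If [p] is nearly optimal for [c], then p(c) >= 1 and continuity of [p] keep [p + eta] above 1
    slightly beyond [c], at the price eta L(1). For c < - M the function vanishes near [c]. *)
Lemma distr_rc : right_continuous distr.
Proof.
move=> c; apply/cvgrPdist_lt => e e0.
suff [d d0 hd] : exists2 d, 0 < d & distr (c + d) < distr c + e.
  near=> z; have cz : c < z by [].
  have zd : z < c + d by near: z; apply: nbhs_right_lt; rewrite ltrDl.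
  rewrite ler0_norm ?subr_le0 ?distr_nd ?ltW // opprB ltrBlDr addrC.
  by apply: le_lt_trans hd; apply: distr_nd; exact: ltW.
have [cM|cM] := ltP c (- M).
  exists ((- M - c) / 2); first by rewrite divr_gt0 // subr_gt0.
  by rewrite !distr_lo ?add0r //; lra.
(* The summand 1 is there because [L 1] may vanish. *)
pose eta := e / 2 / (L 1 + 1).
have L1 : 0 < L 1 + 1 by have := pf1_ge0; lra.
have eta0 : 0 < eta by rewrite !divr_gt0.
have e2 : 0 < e / 2 by rewrite divr_gt0.
have [p hp pe] := distr_adherent c e2.
have cp : {for c, continuous (fun y => p.[y])} by exact: continuous_horner.
have := @cvgr_dist_lt _ _ _ _ (nbhs_filter c) _ _ cp _ eta0.
move=> /nbhs_ballP[d /= d0 hd].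
exists (d / 2); first by rewrite divr_gt0.
apply: (@le_lt_trans _ _ (L (p + eta%:P))); last first.
  rewrite LD pf_const; have : eta * L 1 < e / 2.
    rewrite /eta -mulrA gtr_pMr // mulrC ltr_pdivrMr // mul1r ltrDl.
    exact: ltr01.
  by move: pe; lra.
apply: distr_le => y yM; have [p0 p1] := hp y yM; rewrite hornerD hornerC.
split=> [|ycd]; first by rewrite addr_ge0 // ltW.
have [yc|cy] := leP y c; first by have := p1 yc; lra.
have cM' : `|c| <= M.
  by move: yM; rewrite !ler_norml => /andP[? ?]; apply/andP; split; lra.
have := (hp c cM').2 (lexx _).
have := hd y; rewrite /ball /= ltr0_norm ?subr_lt0 // opprB.
move=> /(_ ltac:(lra)); rewrite ltr_norml => /andP[]; lra.
Unshelve. all: by end_near. Qed.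

HB.instance Definition _ := isCumulative.Build R _ R distr distr_nd distr_rc.

Let m : {measure set (measurableTypeR R) -> \bar R} :=
  lebesgue_stieltjes_measure [the cumulative R R of distr].

Lemma distr_itvoc (a b : R) : a <= b -> m `]a, b]%classic = (distr b - distr a)%:E.
Proof.
move=> ab; rewrite /m /= /lebesgue_stieltjes_measure /measure_extension /=.
rewrite measurable_mu_extE; last exact: is_ocitv.
exact: wlength_itv_bnd.
Qed.

Lemma null_itvoc (a b : R) : a <= b -> distr a = distr b ->
  m.-negligible `]a, b]%classic.
Proof.
move=> ab e; exists `]a, b]%classic; split=> //.
by rewrite distr_itvoc // e subrr.
Qed.

(** Covers the complement of [- M, M] by countably many half-open intervals on which [distr] is
    constant. Those on the left stop at - M - 1 / (n + 1), since [distr] may jump at - M. *)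
Lemma outside_cover y : (y < - M) || (M < y) ->
  exists n, (- M - n.+1%:R < y /\ y <= - M - n.+1%:R^-1) \/ (M < y /\ y <= M + n%:R).
Proof.
pose k := Num.bound `|y|; have hk : `|y| < k%:R by exact: archi_boundP.
have := hk; rewrite ltr_norml => /andP[ky yk].
case/orP=> h; last by exists k; right; split=> //; have := M0; lra.
have d0 : 0 < - M - y by rewrite subr_gt0.
pose j := Num.bound (- M - y)^-1.
have hj : (- M - y)^-1 < j%:R by apply: archi_boundP; rewrite invr_ge0 ltW.
exists (k + j)%N; left; split.
  rewrite -addn1 !natrD; have : 0 <= j%:R :> R by []. 
  by have := M0; move: ky; lra.
rewrite lerBrDl -lerBrDr -[X in _ <= X]invrK lef_pV2 ?posrE ?invr_gt0 //.
by rewrite (le_trans (ltW hj)) // ler_nat -addnS -addSnnS leq_addl.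
Qed.

Lemma distr_supp : m (~` `[- M, M]) = 0%E.
Proof.
have mS : measurable (~` `[- M, M] : set (measurableTypeR R)).
  by apply: measurableC; exact: measurable_sym_itv.
apply/(measure_negligible (mu := m)) => //.
pose F n : set (measurableTypeR R) :=
  `]- M - n.+1%:R, - M - n.+1%:R^-1] `|` `]M, M + n%:R].
apply: (@negligibleS _ _ _ _ (\bigcup_n F n)).
  move=> y; rewrite /= in_itv /= => /negP; rewrite negb_and -!ltNge.
  case/(@outside_cover _) => n hn; exists n => //.
  by case: hn => [[h1 h2]|[h1 h2]]; [left|right]; rewrite /= in_itv /= h1 h2.
apply: negligible_bigcup => n; apply: negligibleU.
  have n1 : n.+1%:R^-1 <= n.+1%:R :> R by rewrite (@le_trans _ _ 1) ?invf_le1 ?ler1n.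
  have n0 : 0 < n.+1%:R^-1 :> R by [].
  by apply: null_itvoc; rewrite ?distr_lo ?lerB ?gtrBl //; apply: lt_le_trans n1.
by apply: null_itvoc; rewrite ?distr_hi // lerDl.
Qed.

Lemma distr_fin : (m setT < +oo)%E.
Proof.
have mS := measurable_sym_itv M.
have -> : setT = `[- M, M] `|` ~` `[- M, M] :> set (measurableTypeR R).
  by rewrite setUv.
apply: le_lt_trans (measureU2 m mS (measurableC mS)) _.
rewrite [X in (_ + X)%E]distr_supp adde0.
apply: (@le_lt_trans _ _ (m `]- M - 1, M]%classic)).
  apply: le_measure; rewrite ?inE //.
  by move=> y; rewrite /= !in_itv /= => /andP[h ->]; rewrite andbT; lra.
by rewrite distr_itvoc ?ltry //; have := M0; lra.
Qed.

Local Notation I f := (\int[m]_(y in `[- M, M]) f y).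

Lemma distr_ray c : `|c| <= M -> I (\1_(`]-oo, c])) = distr c.
Proof.
move=> cM; have mc : measurable (`]-oo, c] : set (measurableTypeR R)).
  exact: measurable_itv.
rewrite /Rintegral (integral_indic m (measurable_sym_itv M) mc).
have := cM; rewrite ler_norml => /andP[Mc cM'].
(* Starting at - M - 1, where [distr] is still 0, keeps a possible atom at - M inside the
   interval. *)
have -> : m (`]-oo, c]%classic `&` `[- M, M]%classic) = m `]- M - 1, c]%classic.
  apply/eqP; rewrite eq_le; apply/andP; split.
    apply: le_measure; rewrite ?inE; [|exact: measurable_itv|].
      by apply: measurableI => //; exact: measurable_sym_itv.
    move=> y [/=]; rewrite !in_itv /= => -> /andP[h _]; rewrite andbT; lra.
  rewrite -[leRHS]adde0 -distr_supp; apply: le_trans (measureU2 m _ _) => //.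
  - apply: le_measure; rewrite ?inE; [exact: measurable_itv| |].
      apply: measurableU; last by apply: measurableC; exact: measurable_sym_itv.
      by apply: measurableI => //; exact: measurable_sym_itv.
    move=> y; rewrite /= in_itv /= => /andP[_ yc].
    have [yM|yM] := pselect (`[- M, M]%classic y); last by right.
    by left; split=> //=; rewrite in_itv.
  - by apply: measurableI => //; exact: measurable_sym_itv.
  - by apply: measurableC; exact: measurable_sym_itv.
rewrite distr_itvoc /=; last by lra.
by rewrite (distr_lo (c := - M - 1)) ?subr0 //; lra.
Qed.

Let sfI : sigma_functional M (fun f => I f) := sf_integral distr_fin M.

Lemma distr_mass : I (fun=> 1) = L 1.
Proof.
rewrite -(distr_hi (lexx M)) -distr_ray ?ger0_norm ?M0 //.
apply: (sf_ext sfI) => [||y]; first exact: lb_cst.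
  by apply: lb_indic; exact: measurable_itv.
by rewrite ler_norml => /andP[_ yM]; rewrite indicE mem_set //= in_itv.
Qed.

Section Stairs.
Variables (g : R -> R) (lo k h : R).
Hypotheses (h0 : 0 <= h) (k0 : 0 <= k) (loM : lo <= - M).
Hypothesis g_lip : forall x y, lo <= x -> x <= y -> y <= M ->
  0 <= g x - g y <= k * (y - x).
Let c j := - M + h * j%:R.

(** Abel summation: a lower staircase for g - g(c n), with [g] nonincreasing, written with
    indicators of rays because their integrals are the values of [distr]. The bound [lo] leaves room
    to evaluate it to the left of - M. *)
Definition stairs n y :=
  \sum_(j < n) (g (c j) - g (c j.+1)) * \1_(`]-oo, c j]) y.

Let cS j : c j.+1 = c j + h.
Proof. by rewrite /c -addn1 natrD mulrDr mulr1 addrA. Qed.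
Let c_nd i j : (i <= j)%N -> c i <= c j.
Proof. by move=> ij; rewrite lerD2l ler_wpM2l // ler_nat. Qed.
Let c_lo j : lo <= c j.
Proof. by rewrite (le_trans loM) // lerDl mulr_ge0. Qed.

Lemma stairs_out n y : c n < y -> stairs n y = 0.
Proof.
move=> cy; apply: big1 => j _; rewrite indicE memNset ?mulr0 //= in_itv /=.
by apply/negP; rewrite -ltNge (le_lt_trans _ cy) // c_nd // ltnW.
Qed.

(** The sum telescopes to g at the first grid point not below [y], minus g(c n). The grid starts at
    - M, so only for y >= - M is that point within one mesh of [y]. *)
Lemma stairs_bound n y : lo <= y -> c n <= M -> y <= c n ->
  stairs n y <= g y - g (c n) /\ (- M <= y -> g y - g (c n) - k * h <= stairs n y).
Proof.
move=> ly; have kh0 : 0 <= k * h by exact: mulr_ge0.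
elim: n => [|n ih] cM yc.
  rewrite /stairs big_ord0; have /andP[h1 h2] := g_lip ly yc cM.
  split=> // My; have -> : y = c 0 by apply/eqP; rewrite eq_le yc /c mulr0 addr0.
  by rewrite subrr sub0r oppr_le0.
rewrite /stairs big_ord_recr /= -/(stairs n y) indicE.
have cnM : c n <= M by rewrite (le_trans _ cM) // c_nd.
have [ycn|cny] := leP y (c n).
  rewrite mem_set /= ?in_itv //= mulr1; have [h1 h2] := ih cnM ycn.
  by split=> [|/h2]; lra.
rewrite memNset /= ?in_itv /=; last by apply/negP; rewrite -ltNge.
rewrite mulr0 addr0 stairs_out //; have /andP[h1 h2] := g_lip ly yc cM.
split=> // _; have : k * (c n.+1 - y) <= k * h by rewrite ler_wpM2l // cS; lra.
lra.
Qed.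

Lemma stairs_lb n : lbfun (stairs n).
Proof. by apply: lb_sum => j; apply/lbZ/lb_indic; exact: measurable_itv. Qed.

Lemma stairs_integral n : c n <= M ->
  I (stairs n) = \sum_(j < n) (g (c j) - g (c j.+1)) * distr (c j).
Proof.
move=> cM; rewrite (sf_sum sfI) => [|j]; last first.
  by apply/lbZ/lb_indic; exact: measurable_itv.
apply: eq_bigr => j _; rewrite (sfZ sfI); last first.
  by apply: lb_indic; exact: measurable_itv.
rewrite distr_ray // ler_norml; apply/andP; split.
  by rewrite lerDl mulr_ge0.
by rewrite (le_trans _ cM) // c_nd // ltnW.
Qed.

End Stairs.

Lemma le_of_inv (x y C : R) : (forall n, x <= y + C * n.+1%:R^-1) -> x <= y.
Proof.
move=> hx; rewrite leNgt; apply/negP => yx.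
have xy : 0 < x - y by rewrite subr_gt0.
pose n := Num.bound (`|C| / (x - y)).
have hn : `|C| / (x - y) < n%:R by apply: archi_boundP; rewrite divr_ge0 // ltW.
have := hx n; rewrite leNgt => /negP; apply.
rewrite -ltrBrDl ltr_pdivrMr // mulrC -ltr_pdivrMr //.
rewrite (le_lt_trans _ (lt_trans hn _)) ?ltr_nat // ler_pM2r ?invr_gt0 //.
exact: ler_norm.
Qed.

Let gridM n : - M + 2 * M / n.+1%:R * n.+1%:R = M.
Proof. by rewrite divfK //; lra. Qed.

(** Replacing each ray in the staircase of [p] by a nearly optimal dominating polynomial gives a
    polynomial which, up to the mesh error, lies above p - p(M). Applying [L] turns the rays into
    values of [distr], hence into the integral of the staircase, which is below that of p - p(M). *)
Lemma le_distr_integral p (k : R) : 0 <= k ->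
  (forall x y, - M <= x -> x <= y -> y <= M -> 0 <= p.[x] - p.[y] <= k * (y - x)) ->
  L p <= I (fun y => p.[y]).
Proof.
(* The first constant is the slack in the dominating polynomials, weighted by increments of total at
   most 2 M k; the second is the mesh error k h L(1). *)
move=> k0 plip; apply: (@le_of_inv _ _ (2 * M * k + 2 * M * k * L 1)) => N.
have MM : - M <= M by rewrite ge0_cp.
pose h := 2 * M / N.+1%:R; pose e := N.+1%:R^-1 : R.
have h0 : 0 <= h by rewrite divr_ge0 // mulr_ge0.
have e0 : 0 < e by rewrite invr_gt0.
pose c j := - M + h * j%:R.
have cN : c N.+1 = M by exact: gridM.
pose a j := p.[c j] - p.[c j.+1].
have cSle j : (j < N.+1)%N -> c j <= c j.+1 /\ c j.+1 <= M.
  move=> jN; split; first by rewrite lerD2l ler_wpM2l // ler_nat.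
  by rewrite -cN lerD2l ler_wpM2l // ler_nat.
have a0 j : (j < N.+1)%N -> 0 <= a j.
  move=> /cSle[h1 h2]; have Mc : - M <= c j by rewrite lerDl mulr_ge0.
  by have /andP[] := plip _ _ Mc h1 h2.
have /choice[q hq] : forall j, exists q, dominating (c j) q /\ L q < distr (c j) + e.
  by move=> j; have [q h1 h2] := distr_adherent (c j) e0; exists q.
have sb := @stairs_bound (fun y => p.[y]) (- M) k h h0 k0 plip N.+1.
have up : L p - p.[M] * L 1 <= \sum_(j < N.+1) a j * L (q j) + k * h * L 1.
  rewrite -pf_const -pfB -(pf_const (k * h)).
  under eq_bigr do rewrite -LZ.
  rewrite -(pf_sum N.+1 (fun j => (a j)%:P * q j)) -LD; apply: pf_le => y yM.
  have := yM; rewrite ler_norml => /andP[My yM'].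
  rewrite hornerD hornerN (hornerD _ (k * h)%:P) !hornerC horner_sum.
  have := sb y My; rewrite -/(c N.+1) cN => /(_ (lexx _) yM')[_].
  move=> /(_ My) h1; rewrite -lerBlDr (le_trans h1) //.
  apply: ler_sum => j _; rewrite hornerM hornerC ler_wpM2l ?a0 //.
  have [q0 q1] := (hq j).1 y yM; rewrite indicE.
  have [yc|yc] := leP y (c j); first by rewrite mem_set ?q1 //= in_itv.
  by rewrite memNset // /= in_itv /=; apply/negP; rewrite -ltNge.
have low : \sum_(j < N.+1) a j * distr (c j) <= I (fun y => p.[y]) - p.[M] * L 1.
  rewrite -(stairs_integral (fun y => p.[y]) h0) -/(c N.+1) ?cN //.
  have -> : I (fun y => p.[y]) - p.[M] * L 1 = I (fun y => (p - p.[M]%:P).[y]).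
    have -> : (fun y => (p - p.[M]%:P).[y]) =
        (fun y => p.[y]) \+ (fun y => - p.[M] * (fun=> 1) y).
      by apply/funext => y; rewrite !hornerE /=; ring.
    rewrite (sfD sfI); [|exact: lb_poly|exact/lbZ/lb_cst].
    by rewrite (sfZ sfI (- p.[M]) (lb_cst 1)) distr_mass mulNr.
  apply: le_lb_integral; [exact: distr_fin|exact: stairs_lb|exact: lb_poly|].
  move=> y; rewrite ler_norml => /andP[My yM'].
  have := sb y My; rewrite -/(c N.+1) cN => /(_ (lexx _) yM')[h1 _].
  by rewrite !hornerE.
have mid : \sum_(j < N.+1) a j * L (q j) <=
    \sum_(j < N.+1) a j * distr (c j) + e * (p.[- M] - p.[M]).
  have -> : p.[- M] - p.[M] = \sum_(j < N.+1) a j.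
    have c0 : c 0 = - M by rewrite /c mulr0 addr0.
    rewrite -c0 -[X in _ - p.[X]]cN.
    elim: (N.+1) => [|n ih]; first by rewrite big_ord0 subrr.
    rewrite big_ord_recr /= -ih /a; ring.
  rewrite mulr_sumr -big_split /=; apply: ler_sum => j _.
  rewrite [e * _]mulrC -mulrDr ler_wpM2l ?a0 // ltW //; exact: (hq j).2.
have /andP[_ pM] := plip _ _ (lexx (- M)) MM (lexx M).
have pe : e * (p.[- M] - p.[M]) <= e * (k * (M - - M)) by rewrite ler_wpM2l // ltW.
have -> : (2 * M * k + 2 * M * k * L 1) / N.+1%:R =
  e * (k * (M - - M)) + k * h * L 1 by rewrite /e /h; field.
move: (e * (k * _)) (e * _) (k * h * _) (p.[M] * _) (I _) (L p) up low mid pe.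
move: (\sum_(j < _) _) (\sum_(j < _) _); clear; move=> *; lra.
Qed.

(** Smoothstep iterates of a decreasing affine map sending the midpoint [u] to 1/2; [d] is its
    distance from 1/2 at [c] and at [c'], and bounds the rate of convergence outside ]c, c'[. *)
Lemma smooth_step_poly c c' e : c < c' -> 0 < e -> exists p : {poly R},
  forall y, `|y| <= M -> [/\ 0 <= p.[y] <= 1, y <= c -> 1 - e <= p.[y] &
    c' <= y -> p.[y] <= e].
Proof.
move=> cc e0; pose K := M + `|c| + `|c'| + 1.
have K0 : 0 < K by rewrite ltr_pwDr // !addr_ge0.
pose u := (c + c') / 2; pose d := (c' - c) / (4 * K).
pose p : {poly R} := ((2 * K)^-1)%:P * (u%:P - 'X) + (2^-1)%:P.
have pE y : p.[y] = (u - y) / (2 * K) + 2^-1 by rewrite !hornerE mulrC.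
have p01 y : `|y| <= M -> 0 <= p.[y] <= 1.
  move=> yM; have : `|(u - y) / (2 * K)| <= 2^-1.
    rewrite normrM [`|_^-1|]ger0_norm ?invr_ge0 ?mulr_ge0 ?(ltW K0) //.
    rewrite ler_pdivrMr ?mulr_gt0 // mulrA mulVf // mul1r.
    have [h1 h2] := (ler_norm c, ler_norm c').
    have [h3 h4] : - `|c| <= c /\ - `|c'| <= c' by rewrite !lerNnormlW.
    move: yM; rewrite !ler_norml => /andP[h5 h6]; rewrite /u /K; apply/andP; split; lra.
  by rewrite ler_norml pE => /andP[h1 h2]; lra.
have d2 : 0 <= 2^-1 - d < 2^-1.
  have : 0 < d by rewrite divr_gt0 ?subr_gt0 // mulr_gt0.
  have : d <= 2^-1; last by lra.
  rewrite ler_pdivrMr ?mulr_gt0 //.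
  have [h2 h3] : c' <= `|c'| /\ - `|c| <= c by rewrite ler_norm lerNnormlW.
  rewrite mulrA /K; have := M0; lra.
have /andP[d20 d21] := d2.
have /cvgrPdist_lt/(_ e e0)[n _ /(_ n (leqnn _)) hn] := smooth_rate d2.
have {}hn : (3 * (2^-1 - d) - 2 * (2^-1 - d) ^+ 2) ^+ n * (2^-1 - d) <= e.
  rewrite (le_trans (ler_norm _)) // -normrN -sub0r; exact: ltW.
have [r hr] := iter_smooth_poly n p; exists r => y yM; rewrite hr.
have /andP[p0 p1] := p01 y yM.
split; first exact/iter_smooth_itv/p01.
- move=> yc; rewrite -[p.[y]](subKr 1) iter_smoothC lerB // (le_trans _ hn) //.
  apply: iter_smooth_le => //; rewrite subr_ge0 p1 /= pE /d /u.
  have -> : (c' - c) / (4 * K) = (c' - c) / 2 / (2 * K) by field; exact: lt0r_neq0.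
  have : (c - y) / (2 * K) >= 0 by rewrite divr_ge0 ?subr_ge0 // mulr_ge0 // ltW.
  lra.
- move=> yc; rewrite (le_trans _ hn) //.
  apply: iter_smooth_le => //; rewrite p0 /= pE /d /u.
  have -> : (c' - c) / (4 * K) = (c' - c) / 2 / (2 * K) by field; exact: lt0r_neq0.
  have : (y - c') / (2 * K) >= 0 by rewrite divr_ge0 ?subr_ge0 // mulr_ge0 // ltW.
  lra.
Qed.

(** [distr] is an infimum, so bounding it from above takes explicit dominating polynomials: a smooth
    step descending between two neighbouring grid points, raised by e. It exceeds the ray of the
    next grid point by at most 2 e, and summation against the mesh yields M - 'X up to small
    errors. *)
Lemma distr_integral_id : L 'X <= I id.
Proof.
(* For M = 0 the mesh is 0 and leaves no gap in which a step could descend. *)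
have [M1|M1] := eqVneq M 0.
  apply: (@le_trans _ _ 0).
    by rewrite -pf0; apply: pf_le => y; rewrite M1 normr_le0 hornerX horner0 => /eqP->.
  apply: Rintegral_ge0 => y; rewrite in_sym_itv M1 normr_le0 => /eqP->; exact: lexx.
have {}M1 : 0 < M by rewrite lt0r M1.
apply: (@le_of_inv _ _ ((2 * (2 * M) + 4 * M) * L 1)) => N.
pose h := 2 * M / N.+1%:R; pose e := N.+1%:R^-1 : R.
have h0 : 0 < h by rewrite divr_gt0 // mulr_gt0.
have e0 : 0 < e by rewrite invr_gt0.
pose c j := - M + h * j%:R.
have cN : c N.+1 = M by exact: gridM.
have cS j : c j.+1 = c j + h by rewrite /c -addn1 natrD mulrDr mulr1 addrA.
have /choice[r hr] : forall j, exists p : {poly R}, forall y, `|y| <= M ->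
    [/\ 0 <= p.[y] <= 1, y <= c j -> 1 - e <= p.[y] & c j.+1 <= y -> p.[y] <= e].
  by move=> j; apply: smooth_step_poly => //; rewrite cS ltrDl.
have lin x y : - M - h <= x -> x <= y -> y <= M -> 0 <= - x - - y <= 1 * (y - x).
  by move=> _ xy _; lra.
have loM : - M - h <= - M by rewrite gerBl ltW.
have sb := stairs_bound (ltW h0) ler01 lin (n := N.+1).
have stE y : stairs -%R h N.+1 y = \sum_(j < N.+1) h * \1_(`]-oo, c j]) y.
  apply: eq_bigr => j _; congr (_ * _).
  by rewrite -/(c j) -/(c j.+1) cS; ring.
have low : M * L 1 - I id - h * L 1 <= \sum_(j < N.+1) h * distr (c j).
  have -> : \sum_(j < N.+1) h * distr (c j) = I (stairs -%R h N.+1).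
    rewrite (stairs_integral -%R (ltW h0)) -/(c N.+1) ?cN //.
    by apply: eq_bigr => j _; rewrite -/(c j) -/(c j.+1) cS; congr (_ * _); ring.
  have -> : M * L 1 - I id - h * L 1 = I (fun y => ((M - h)%:P - 'X).[y]).
    have -> : (fun y => ((M - h)%:P - 'X).[y]) =
        (fun y => (M - h) * (fun=> 1) y) \+ (fun y => -1 * id y).
      by apply/funext => y; rewrite !hornerE /=; ring.
    rewrite (sfD sfI); [|exact/lbZ/lb_cst|exact/lbZ/lb_id].
    rewrite (sfZ sfI (M - h) (lb_cst 1)) (sfZ sfI (-1) lb_id) distr_mass; ring.
  apply: le_lb_integral; [exact: distr_fin|exact: lb_poly|exact: stairs_lb|].
  move=> y; rewrite ler_norml => /andP[My yM].
  have := sb y; rewrite -/(c N.+1) cN => /(_ ltac:(lra) (lexx _) yM)[_ /(_ My)].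
  by rewrite !hornerE; lra.
have up : \sum_(j < N.+1) h * distr (c j) <= M * L 1 - L 'X + (h + 4 * e * M) * L 1.
  apply: (@le_trans _ _ (L (\sum_(j < N.+1) h%:P * (r j + e%:P)))).
    rewrite (pf_sum N.+1 (fun j => h%:P * (r j + e%:P))).
    apply: ler_sum => j _; rewrite LZ ler_wpM2l ?(ltW h0) //.
    apply: distr_le => y yM; have [/andP[r0 r1] r2 r3] := hr j y yM.
    by rewrite !hornerE; split=> [|/r2]; lra.
  rewrite -pf_const -pfB -(pf_const (h + _)) -LD; apply: pf_le => y yM.
  have := yM; rewrite ler_norml => /andP[My yM'].
  rewrite horner_sum !hornerE /=.
  (* The ray of the grid point j + 1 at [y] is the ray of the grid point j at y - h; hence the lower
     end - M - h of the staircase. *)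
  apply: (@le_trans _ _ (\sum_(j < N.+1) (h * \1_(`]-oo, c j]) (y - h) + h * (2 * e)))).
    apply: ler_sum => j _; rewrite hornerM hornerD !hornerC -mulrDr.
    rewrite ler_wpM2l ?(ltW h0) //.
    have [/andP[r0 r1] r2 r3] := hr j y yM; rewrite indicE.
    have [yc|yc] := leP y (c j.+1).
      by rewrite mem_set /= ?in_itv /= ?lerBlDr -?cS //; lra.
    rewrite memNset /= ?in_itv /=; last by rewrite lerBlDr -cS; apply/negP; rewrite -ltNge.
    have := r3 (ltW yc); lra.
  rewrite big_split /= -stE sumr_const card_ord -[X in _ + X <= _]mulr_natl.
  have -> : N.+1%:R * (h * (2 * e)) = 4 * e * M by rewrite /h; field.
  have := sb (y - h); rewrite -/(c N.+1) cN => /(_ ltac:(lra) (lexx _) ltac:(lra))[].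
  lra.
have -> : (2 * (2 * M) + 4 * M) * L 1 / N.+1%:R = (2 * h + 4 * e * M) * L 1.
  by rewrite /h /e; field.
move: up low; lra.
Qed.

Lemma exprn_lip n : exists2 k : R, 0 <= k &
  forall x y, `|x| <= M -> `|y| <= M -> `|x ^+ n - y ^+ n| <= k * `|x - y|.
Proof.
elim: n => [|n [k k0 hk]]; first by exists 0 => // x y _ _; rewrite subrr normr0 mul0r.
have M0' := M0.
exists (M * k + M ^+ n) => [|x y xM yM]; first by rewrite addr_ge0 ?mulr_ge0 ?exprn_ge0.
have -> : x ^+ n.+1 - y ^+ n.+1 = x * (x ^+ n - y ^+ n) + (x - y) * y ^+ n.
  by rewrite !exprS; ring.
rewrite (le_trans (ler_normD _ _)) // !normrM mulrDl lerD //.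
  by rewrite -mulrA ler_pM ?hk.
by rewrite mulrC ler_wpM2r // normrX lerXn2r ?nnegrE.
Qed.

(** For a Lipschitz constant k of the power function, s 'X^n - k 'X is nonincreasing for s = 1 and s
    = - 1, so [le_distr_integral] applies to it; the term in 'X is removed by [distr_integral_id].
    The two signs give the two inequalities. *)
Theorem riesz_moments : exists m : {measure set (measurableTypeR R) -> \bar R},
  [/\ (m setT < +oo)%E, m (~` `[- M, M]) = 0%E &
    forall n, L 'X^n = \int[m]_(y in `[- M, M]) (y ^+ n)].
Proof.
exists m; split; [exact: distr_fin|exact: distr_supp|move=> n].
have [k k0 hk] := exprn_lip n.
have inM x y z : - M <= x -> x <= y -> y <= M -> `|x| <= M /\ `|y| <= M.
  by move=> *; rewrite !ler_norml; split; apply/andP; split; lra.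
have main (s : R) : `|s| = 1 -> s * L 'X^n <= s * I (fun y => y ^+ n).
  move=> s1; have := @le_distr_integral (s%:P * 'X^n - k%:P * 'X) (2 * k).
  rewrite pfB !LZ; have -> : I (fun y => (s%:P * 'X^n - k%:P * 'X).[y]) =
      s * I (fun y => y ^+ n) - k * I id.
    have -> : (fun y => (s%:P * 'X^n - k%:P * 'X).[y]) =
        (fun y => s * y ^+ n) \+ (fun y => - k * y).
      by apply/funext => y; rewrite !hornerE /=; ring.
    rewrite (sfD sfI) ?(sfZ sfI) ?mulNr //; try exact: lb_id; try exact: lb_expr.
    - exact/lbZ/lb_expr.
    - exact/lbZ/lb_id.
  have kX : k * L 'X <= k * I id by rewrite ler_wpM2l // distr_integral_id.
  move=> h.
  suff : s * L 'X^n - k * L 'X <= s * I (fun y => y ^+ n) - k * I id by lra.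
  apply: h => [|x y Mx xy yM]; first by rewrite mulr_ge0.
  have [xM' yM'] := inM x y 0 Mx xy yM; have := hk x y xM' yM'.
  have -> : `|x ^+ n - y ^+ n| = `|s * x ^+ n - s * y ^+ n|.
    by rewrite -mulrBr normrM s1 mul1r.
  rewrite (ler0_norm (x := x - y)) ?subr_le0 //.
  by rewrite ler_norml !hornerE => /andP[]; lra.
have := main 1 (normr1 _); have := main (-1) (normrN1 _); lra.
Qed.

End PositiveFunctional.

(** * Spectral measures *)

Section PolynomialPositivity.
Context {R : realType} {H : hilbertType R}.
Implicit Types (x y z : H) (T S A : H -> H) (a b d e K t : R)
  (p : {poly R}).

(* [<A(x + t A x), x + t A x> >= 0] at [t = - 1 / K]. *)
Lemma pos_op_norm_le A K x : selfadjoint A -> (forall y, 0 <= rip (A y) y) ->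
  0 < K -> opnorm A <= K -> hnrm (A x) ^+ 2 <= K * rip (A x) x.
Proof.
move=> sA A0 K0 AK; have lA := bop_lin (sa_bop sA); pose t : R := - K^-1.
have := A0 (x + t%:C *: A x); rewrite (linD lA) (linZ lA) ripDl !ripDr.
rewrite !ripZl !ripZr (sa_rip (A x) x sA) -sqr_hnrm => h.
have h2 : rip (A (A x)) (A x) <= K * hnrm (A x) ^+ 2.
  rewrite (le_trans (rip_le _ _)) // expr2 mulrA ler_wpM2r ?hnrm_ge0 //.
  by rewrite (le_trans (le_opnorm _ (sa_bop sA))) // ler_wpM2r ?hnrm_ge0.
have h3 : t * (t * rip (A (A x)) (A x)) <= - t * hnrm (A x) ^+ 2.
  have -> : - t * hnrm (A x) ^+ 2 = t * (t * (K * hnrm (A x) ^+ 2)).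
    by rewrite /t; field; exact: lt0r_neq0.
  by rewrite mulrA [leRHS]mulrA -expr2 ler_wpM2l ?sqr_ge0.
have : t * hnrm (A x) ^+ 2 + rip (A x) x >= 0 by move: h h3; rewrite sqr_hnrm; lra.
rewrite /t mulNr addrC subr_ge0 mulrC ler_pdivrMr // mulrC //.
Qed.

Variables (T : H -> H) (sT : selfadjoint T).
Let bT := sa_bop sT.
Let lT := bop_lin bT.

(** Coefficients are complex so that real polynomials can be split into linear factors; the length
    [n] is kept apart from the size of [q] so that factors can be peeled off one at a time. *)
Definition cpoly_op n (q : {poly R[i]}) x := \sum_(i < n) q`_i *: iter i T x.

Definition roots_op (rs : seq R[i]) x := foldr (fun r y => T y - r *: y) x rs.

Lemma cpoly_op_wide n m (q : {poly R[i]}) x : (size q <= n)%N -> (n <= m)%N ->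
  cpoly_op m q x = cpoly_op n q x.
Proof.
move=> qn nm; rewrite /cpoly_op (big_ord_widen _ (fun i => q`_i *: iter i T x) nm).
rewrite [LHS](bigID (fun i : 'I_m => (i < n)%N)) /= [X in _ + X]big1 ?addr0 //.
by move=> i; rewrite -leqNgt => ni; rewrite nth_default ?scale0r // (leq_trans qn).
Qed.

Lemma cpoly_op_MXsubC n r (q : {poly R[i]}) x : (size q <= n)%N ->
  cpoly_op n.+1 (('X - r%:P) * q) x = T (cpoly_op n q x) - r *: cpoly_op n q x.
Proof.
move=> qn; have lTn i : T (iter i T x) = iter i.+1 T x by [].
have -> : T (cpoly_op n q x) = \sum_(i < n.+1) ('X * q)`_i *: iter i T x.
  rewrite big_ord_recl coefXM /= scale0r add0r /cpoly_op.
  rewrite (big_morph T (linD lT) (lin0 lT)); apply: eq_bigr => i _.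
  by rewrite coefXM /= (linZ lT).
rewrite -(cpoly_op_wide x qn (leqnSn n)) /cpoly_op scaler_sumr -sumrB.
by apply: eq_bigr => i _; rewrite mulrBl coefB coefCM scalerBl scalerA.
Qed.

Lemma cpoly_op_roots rs x n : (size rs < n)%N ->
  cpoly_op n (\prod_(r <- rs) ('X - r%:P)) x = roots_op rs x.
Proof.
elim: rs n => [|r rs ih] [//|n] hn.
  rewrite big_nil /cpoly_op big_ord_recl big1 ?addr0 /= => [|i _].
    by rewrite coefC scale1r.
  by rewrite coefC /= scale0r.
rewrite big_cons cpoly_op_MXsubC ?size_prod_XsubC // ih //=.
Qed.

Lemma roots_op_bounded_below rs :
  (forall r, r \in rs -> exists2 d, 0 < d & forall y, d * hnrm y <= hnrm (T y - r *: y)) ->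
  exists2 d, 0 < d & forall y, d * hnrm y <= hnrm (roots_op rs y).
Proof.
elim: rs => [|r rs ih] h; first by exists 1 => // y; rewrite mul1r.
have [|d d0 hd] := ih; first by move=> s srs; apply: h; rewrite inE srs orbT.
have [e e0 he] := h r (mem_head _ _).
exists (e * d) => [|y /=]; first exact: mulr_gt0.
by rewrite (le_trans _ (he _)) // -mulrA ler_wpM2l // ltW.
Qed.

(** For r = a + b 'i with b nonzero, |(T - r) y|^2 = |(T - a) y|^2 + b^2 |y|^2 as the cross term
    vanishes by symmetry. For real r of modulus above the norm it is the triangle inequality. *)
Lemma shift_bounded_below (r : R[i]) : (Im r != 0) || (opnorm T < `|Re r|) ->
  exists2 d, 0 < d & forall y, d * hnrm y <= hnrm (T y - r *: y).
Proof.
case: r => a b /= h.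
have rE y : (a +i* b) *: y = a%:C *: y + b%:C *: ('i *: y).
  by rewrite scalerA -scalerDl; congr (_ *: _); apply/eqP; rewrite eq_complex /=; apply/andP; split; apply/eqP; ring.
have [b0|b0] := eqVneq b 0.
  have {}h : opnorm T < `|a| by move: h; rewrite b0 eqxx.
  exists (`|a| - opnorm T); first by rewrite subr_gt0.
  move=> y; rewrite rE b0 scale0r addr0 mulrBl -hnrmZR lerBlDr.
  have := hnrmD (a%:C *: y - T y) (T y); rewrite subrK -(hnrmN (_ - _)) opprB => h1.
  by rewrite (le_trans h1) // lerD2l le_opnorm.
exists `|b| => [|y]; first by rewrite normr_gt0.
rewrite -(ler_pXn2r (n:=2)) ?nnegrE ?mulr_ge0 ?hnrm_ge0 // exprMn.
have -> : T y - (a +i* b) *: y = (T y - a%:C *: y) - b%:C *: ('i *: y).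
  by rewrite rE opprD addrA.
have iy0 : rip y ('i *: y) = 0 by have := rip_ir y y; rewrite (ripC ('i *: y)); lra.
have Ty0 : rip (T y) ('i *: y) = 0.
  have := sa_rip y ('i *: y) sT; have := rip_ir y (T y).
  by rewrite (linZ lT) (ripC ('i *: y)); lra.
rewrite (sqr_hnrmB (T y - _)) ripZr ripBl ripZl iy0 Ty0 hnrmZR hnrmi exprMn.
by rewrite mulr0 subr0 !mulr0 subr0 lerDr sqr_ge0.
Qed.

(** Without roots in the norm interval, each complex root of [p] is nonreal or of modulus above the
    norm, so p(T) is a scalar times a product of factors bounded below. *)
Lemma cpoly_op_nonneg (p : {poly R}) : p != 0 ->
  (forall y : R, `|y| <= opnorm T -> p.[y] != 0) ->
  exists2 d, 0 < d & forall x,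
    d * hnrm x <= hnrm (cpoly_op (size p) (map_poly (real_complex R) p) x).
Proof.
move=> p0 hp; set q := map_poly _ p.
have [rs hq] := closed_field_poly_normal q.
have q0 : q != 0 by rewrite map_poly_eq0.
have szq : size q = size p by rewrite size_map_poly.
have szrs : size p = (size rs).+1.
  by rewrite -szq hq size_scale ?lead_coef_eq0 // size_prod_XsubC.
have [|d d0 hd] := @roots_op_bounded_below rs.
  move=> r rrs; apply: shift_bounded_below; apply/negPn/negP.
  rewrite negb_or negbK -leNgt => /andP[/eqP Ir rT].
  have rE : r = (Re r)%:C by case: r Ir {rrs rT} => a b /= ->.
  have : root q r by rewrite hq rootZ ?lead_coef_eq0 // root_prod_XsubC.
  rewrite rE /root horner_map /= -[0]/((0 : R)%:C) (inj_eq (@complexI R)) => /eqP e.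
  by have := hp _ rT; rewrite e eqxx.
exists (Re `|lead_coef q| * d).
  rewrite mulr_gt0 //; have : 0 < `|lead_coef q| by rewrite normr_gt0 lead_coef_eq0.
  by rewrite ltcE /= => /andP[].
move=> x; have -> : cpoly_op (size p) q x = lead_coef q *: roots_op rs x.
  rewrite -(@cpoly_op_roots rs x (size p)) ?szrs // {1}hq /cpoly_op scaler_sumr.
  by apply: eq_bigr => i _; rewrite coefZ scalerA.
by rewrite hnrmZ -mulrA ler_wpM2l // normc_def /= sqrtr_ge0.
Qed.

Definition moment_form (x : H) (p : {poly R}) : R :=
  \sum_(i < size p) p`_i * rip (iter i T x) x.

Lemma moment_formE x p n : (size p <= n)%N ->
  moment_form x p = \sum_(i < n) p`_i * rip (iter i T x) x.
Proof.
move=> pn; rewrite /moment_form (big_ord_widen _ (fun i => p`_i * rip (iter i T x) x) pn).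
rewrite [RHS](bigID (fun i : 'I_n => (i < size p)%N)) /= [X in _ + X]big1 ?addr0 //.
by move=> i; rewrite -leqNgt => ni; rewrite nth_default ?mul0r.
Qed.

Lemma moment_formD x p (q : {poly R}) : moment_form x (p + q) = moment_form x p + moment_form x q.
Proof.
rewrite !(@moment_formE x _ (maxn (size p) (size q))) ?leq_maxl ?leq_maxr //.
  by rewrite -big_split; apply: eq_bigr => i _; rewrite coefD mulrDl.
exact: size_polyD.
Qed.

Lemma moment_formZ x a p : moment_form x (a%:P * p) = a * moment_form x p.
Proof.
rewrite !(@moment_formE x _ (size p)) ?mulr_sumr //.
  by apply: eq_bigr => i _; rewrite coefCM mulrA.
by rewrite mul_polyC size_scale_leq.
Qed.

Lemma moment_formX x n : moment_form x 'X^n = rip (iter n T x) x.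
Proof.
rewrite /moment_form size_polyXn big_ord_recr /= coefXn eqxx mul1r big1 ?add0r //.
by move=> i _; rewrite coefXn ltn_eqF ?mul0r.
Qed.

Lemma rip_cpoly_op x p :
  rip (cpoly_op (size p) (map_poly (real_complex R) p) x) x = moment_form x p.
Proof.
rewrite /cpoly_op /moment_form; elim/big_rec2: _ => [|i a b _ <-]; first exact: rip0l.
by rewrite ripDl coef_map ripZl.
Qed.

Lemma sa_cpoly_op n p : selfadjoint (cpoly_op n (map_poly (real_complex R) p)).
Proof.
elim: n => [|n ih].
  rewrite (_ : cpoly_op 0 _ = 0); first exact: sa0.
  by apply/funext => x; rewrite /cpoly_op big_ord0.
rewrite (_ : cpoly_op n.+1 _ = cpoly_op n (map_poly (real_complex R) p) +
   (p`_n)%:C *: iter n T); first by apply: saD => //; exact/saZ/sa_iter.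
by apply/funext => x; rewrite /cpoly_op big_ord_recr /= coef_map.
Qed.

Lemma moment_form_homog x p (c : R) :
  moment_form (c%:C *: x) p = c ^+ 2 * moment_form x p.
Proof.
rewrite /moment_form mulr_sumr; apply: eq_bigr => i _.
rewrite (linZ (bop_lin (bop_iter i bT))) ripZl ripZr; ring.
Qed.

(* If the infimum a of the quadratic form of p(T) on the unit sphere were
   negative, p(T) - a would not be bounded below, hence neither would one of
   the linear factors T - r of p - a: so r is a root of p - a in the interval,
   where p >= 0 > a. *)
Lemma moment_form_ge0 x (p : {poly R}) :
  (forall y : R, `|y| <= opnorm T -> 0 <= p.[y]) -> 0 <= moment_form x p.
Proof.
move=> hp.
have unit_case : (forall z, hnrm z = 1 -> 0 <= moment_form z p) ->
    forall z, 0 <= moment_form z p.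
  move=> h z; have [z0|z0] := eqVneq (hnrm z) 0.
    have := z0 => /eqP; rewrite hnrm_eq0 => /eqP->; rewrite /moment_form big1 // => i _.
    by rewrite rip0r mulr0.
  have -> : z = (hnrm z)%:C *: ((hnrm z)^-1%:C *: z).
    by rewrite scalerA -rmorphM /= divff // scale1r.
  rewrite moment_form_homog mulr_ge0 ?sqr_ge0 // h //.
  by rewrite hnrmZR ger0_norm ?invr_ge0 ?hnrm_ge0 // mulVf.
apply: unit_case => z1 z1n; rewrite leNgt; apply/negP => neg.
pose E := [set moment_form z p | z in [set z | hnrm z = 1]].
pose A := cpoly_op (size p) (map_poly (real_complex R) p).
have sA : selfadjoint A by exact: sa_cpoly_op.
have AE z : moment_form z p = rip (A z) z by rewrite rip_cpoly_op.
have hE : has_inf E.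
  split; first by exists (moment_form z1 p), z1.
  exists (- opnorm A) => _ [z zn <-]; rewrite AE lerNl -ripNl.
  rewrite (le_trans (rip_le _ _)) // hnrmN zn mulr1.
  by rewrite (le_trans (le_opnorm _ (sa_bop sA))) // zn mulr1.
pose a := inf E.
have a0 : a < 0.
  by apply: le_lt_trans neg; apply: ge_inf; [exact: hE.2|exists z1].
pose p' := p - a%:P.
have p'pos (y : R) : `|y| <= opnorm T -> 0 < p'.[y].
  by move=> /hp py; rewrite /p' hornerD hornerN hornerC; lra.
have p'0 : p' != 0.
  apply/eqP => e; have := p'pos 0; rewrite e horner0 normr0 ltxx.
  by move/(_ (opnorm_ge0 bT)).
have [|d d0 hd] := cpoly_op_nonneg p'0.
  by move=> y /p'pos/lt0r_neq0.
pose A' := cpoly_op (size p') (map_poly (real_complex R) p').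
have sA' : selfadjoint A' by exact: sa_cpoly_op.
have A'E z : rip (A' z) z = rip (A z) z - a * hnrm z ^+ 2.
  rewrite /A' rip_cpoly_op (_ : p' = p + (- a)%:P * 'X^0).
    by rewrite moment_formD moment_formZ moment_formX sqr_hnrm AE mulNr.
  by rewrite expr0 mulr1 rmorphN.
have A'0 z : 0 <= rip (A' z) z.
  have [z0|z0] := eqVneq (hnrm z) 0.
    by have := z0 => /eqP; rewrite hnrm_eq0 => /eqP->; rewrite rip0r.
  rewrite A'E subr_ge0 -ler_pdivlMr ?exprn_gt0 ?lt0r ?z0 ?hnrm_ge0 //.
  apply: ge_inf; first exact: hE.2.
  exists ((hnrm z)^-1%:C *: z).
    by rewrite /= hnrmZR ger0_norm ?invr_ge0 ?hnrm_ge0 // mulVf.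
  by rewrite moment_form_homog AE mulrC exprVn.
pose K := opnorm A' + 1.
have K0 : 0 < K by rewrite ltr_pwDr // opnorm_ge0 //; exact: sa_bop.
have e0 : 0 < d ^+ 2 / K by rewrite divr_gt0 ?exprn_gt0.
have [_ [z zn <-] hz] := inf_adherent e0 hE.
have := pos_op_norm_le z sA' A'0 K0; rewrite lerDl => /(_ ler01).
apply/negP; rewrite -ltNge.
have -> : rip (A' z) z = moment_form z p - a by rewrite A'E AE zn expr1n mulr1.
apply: (@lt_le_trans _ _ (d ^+ 2)).
  rewrite mulrC -ltr_pdivlMr //; move: hz; rewrite -/a; lra.
by rewrite lerXn2r ?nnegrE ?hnrm_ge0 ?(ltW d0) //; have := hd z; rewrite zn mulr1.
Qed.

Lemma spectral_measure_exists x : exists m, spectral_measure_at T x m.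
Proof.
have [m [m1 m2 m3]] := @riesz_moments R (opnorm T) (moment_form x)
  (opnorm_ge0 bT) (moment_formD x) (moment_formZ x) (@moment_form_ge0 x).
exists m; split=> // n; rewrite (sa_hdot _ (sa_iter n sT)) -moment_formX m3 //.
Qed.

End PolynomialPositivity.

(** * Functional calculus *)

Section FunctionalCalculusExistence.
Context {R : realType} {H : hilbertType R}.
Implicit Types (x y z : H) (f g : R -> R) (a b K M : R).

(** Reduces identities of the functional calculus to the powers of the operator. *)
Lemma sf_eq M (l1 l2 : (R -> R) -> R) f :
  sigma_functional M l1 -> sigma_functional M l2 ->
  (forall n, l1 (fun t => t ^+ n) = l2 (fun t => t ^+ n)) -> lbfun f -> l1 f = l2 f.
Proof.
move=> h1 h2 e lf; apply/eqP; rewrite -subr_eq0; apply/eqP.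
by apply: (sf_moments (sf_minus h1 h2)) => // n; rewrite e subrr.
Qed.

Variables (T : H -> H) (sT : selfadjoint T).
Let M := opnorm T.
Let m x := sval (cid (spectral_measure_exists sT x)).
Let m_spec x : spectral_measure_at T x (m x).
Proof. by rewrite /m; case: cid. Qed.
Let I f x := \int[m x]_(y in `[- M, M]) f y.
(** The measures [m x] are chosen independently of one another, so additivity of this polarised form
    is not built in; it follows by [sf_eq] from the moments, which are [rip (iter n T x) y]. *)
Let b f x y := 4^-1 * (I f (x + y) - I f (x - y)).

Let sfI x : sigma_functional M (fun f => I f x).
Proof. by apply: sf_integral; case: (m_spec x). Qed.

Let I_X n x : I (fun t => t ^+ n) x = rip (iter n T x) x.
Proof.
have [_ _ /(_ n)] := m_spec x; rewrite (sa_hdot _ (sa_iter n sT)) => e.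
exact/esym/(@complexI R).
Qed.

Let sfb x y : sigma_functional M (fun f => b f x y).
Proof. by apply: sf_scale; apply: sf_minus; exact: sfI. Qed.

Let b_X n x y : b (fun t => t ^+ n) x y = rip (iter n T x) y.
Proof.
have lTn := bop_lin (bop_iter n (sa_bop sT)).
rewrite /b !I_X (linD lTn) (linB lTn) !(ripDl, ripDr, ripNl, ripNr).
have -> : rip (iter n T y) x = rip (iter n T x) y.
  by rewrite ripC -(sa_rip x y (sa_iter n sT)).
by field.
Qed.

Let bC f x y : lbfun f -> b f x y = b f y x.
Proof.
move=> lf; apply: (sf_eq (sfb x y) (sfb y x)) => // n.
by rewrite !b_X (sa_rip x y (sa_iter n sT)) ripC.
Qed.

Let bDl f x x' y : lbfun f -> b f (x + x') y = b f x y + b f x' y.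
Proof.
move=> lf; apply: (sf_eq (sfb (x + x') y) (sf_plus (sfb x y) (sfb x' y))) => // n.
by rewrite !b_X (linD (bop_lin (bop_iter n (sa_bop sT)))) ripDl.
Qed.

Let bZl f a x y : lbfun f -> b f (a%:C *: x) y = a * b f x y.
Proof.
move=> lf; apply: (sf_eq (sfb _ _) (sf_scale a (sfb x y))) => // n.
by rewrite !b_X (linZ (bop_lin (bop_iter n (sa_bop sT)))) ripZl.
Qed.

Let bi f x y : lbfun f -> b f ('i *: x) ('i *: y) = b f x y.
Proof.
move=> lf; apply: (sf_eq (sfb _ _) (sfb x y)) => // n.
by rewrite !b_X (linZ (bop_lin (bop_iter n (sa_bop sT)))) rip_ii.
Qed.

Let b_diag f x : lbfun f -> b f x x = I f x.
Proof. by move=> lf; apply: (sf_eq (sfb x x) (sfI x)) => // n; rewrite b_X I_X. Qed.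

Let I_le f K x : lbfun f -> (forall t : R, `|t| <= M -> `|f t| <= K) ->
  `|I f x| <= K * hnrm x ^+ 2.
Proof.
move=> lf fK; have I1 : I (fun=> 1) x = hnrm x ^+ 2.
  rewrite sqr_hnrm -(I_X 0); congr (I _ x); apply/funext => t; by rewrite expr0.
have IK a : I (fun=> a * 1) x = a * hnrm x ^+ 2.
  by rewrite -I1 -(sfZ (sfI x)) //; exact: lb_cst.
have [mfin _ _] := m_spec x.
rewrite ler_norml -mulNr -!IK; apply/andP; split.
  apply: le_lb_integral => //; first exact: lb_cst.
  by move=> y /fK; rewrite ler_norml mulr1 => /andP[].
apply: le_lb_integral => //; first exact: lb_cst.
by move=> y /fK; rewrite ler_norml mulr1 => /andP[].
Qed.

(** The parallelogram law bounds the form by K on pairs of unit vectors; homogeneity gives the rest,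
    zero vectors being treated apart. *)
Let b_le f K x y : 0 <= K -> lbfun f -> (forall t : R, `|t| <= M -> `|f t| <= K) ->
  `|b f x y| <= K * hnrm x * hnrm y.
Proof.
move=> K0 lf fK.
have b1 z w : `|b f z w| <= K * ((hnrm z ^+ 2 + hnrm w ^+ 2) / 2).
  have h1 := I_le (z + w) lf fK; have h2 := I_le (z - w) lf fK.
  rewrite /b normrM ger0_norm ?invr_ge0 //.
  have h3 := ler_normB (I f (z + w)) (I f (z - w)).
  move: h1 h2; rewrite sqr_hnrmD sqr_hnrmB => h1 h2; lra.
have b2 z w : hnrm z = 1 -> hnrm w = 1 -> `|b f z w| <= K.
  by move=> z1 w1; have := b1 z w; rewrite z1 w1 expr1n; lra.
have zero z w : hnrm z = 0 -> `|b f z w| <= K * hnrm z * hnrm w.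
  move=> z0; have /eqP := z0; rewrite hnrm_eq0 => /eqP->.
  have -> : (0 : H) = (0 : R)%:C *: 0 by rewrite scaler0.
  by rewrite bZl // mul0r normr0 scaler0 hnrm0 mulr0 mul0r.
have [x0|x0] := eqVneq (hnrm x) 0; first exact: zero.
have [y0|y0] := eqVneq (hnrm y) 0.
  by rewrite bC // mulrAC; exact: zero.
have nrm (z : H) : hnrm z != 0 -> hnrm ((hnrm z)^-1%:C *: z) = 1 /\
    z = (hnrm z)%:C *: ((hnrm z)^-1%:C *: z).
  move=> z0; rewrite hnrmZR ger0_norm ?invr_ge0 ?hnrm_ge0 // mulVf //.
  by rewrite scalerA -rmorphM /= divff // scale1r.
have [x1 xE] := nrm _ x0; have [y1 yE] := nrm _ y0.
rewrite {1}xE {1}yE bZl // bC // bZl // bC //.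
move: (b2 _ _ x1 y1); move: (b f _ _) => B hB; rewrite !normrM.
rewrite (ger0_norm (hnrm_ge0 x)) (ger0_norm (hnrm_ge0 y)) mulrA mulrC -(mulrA K).
by rewrite ler_wpM2r ?mulr_ge0 ?hnrm_ge0.
Qed.

Let calc_exists f : lbfun f -> exists S,
  [/\ selfadjoint S, forall x y, rip (S x) y = b f x y &
      forall K, 0 <= K -> (forall t : R, `|t| <= M -> `|f t| <= K) -> opnorm S <= K].
Proof.
move=> lf; have [C hC] := lf.2 M; pose K := `|C|.
have fK (t : R) : `|t| <= M -> `|f t| <= K.
  by move=> /hC h; rewrite (le_trans h) // ler_norm.
have mk K' : 0 <= K' -> (forall t : R, `|t| <= M -> `|f t| <= K') ->
    exists2 S, bounded_op S /\ opnorm S <= K' & forall x y, rip (S x) y = b f x y.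
  move=> K0 hK; apply: bilinear_op => //.
  - by move=> x x' y; exact: bDl.
  - by move=> x y y'; rewrite bC // bDl // (bC _ x) // (bC y' x).
  - by move=> a x y; exact: bZl.
  - by move=> a x y; rewrite bC // bZl // bC.
  - by move=> x y; exact: bi.
  - by move=> x y; exact: b_le.
have [S [bS _] hS] := mk K (normr_ge0 _) fK.
exists S; split=> // [|K' K0 hK].
  by apply/selfadjointP; split=> // x y; rewrite hS bC // -hS ripC.
have [S' [_ S'K] hS'] := mk K' K0 hK.
rewrite (_ : S = S') //; apply/funext => x; apply: rip_eq => y.
by rewrite hS hS'.
Qed.

(** The witness chosen in [fun_calc] may come with other spectral measures, but these have the same
    moments, hence the same integrals of [f]. Its quadratic form is therefore that of [S], and a
    self-adjoint operator is determined by its quadratic form. *)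
Let fun_calc_spec f : lbfun f ->
  [/\ selfadjoint (fun_calc f T), forall x y, rip (fun_calc f T x) y = b f x y &
      forall K, 0 <= K -> (forall t : R, `|t| <= M -> `|f t| <= K) ->
        opnorm (fun_calc f T) <= K].
Proof.
move=> lf; have [S [sS hS SK]] := calc_exists lf.
suff -> : fun_calc f T = S by [].
have h : [set S | bounded_op S /\ forall x, exists2 m', spectral_measure_at T x m' &
    hdot (S x) x = (\int[m']_(y in `[- opnorm T, opnorm T]) f y)%:C] S.
  split=> [|x]; first exact: sa_bop.
  by exists (m x) => //; rewrite sa_hdot // hS b_diag.
have [bS' hS'] := xgetI 0 h; rewrite -/(fun_calc f T) in bS' hS' *.
have quad x : hdot (fun_calc f T x) x = (rip (S x) x)%:C.
  have [m' [m1 m2 m3] ->] := hS' x; rewrite hS b_diag //; congr (_%:C).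
  apply: (sf_eq (sf_integral m1 M) (sfI x)) => // n.
  by rewrite I_X; have := m3 n; rewrite (sa_hdot _ (sa_iter n sT)) => /(@complexI R).
have sS' : selfadjoint (fun_calc f T).
  apply: sym_of_real => // x; have := quad x.
  by rewrite hdotE => -[].
apply/eqP; rewrite -subr_eq0; apply/eqP/sa_quad_eq0; first exact: saB.
by move=> x; rewrite opBE ripBl -/(rip _ _) /rip quad /= subrr.
Qed.

Lemma fc_sa f : lbfun f -> selfadjoint (fun_calc f T).
Proof. by move=> /fun_calc_spec[]. Qed.

Lemma fc_sf x y : sigma_functional (opnorm T) (fun f => rip (fun_calc f T x) y).
Proof.
have hb f : lbfun f -> rip (fun_calc f T x) y = b f x y by move=> /fun_calc_spec[].
split.
- by move=> f g lf lg; rewrite !hb ?(sfD (sfb x y)) //; exact: lbD.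
- by move=> a f lf; rewrite !hb ?(sfZ (sfb x y)) //; exact: lbZ.
- move=> f_ f K lf_ lf bf cf; rewrite hb //.
  under eq_fun do rewrite hb //; exact: (sf_cvg (sfb x y) lf_ lf bf cf).
Qed.

Lemma fc_pos f x : lbfun f -> (forall t : R, `|t| <= opnorm T -> 0 <= f t) ->
  0 <= rip (fun_calc f T x) x.
Proof.
move=> lf f0; have [_ -> _] := fun_calc_spec lf; rewrite b_diag //.
by apply: Rintegral_ge0 => y; rewrite in_sym_itv; exact: f0.
Qed.

Lemma fc_X n : fun_calc (fun t => t ^+ n) T = iter n T.
Proof.
apply/funext => x; apply: rip_eq => y; have [_ -> _] := fun_calc_spec (lb_expr n).
by rewrite b_X.
Qed.

End FunctionalCalculusExistence.

Section FunctionalCalculus.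
Context {R : realType} {H : hilbertType R}.
Implicit Types (x y z : H) (f g : R -> R) (a b K M : R) (T S C : H -> H).

Lemma fc_bop T f : selfadjoint T -> lbfun f -> bounded_op (fun_calc f T).
Proof. by move=> sT lf; exact/sa_bop/fc_sa. Qed.

Lemma fc_lin T f : selfadjoint T -> lbfun f -> linear (fun_calc f T).
Proof. by move=> sT lf; exact/bop_lin/fc_bop. Qed.

Lemma fc_id T : selfadjoint T -> fun_calc id T = T.
Proof.
by move=> sT; rewrite -[RHS](fc_X sT 1); congr fun_calc; apply/funext => y; rewrite expr1.
Qed.

Lemma fc1 T : selfadjoint T -> fun_calc (fun=> 1) T = id.
Proof.
by move=> sT; rewrite -[RHS](fc_X sT 0); congr fun_calc; apply/funext => y; rewrite expr0.
Qed.

Lemma fcD T f g : selfadjoint T -> lbfun f -> lbfun g ->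
  fun_calc (f \+ g) T = fun_calc f T + fun_calc g T.
Proof.
move=> sT lf lg; apply/funext => x; apply: rip_eq => y.
by rewrite (sfD (fc_sf sT x y)) // opDE ripDl.
Qed.

Lemma fcZ T f a : selfadjoint T -> lbfun f ->
  fun_calc (fun t => a * f t) T = a%:C *: fun_calc f T.
Proof.
move=> sT lf; apply/funext => x; apply: rip_eq => y.
by rewrite (sfZ (fc_sf sT x y)) // opZE ripZl.
Qed.

Lemma fc_ext T f g : selfadjoint T -> lbfun f -> lbfun g ->
  (forall t : R, `|t| <= opnorm T -> f t = g t) -> fun_calc f T = fun_calc g T.
Proof.
move=> sT lf lg fg; apply/funext => x; apply: rip_eq => y.
exact: (sf_ext (fc_sf sT x y)).
Qed.

Lemma fc_cst T a : selfadjoint T -> fun_calc (fun=> a) T = a%:C *: id.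
Proof.
move=> sT; rewrite -(fc1 sT) -fcZ //; last exact: lb_cst.
by congr fun_calc; apply/funext => y; rewrite mulr1.
Qed.

Lemma fcB T f g : selfadjoint T -> lbfun f -> lbfun g ->
  fun_calc (f \- g) T = fun_calc f T - fun_calc g T.
Proof.
move=> sT lf lg; apply/funext => x; apply: rip_eq => y.
have -> : f \- g = f \+ (fun t => -1 * g t).
  by apply/funext => t /=; rewrite mulN1r.
have := sfD (fc_sf sT x y) lf (lbZ (-1) lg) => ->.
by rewrite (sfZ (fc_sf sT x y)) // opBE ripBl mulN1r.
Qed.

(** On powers the claim is C T^n = S^n C. Besides commutation with T = S, it serves to intertwine an
    operator with its negative. *)
Lemma fc_intertwine T S C f : selfadjoint T -> selfadjoint S -> bounded_op C ->
  C \o T = S \o C -> lbfun f -> C \o fun_calc f T = fun_calc f S \o C.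
Proof.
move=> sT sS bC e lf; apply/funext => x; apply: rip_eq => y /=.
rewrite (rip_adjointr _ _ bC).
pose M := Num.max (opnorm T) (opnorm S).
have h1 : sigma_functional M (fun f => rip (fun_calc f T x) (adjoint C y)).
  by apply: sf_wide (fc_sf sT _ _); rewrite /M le_max lexx.
have h2 : sigma_functional M (fun f => rip (fun_calc f S (C x)) y).
  by apply: sf_wide (fc_sf sS _ _); rewrite /M le_max lexx orbT.
apply: (sf_eq h1 h2) => // n; rewrite !fc_X // -rip_adjointr //; congr rip.
by elim: n => //= n ih; have := congr1 (fun F => F (iter n T x)) e => /= ->; rewrite ih.
Qed.

Lemma fc_comm T C f : selfadjoint T -> bounded_op C -> C \o T = T \o C ->
  lbfun f -> C \o fun_calc f T = fun_calc f T \o C.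
Proof. by move=> sT; exact: fc_intertwine. Qed.

(** Two reductions to powers: the first replaces [f] by a power with [g] fixed; then T^n is moved
    past g(T), and the second replaces [g] by a power. *)
Lemma fcM T f g : selfadjoint T -> lbfun f -> lbfun g ->
  fun_calc (f \* g) T = fun_calc f T \o fun_calc g T.
Proof.
move=> sT lf lg.
have step h x y : lbfun h ->
    (forall n, rip (fun_calc ((fun t => t ^+ n) \* h) T x) y =
      rip (iter n T (fun_calc h T x)) y) ->
    rip (fun_calc (f \* h) T x) y = rip (fun_calc f T (fun_calc h T x)) y.
  move=> lh e; apply: (sf_eq (sf_weight lh (fc_sf sT x y)) (fc_sf sT (fun_calc h T x) y)) => // n.
  by rewrite e fc_X.
apply/funext => x; apply: rip_eq => y; apply: step => // n.
have -> : (fun t => t ^+ n) \* g = g \* (fun t => t ^+ n).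
  by apply/funext => t /=; rewrite mulrC.
have comm : iter n T \o fun_calc g T = fun_calc g T \o iter n T.
  apply: fc_comm => //; first exact/bop_iter/sa_bop.
  by apply/funext => z /=; rewrite -iterSr.
have := congr1 (fun F => F x) comm => /= ->.
rewrite -[in RHS](fc_X sT n).
apply: (sf_eq (sf_weight (lb_expr n) (fc_sf sT x y)) (fc_sf sT (fun_calc _ T x) y)) => // k.
rewrite !fc_X // -iterD -(fc_X sT (k + n)); congr (rip (fun_calc _ T x) y).
by apply/funext => t /=; rewrite exprD.
Qed.

Lemma fc_comp T f g : selfadjoint T -> lbfun f -> lbfun g ->
  fun_calc f (fun_calc g T) = fun_calc (f \o g) T.
Proof.
move=> sT lf lg; have sG := fc_sa sT lg; have [K hK] := lg.2 (opnorm T).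
apply/funext => x; apply: rip_eq => y.
pose M := Num.max (opnorm (fun_calc g T)) K.
have h1 : sigma_functional M (fun f => rip (fun_calc f (fun_calc g T) x) y).
  by apply: sf_wide (fc_sf sG _ _); rewrite /M le_max lexx.
have h2 : sigma_functional M (fun f => rip (fun_calc (f \o g) T x) y).
  apply: (sf_comp lg _ (fc_sf sT x y)) => t /hK h.
  by rewrite (le_trans h) // le_max lexx orbT.
apply: (sf_eq h1 h2) => // n; rewrite fc_X //; congr (rip (_ x) y).
elim: n => [|n ih].
  by rewrite (_ : _ \o g = fun=> 1) ?fc1 //; apply/funext => t /=; rewrite expr0.
rewrite (_ : _ \o g = g \* (fun t => g t ^+ n)) ?fcM //; last first.
- by apply/funext => t /=; rewrite exprS.
- exact: lbX.
by rewrite -/((fun t => t ^+ n) \o g) -ih.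
Qed.

(** Evaluation at [a], scaled by [rip x y], is itself a functional with the moments of [T] at x and
    y; widening the interval to contain [a] avoids locating the eigenvalue. *)
Lemma fc_eigen T f x a : selfadjoint T -> lbfun f -> T x = a%:C *: x ->
  fun_calc f T x = (f a)%:C *: x.
Proof.
move=> sT lf e; apply: rip_eq => y; rewrite ripZl.
pose M := Num.max (opnorm T) `|a|.
have h1 : sigma_functional M (fun f => rip (fun_calc f T x) y).
  by apply: sf_wide (fc_sf sT _ _); rewrite /M le_max lexx.
have h2 : sigma_functional M (fun f => rip x y * f a).
  by apply/sf_scale/sf_eval; rewrite /M le_max lexx orbT.
rewrite mulrC; apply: (sf_eq h1 h2) => // n; rewrite fc_X // mulrC -ripZl; congr rip.
elim: n => [|n ih]; first by rewrite expr0 scale1r.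
rewrite iterS ih (linZ (bop_lin (sa_bop sT))) e scalerA -rmorphM /=.
by rewrite exprSr.
Qed.

(** On S n = {|f| >= 1 / (n + 1)} the indicator is at most (n + 1)^2 f^2, so f(T) x = 0 kills the
    spectral projection of [S n] at x. As g vanishes where f does, it is the limit of its
    restrictions to the sets [S n]. *)
Lemma fc_ker T f g x : selfadjoint T -> lbfun f -> lbfun g ->
  (forall t : R, `|t| <= opnorm T -> f t = 0 -> g t = 0) ->
  fun_calc f T x = 0 -> fun_calc g T x = 0.
Proof.
move=> sT lf lg fg fx; apply: rip_eq => y; rewrite rip0l.
pose S n : set (measurableTypeR R) := [set t | n.+1%:R^-1 <= `|f t|].
have mS n : measurable (S n).
  have := (lb_norm lf).1 measurableT `[n.+1%:R^-1, +oo[%classic (measurable_itv _).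
  rewrite setTI; congr (measurable _); apply/seteqP; split=> t /=.
    by rewrite in_itv /= andbT.
  by rewrite in_itv /= andbT.
have lS n : lbfun (\1_(S n)) by exact: lb_indic.
have Sx n : fun_calc (\1_(S n)) T x = 0.
  have lh : lbfun ((fun t => n.+1%:R ^+ 2 * (f \* f) t) \- \1_(S n)).
    by apply: lbB => //; apply/lbZ/lbM.
  have h : 0 <= rip (fun_calc ((fun t => n.+1%:R ^+ 2 * (f \* f) t) \- \1_(S n)) T x) x.
    apply: (fc_pos sT) => // t _; rewrite /= indicE subr_ge0.
    case: (boolP (t \in _)) => [|_]; last by rewrite mulr_ge0 ?sqr_ge0 // -expr2 sqr_ge0.
    rewrite inE /S /= => h; rewrite -expr2 -exprMn -real_normK ?num_real //.
    rewrite expr_ge1 // normrM ger0_norm // -ler_pdivrMl // mulr1 //.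
  have idem : \1_(S n) \* \1_(S n) = \1_(S n) :> (R -> R).
    by apply/funext => t /=; rewrite indicE; case: (_ \in _); rewrite ?mulr1 ?mulr0.
  apply: rip_eq0; rewrite (sa_rip _ _ (fc_sa sT (lS n))) ripC.
  have := congr1 (fun F => fun_calc F T x) idem; rewrite fcM //= => ->.
  apply/eqP; rewrite eq_le; apply/andP; split; last first.
    by apply: fc_pos => // t _; rewrite indicE.
  move: h; rewrite fcB ?fcZ ?fcM //; try by [apply: lbM|apply/lbZ/lbM].
  by rewrite opBE opZE /= fx (lin0 (fc_lin sT lf)) scaler0 ripBl rip0l sub0r oppr_ge0.
have [C hC] := lg.2 (opnorm T).
apply: (sf_eq0_cvg (fc_sf sT x y) (f_ := fun n => g \* \1_(S n)) (K := C)) => //.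
- by move=> n; exact: lbM.
- move=> n t /hC ht; rewrite /= indicE; case: (_ \in _); rewrite ?mulr1 ?mulr0 //.
  by rewrite normr0 (le_trans _ ht).
- move=> t tM; have [f0|f0] := eqVneq (f t) 0.
    rewrite (fg _ tM f0) /=; under eq_fun do rewrite (fg _ tM f0) mul0r.
    exact: cvg_cst.
  apply: cvg_near_cst; near=> n; rewrite /= indicE mem_set ?mulr1 //= /S /=.
  near: n; have f1 : 0 < `|f t| by rewrite normr_gt0.
  have := near_infty_natSinv_lt (PosNum f1).
  by apply: filterS => n /ltW.
- by move=> n; rewrite fcM // /= Sx (lin0 (fc_lin sT lg)) rip0l.
Unshelve. all: by end_near. Qed.

End FunctionalCalculus.

(** * Traces *)

Section VonNeumann.
Context {R : realType} {H : hilbertType R}.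
Implicit Types (x z w : H) (S T A B C E G P : H -> H) (f g : R -> R) (a c e : R).
Variables (N : set (H -> H)) (hN : von_neumann_algebra N).

Lemma vna_bop T : N T -> bounded_op T. Proof. exact: vna_bounded. Qed.

Lemma vnaP T : N T <-> bounded_op T /\ forall S, commutant N S -> T \o S = S \o T.
Proof. by rewrite -{1}(vna_bicommutant hN). Qed.

Lemma vnaD T S : N T -> N S -> N (T + S).
Proof.
move=> /vnaP[bT cT] /vnaP[bS cS]; apply/vnaP; split=> [|C hC]; first exact: bopD.
apply/funext => x /=; have [bC _] := hC.
rewrite !opDE (linD (bop_lin bC)); congr (_ + _).
  exact: (congr1 (fun F => F x) (cT C hC)).
exact: (congr1 (fun F => F x) (cS C hC)).
Qed.

Lemma vnaZ (c : R[i]) T : N T -> N (c *: T).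
Proof.
move=> /vnaP[bT cT]; apply/vnaP; split=> [|C hC]; first exact: bopZ.
apply/funext => x /=; have [bC _] := hC; rewrite !opZE (linZ (bop_lin bC)).
by congr (_ *: _); exact: (congr1 (fun F => F x) (cT C hC)).
Qed.

Lemma vnaN T : N T -> N (- T).
Proof. by move=> /(vnaZ (-1)); rewrite scaleN1r. Qed.

Lemma vnaB T S : N T -> N S -> N (T - S).
Proof. by move=> hT hS; apply: vnaD => //; exact: vnaN. Qed.

Lemma vnaM T S : N T -> N S -> N (T \o S).
Proof.
move=> /vnaP[bT cT] /vnaP[bS cS]; apply/vnaP; split=> [|C hC]; first exact: bopM.
by rewrite -compA cS // compA cT.
Qed.

Lemma vna_id : N id.
Proof. by apply/vnaP; split=> //; exact: bop_id. Qed.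

Lemma vna0 : N 0.
Proof.
apply/vnaP; split=> [|C [bC _]]; first exact: bop0.
by apply/funext => x /=; rewrite (lin0 (bop_lin bC)).
Qed.

Lemma vna_adj T : N T -> N (adjoint T). Proof. exact: vna_adjoint. Qed.

Lemma vna_fc T f : N T -> selfadjoint T -> lbfun f -> N (fun_calc f T).
Proof.
move=> NT sT lf; apply/vnaP; split=> [|C hC]; first exact: fc_bop.
apply/esym/fc_comm => //; first by case: hC.
by have [_ ->] := hC.
Qed.

Lemma op_leP A B : selfadjoint A -> selfadjoint B ->
  op_le A B <-> forall x, rip (A x) x <= rip (B x) x.
Proof.
move=> sA sB; split=> [/positive_opP[_ h] x|h].
  by have := h x; rewrite opBE ripBl subr_ge0.
apply/positive_opP; split=> [|x]; first exact: saB.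
by rewrite opBE ripBl subr_ge0.
Qed.

Lemma pos_partP A : pos_part N A <->
  [/\ N A, selfadjoint A & forall x, 0 <= rip (A x) x].
Proof.
split=> [[NA /positive_opP[sA h]]|[NA sA h]]; first by [].
by split=> //; apply/positive_opP.
Qed.

Lemma pos_sa A : pos_part N A -> selfadjoint A. Proof. by move=> /pos_partP[]. Qed.
Lemma pos_mem A : pos_part N A -> N A. Proof. by case. Qed.

Lemma posD A B : pos_part N A -> pos_part N B -> pos_part N (A + B).
Proof.
move=> /pos_partP[NA sA hA] /pos_partP[NB sB hB]; apply/pos_partP; split.
- exact: vnaD.
- exact: saD.
- by move=> x; rewrite opDE ripDl addr_ge0.
Qed.

Lemma posZ a A : 0 <= a -> pos_part N A -> pos_part N (a%:C *: A).
Proof.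
move=> a0 /pos_partP[NA sA hA]; apply/pos_partP; split.
- exact: vnaZ.
- exact: saZ.
- by move=> x; rewrite opZE ripZl mulr_ge0.
Qed.

Lemma pos0 : pos_part N 0.
Proof.
by apply/pos_partP; split=> [||x]; [exact: vna0|exact: sa0|rewrite rip0l].
Qed.

Lemma pos_proj P : N P -> projection P -> pos_part N P.
Proof. by move=> NP hP; split=> //; exact: proj_pos. Qed.

Lemma pos_fc T f : N T -> selfadjoint T -> lbfun f ->
  (forall t : R, `|t| <= opnorm T -> 0 <= f t) -> pos_part N (fun_calc f T).
Proof.
move=> NT sT lf f0; apply/pos_partP; split; [exact: vna_fc|exact: fc_sa|].
by move=> x; exact: fc_pos.
Qed.

Lemma fc_le T f g : selfadjoint T -> lbfun f -> lbfun g ->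
  (forall t : R, `|t| <= opnorm T -> f t <= g t) ->
  op_le (fun_calc f T) (fun_calc g T).
Proof.
move=> sT lf lg fg; rewrite /op_le -fcB //; apply/positive_opP.
split=> [|x]; first by apply: fc_sa => //; exact: lbB.
by apply: fc_pos => //; [exact: lbB|move=> t /fg; rewrite subr_ge0].
Qed.

Lemma adjoint_self_pos V : N V -> pos_part N (adjoint V \o V).
Proof.
move=> NV; have bV := vna_bop NV; apply/pos_partP; split.
- by apply: vnaM => //; exact: vna_adj.
- apply/selfadjointP; split; first by apply: bopM => //; exact: bop_adjoint.
  by move=> x y /=; rewrite rip_adjointl // rip_adjointr //= rip_adjointr.
- by move=> x /=; rewrite rip_adjointl // rip_ge0.
Qed.

Variables (tau : (H -> H) -> \bar R) (htau : fns_trace N tau).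

Lemma tau0 : tau 0 = 0%E.
Proof.
have := traceZ htau (lexx 0) pos0; rewrite mul0e => <-.
by congr tau; rewrite scaler0.
Qed.

Lemma tau_ge0 A : pos_part N A -> (0 <= tau A)%E.
Proof. exact: trace_ge0. Qed.

Lemma tau_le A B : pos_part N A -> pos_part N B -> op_le A B -> (tau A <= tau B)%E.
Proof.
move=> hA hB AB.
have hBA : pos_part N (B - A) by split=> //; apply: vnaB; exact: pos_mem.
have -> : B = A + (B - A) by rewrite addrC subrK.
by rewrite (traceD htau) // leeDl // tau_ge0.
Qed.

Lemma tau_fin A : finite_pos N tau A -> tau A = (fine (tau A))%:E.
Proof. by move=> [hA fA]; rewrite fineK // ge0_fin_numE // tau_ge0. Qed.

Lemma finite_posD A B : finite_pos N tau A -> finite_pos N tau B ->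
  finite_pos N tau (A + B).
Proof.
move=> [hA fA] [hB fB]; split; first exact: posD.
by rewrite (traceD htau) // lte_add_pinfty.
Qed.

Lemma finite_pos0 : finite_pos N tau 0.
Proof. by split; [exact: pos0|rewrite tau0]. Qed.

Lemma finite_pos_le A B : pos_part N A -> finite_pos N tau B -> op_le A B ->
  finite_pos N tau A.
Proof.
move=> hA [hB fB] AB; split=> //; exact: le_lt_trans (tau_le hA hB AB) fB.
Qed.

Lemma fine_tauD A B : finite_pos N tau A -> finite_pos N tau B ->
  fine (tau (A + B)) = fine (tau A) + fine (tau B).
Proof.
move=> [pA fA] [pB fB]; rewrite (traceD htau pA pB) fineD //.
  by rewrite ge0_fin_numE // tau_ge0.
by rewrite ge0_fin_numE // tau_ge0.
Qed.

(** Uniqueness of the value behind the [xget] in [trace]: for any decomposition, 'i times T3 - T4 is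
    a difference of self-adjoint operators, which forces T3 = T4; then A + T2 = T1 + B, and
    additivity on finite elements concludes. *)
Lemma trace_sub A B : finite_pos N tau A -> finite_pos N tau B ->
  trace N tau (A - B) = (fine (tau A) - fine (tau B))%:C.
Proof.
move=> hA hB; rewrite /trace; set X := (X in xget 0 X); pose z0 := (fine (tau A) - fine (tau B))%:C : R[i].
have Xz0 : X z0.
  exists A, B, 0, 0; split=> //; [by split; exact: finite_pos0| |].
    by rewrite subrr scaler0 addr0.
  by rewrite tau0 /= subrr.
have [T1 [T2 [T3 [T4 [[h1 h2] [h3 h4] e ->]]]]] : X (xget 0 X) by exact: (xgetI 0 Xz0).
have [p1 _] := h1; have [p2 _] := h2; have [p3 _] := h3; have [p4 _] := h4.
have [pA _] := hA; have [pB _] := hB.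
have s12 := saB (pos_sa p1) (pos_sa p2); have s34 := saB (pos_sa p3) (pos_sa p4).
have sAB := saB (pos_sa pA) (pos_sa pB).
have e34 : T3 - T4 = 0.
  apply/funext => x; apply: rip_eq => y; rewrite rip0l.
  have key z w : rip ((T3 - T4) z) ('i *: w) = 0.
    have := sa_rip z w (saB sAB s12).
    have ei u : (A - B - (T1 - T2)) u = 'i *: (T3 - T4) u.
      by rewrite e addrC addKr.
    rewrite !ei rip_il => h1'; have h2' := rip_ir z ((T3 - T4) w).
    rewrite h2' -(sa_rip _ w s34) in h1'.
    rewrite (linZ (bop_lin (sa_bop s34))) rip_il in h1'; lra.
  have := key x (- ('i *: y)).
  by rewrite scalerN scalerA -expr2 sqr_i scaleN1r opprK.
have e12 : A + T2 = T1 + B.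
  have : A - B = T1 - T2 by rewrite e e34 scaler0 addr0.
  by move=> /eqP; rewrite subr_eq addrAC eq_sym subr_eq eq_sym => /eqP.
have e34' : T3 = T4 by apply/eqP; rewrite -subr_eq0 e34.
have := congr1 (fun F => fine (tau F)) e12; rewrite !fine_tauD // => ee.
rewrite e34' subrr; congr Complex; lra.
Qed.

Lemma tau_conj V : N V -> tau (adjoint V \o V) = tau (V \o adjoint V).
Proof. exact: trace_tracial. Qed.

(* |E G| <= 1/2 makes G (1 - E) G >= 3/4 G, and G (1 - E) G has the same trace as
   (1 - E) G (1 - E) <= 1 - E. *)
Lemma tau_proj_le G E : N G -> projection G -> N E -> projection E ->
  (forall x, hnrm (E (G x)) <= 2^-1 * hnrm (G x)) ->
  (tau G <= 2%:E * tau (id - E)%R)%E.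
Proof.
move=> NG hG NE hE h; have [bG aG] := hG.1; have [bE aE] := hE.1.
have NE1 : N (id - E) by apply: vnaB => //; exact: vna_id.
have hE1 := projC hE; have [bE1 aE1] := hE1.1.
have GG x : G (G x) = G x by have [_] := hG; move=> /(congr1 (fun F => F x)).
have EE x : (id - E) ((id - E) x) = (id - E) x.
  by have [_] := hE1; move=> /(congr1 (fun F => F x)).
pose V := (id - E) \o G; have NV : N V by exact: vnaM.
have aV : adjoint V = G \o (id - E) by rewrite /V adjointM // aG aE1.
have pVV := adjoint_self_pos NV.
have pVV' : pos_part N (V \o adjoint V).
  have := adjoint_self_pos (vna_adj NV); rewrite adjointK //; exact: vna_bop.
have pG := pos_proj NG hG; have pE1 := pos_proj NE1 hE1.
have le1 : op_le G (2%:C *: (adjoint V \o V)).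
  apply/op_leP; [exact: pos_sa|exact/saZ/pos_sa|move=> x].
  have -> : rip ((2%:C *: (adjoint V \o V)) x) x = 2 * hnrm (V x) ^+ 2.
    rewrite opZE ripZl sqr_hnrm /= rip_adjointl //; exact: vna_bop.
  rewrite (rip_proj x hG) (proj_pythagoras (G x) hE).
  have -> : V x = G x - E (G x) by [].
  have := h x; rewrite -(ler_pXn2r (n:=2)) ?nnegrE ?mulr_ge0 ?hnrm_ge0 //.
  rewrite exprMn (proj_pythagoras (G x) hE) => h2; nra.
have le2 : op_le (V \o adjoint V) (id - E).
  apply/op_leP; [exact: pos_sa|exact: pos_sa|move=> x].
  rewrite aV /V /= GG (rip_proj x hE1).
  rewrite (sa_rip _ _ hE1.1) (rip_proj _ hG) lerXn2r ?nnegrE ?hnrm_ge0 //.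
  exact: proj_le.
apply: (@le_trans _ _ (tau (2%:C *: (adjoint V \o V)))).
  by apply: tau_le => //; exact: posZ.
rewrite (traceZ htau) // tau_conj // lee_pmul2l //; last exact: tau_le.
Qed.

(** Convergence of the quadratic forms makes [A] the least upper bound of the increasing sequence,
    which is the form in which normality is available. *)
Lemma tau_normal_le (A : H -> H) (A_ : nat -> H -> H) (c : \bar R) :
  pos_part N A -> (forall n, pos_part N (A_ n)) ->
  (forall m n, (m <= n)%N -> op_le (A_ m) (A_ n)) -> (forall n, op_le (A_ n) A) ->
  (forall x e, 0 < e -> exists n, rip (A x) x <= rip (A_ n x) x + e) ->
  (forall n, (tau (A_ n) <= c)%E) -> (tau A <= c)%E.
Proof.
move=> pA pA_ nd ub lim hc.
rewrite (@trace_normal _ _ _ _ htau (range A_)) //.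
- by apply: ge_ereal_sup => _ [_ [n _ <-] <-].
- by move=> _ [n _ <-].
- split; first by exists (A_ 0%N), 0%N.
  move=> _ _ [m _ <-] [n _ <-]; exists (A_ (maxn m n)); first by exists (maxn m n).
  by split; apply: nd; rewrite ?leq_maxl ?leq_maxr.
- split=> // [_ [n _ <-]//|U pU hU]; apply/op_leP; [exact: pos_sa|exact: pos_sa|move=> x].
  apply/ler_addgt0Pr => e e0; have [n hn] := lim x e e0.
  rewrite (le_trans hn) // lerD2r.
  have /op_leP := hU (A_ n) (ex_intro2 _ _ n I erefl); apply; exact: pos_sa.
Qed.

Lemma compact_ideal_closed : closed_ideal N (compact_ideal N tau).
Proof.
split.
- by move=> T [].
- by split=> [|J hJ _]; [exact: vna0|exact: ideal0 hJ].
- move=> S T [NS hS] [NT hT]; split=> [|J hJ tJ]; first exact: vnaD.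
  by apply: (idealD hJ); [exact: hS|exact: hT].
- move=> S T NS [NT hT]; split; split; try exact: vnaM.
    by move=> J hJ tJ; have [] := ideal_comp hJ NS (hT J hJ tJ).
  by move=> J hJ tJ; have [] := ideal_comp hJ NS (hT J hJ tJ).
- move=> T NT h; split=> // J hJ tJ; apply: (ideal_closed hJ) => // e e0.
  have [S [NS hS] Se] := h e e0; exists S => //; exact: hS.
Qed.

End VonNeumann.

(** * Real functions: the exponential weight and the normalising integral *)

Section RealFunctions.
Context {R : realType}.
Implicit Types (f g : R -> R) (t y K : R).

Lemma lb_continuous f : continuous f -> lbfun f.
Proof.
move=> cf; split; first exact: continuous_measurable_fun.
move=> K; have cK : compact `[- K, K]%classic by exact: segment_compact.
have : compact (f @` `[- K, K]%classic).
  by apply: continuous_compact => //; exact: continuous_subspaceT.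
move=> /compact_bounded[M [_ hM]]; exists (M + 1) => y yK.
apply: (hM (M + 1)); first by rewrite ltrDl.
by exists y => //=; rewrite in_itv /= -ler_norml.
Qed.

Lemma lb_sqrt : lbfun (@Num.sqrt R).
Proof. exact/lb_continuous/sqrt_continuous. Qed.

Lemma lb_ge0 : lbfun (\1_(`[0, +oo[) : R -> R).
Proof. by apply: lb_indic; exact: measurable_itv. Qed.

Lemma lb_pt t : lbfun (\1_[set t] : R -> R).
Proof. by apply: lb_indic; exact: measurable_set1. Qed.

Lemma lb_inv : lbfun (fun y : R => (1 + `|y|)^-1).
Proof.
apply: lb_continuous => y; apply: cvgV; first by rewrite gt_eqF // ltr_pwDl.
by apply: cvgD; [exact: cvg_cst|exact: norm_continuous].
Qed.

Lemma lb_max0 f : lbfun f -> lbfun (fun y => Num.max (f y) 0).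
Proof.
move=> lf; have e : (fun y => Num.max (f y) 0) =
    (fun y => 2^-1 * ((fun y => `|f y|) \+ f) y).
  apply/funext => y /=; rewrite maxEge; case: leP => h.
    by rewrite ger0_norm //; field.
  by rewrite ltr0_norm // addNr mulr0.
by rewrite e; apply/lbZ/lbD => //; exact: lb_norm.
Qed.

Lemma lb_sg : lbfun (@Num.sg R).
Proof.
have e : @Num.sg R = (fun y => 2 * (\1_(`[0, +oo[) y)) \- (fun=> 1) \- \1_[set 0].
  apply/funext => y /=; rewrite !indicE !mem_setE in_itv /= andbT.
  have [y0|y0|<-] := ltgtP 0 y.
  - have -> : (y \in [set 0]) = false.
      by apply/negbTE; rewrite notin_setE /= => e; rewrite e ltxx in y0.
    by rewrite gtr0_sg //=; ring.
  - have -> : (y \in [set 0]) = false.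
      by apply/negbTE; rewrite notin_setE /= => e; rewrite e ltxx in y0.
    by rewrite ltr0_sg //=; ring.
  - by rewrite sgr0 mem_set //=; ring.
rewrite e; apply: lbB; last exact: lb_pt.
by apply: lbB; [exact/lbZ/lb_ge0|exact: lb_cst].
Qed.

Variables (q : R) (q0 : 0 < q).

Lemma heat_itv y : 0 <= heat q y <= 1.
Proof.
rewrite /heat; case: ifP => _; first by rewrite lexx ler01.
by rewrite expR_ge0 /= -[leRHS]expR0 ler_expR oppr_le0 powR_ge0.
Qed.

Lemma lb_heat : lbfun (heat q).
Proof.
have e : heat q = (fun y => expR (- (y `^ (- q^-1)))) \* ((fun=> 1) \- \1_[set 0]).
  apply/funext => y; rewrite /heat /= indicE; case: eqP => [->|/eqP y0].
    by rewrite mem_set // subrr mulr0.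
  by rewrite memNset ?subr0 ?mulr1 //; apply/eqP.
split=> [|K]; last by exists 1 => y _; have /andP[h0 h1] := heat_itv y; rewrite ger0_norm.
rewrite e; apply: measurable_funM.
  apply: measurableT_comp; first exact: measurable_expR.
  by apply: measurableT_comp => //; exact: measurable_powR.
by apply: measurable_funB; [exact: measurable_cst|exact: (lb_pt 0).1].
Qed.

Lemma heat_nd x y : 0 <= x -> x <= y -> heat q x <= heat q y.
Proof.
move=> x0 xy; rewrite /heat; case: eqP => [_|/eqP x1].
  by have /andP[] := heat_itv y.
have xp : 0 < x by rewrite lt0r x1.
have yp := lt_le_trans xp xy; rewrite gt_eqF // ler_expR lerN2.
rewrite !powRN lef_pV2 ?posrE ?powR_gt0 //.
by apply: ge0_ler_powR; rewrite ?nnegrE ?invr_ge0 ?(ltW q0) ?(ltW yp).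
Qed.

(** These points calibrate the spectral cut-offs of the trace estimate. *)
Lemma heat_natpow n : heat q (n.+1%:R `^ (- q)) = expR (- n.+1%:R).
Proof.
rewrite /heat gt_eqF ?powR_gt0 // -powRrM mulrNN divff ?powRr1 //.
exact: lt0r_neq0.
Qed.

Lemma heat_cvg0 e : 0 < e -> exists2 d, 0 < d & forall y, 0 <= y < d -> heat q y < e.
Proof.
move=> e0; pose n := Num.bound e^-1.
exists (n.+1%:R `^ (- q)); first exact: powR_gt0.
move=> y /andP[y0 yd]; apply: le_lt_trans (heat_nd y0 (ltW yd)) _.
rewrite heat_natpow expRN invf_plt ?posrE ?expR_gt0 //.
have : e^-1 < n%:R by apply: archi_boundP; rewrite invr_ge0 ltW.
move=> h; rewrite (lt_le_trans h) // (le_trans _ (expR_ge1Dx _)) //.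
by rewrite -natr1; have : 0 <= n%:R :> R by []; lra.
Qed.

(** The absolute value makes continuity at 0 two-sided; there it is the decay of exp (- x^(-1/q)),
    elsewhere the continuity of exp and ln. *)
Lemma heat_continuous y : 0 <= y -> {for y, continuous (fun t => heat q `|t|)}.
Proof.
move=> y0; apply/cvgrPdist_lt => e e0.
have [->|y1] := eqVneq y 0.
  have [d d0 hd] := heat_cvg0 e0.
  have h0 : heat q 0 = 0 by rewrite /heat eqxx.
  apply/nbhs_ballP; exists d => // t; rewrite /ball /= sub0r normrN => td.
  rewrite normr0 h0 sub0r normrN ger0_norm ?hd ?normr_ge0 //.
  by have /andP[] := heat_itv `|t|.
have yp : 0 < y by rewrite lt0r y1.
have c : {for y, continuous (fun t : R => expR (- (expR (- q^-1 * ln t))))}.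
  apply: continuous_comp; last exact: continuous_expR.
  apply: continuous_comp; last exact: opp_continuous.
  apply: continuous_comp; last exact: continuous_expR.
  by apply: cvgM; [exact: cvg_cst|exact: continuous_ln].
have hc := @cvgr_dist_lt _ _ _ _ (nbhs_filter y) _ _ c _ e0.
have hE (t : R) : 0 < t -> heat q `|t| = expR (- (expR (- q^-1 * ln t))).
  by move=> t0; rewrite /heat normr_eq0 gt_eqF // gtr0_norm // /powR gt_eqF.
have hp : \forall t \near y, 0 < t.
  apply/nbhs_ballP; exists y => // t; rewrite /ball /= ltr_norml => /andP[]; lra.
suff : \forall t \near y, `|heat q (`|y|) - heat q (`|t|) | < e by [].
by apply: filterS2 hp hc => t t0; rewrite !hE.
Qed.

Local Notation mu := (@lebesgue_measure R).

(** With x = 2 t - 1 one has 1 - x^2 = 4 t (1 - t) and dx = 2 dt. The left integrand is the value at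
    y = 2 of the odd function of D whose trace is taken, so the Jacobian is accounted for by the
    eigenvalue 2. *)
Lemma C0_substitution :
  \int[mu]_(t in `[0, 1]) (2 * heat q `|t * (1 - t) * 2 ^+ 2|) = C0 q.
Proof.
pose F (t : R) : R := 2 * t - 1; pose G (x : R) := heat q `|1 - x ^+ 2|.
have dF t : is_derive t (1 : R) F 2.
  have -> : F = 2 *: id - cst 1 :> (R -> R) by [].
  by apply: is_derive_eq; rewrite subr0 /GRing.scale /= mulr1.
have F'E : derive1 F = cst 2.
  by apply/funext => t; rewrite derive1E; apply: derive_val.
have cF : continuous F.
  by move=> t; apply: cvgB; [apply: cvgM; [exact: cvg_cst|exact: cvg_id]|exact: cvg_cst].
have cG : {within `[F 0, F 1], continuous G}.
  apply: (@continuous_in_subspaceT _ _ `[F 0, F 1]%classic) => x.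
  rewrite inE /F /= in_itv /= mulr0 mulr1 sub0r => /andP[x1 x2].
  have hx : 0 <= 1 - x ^+ 2.
    by rewrite subr_ge0 -real_normK ?num_real // expr_le1 // ler_norml x1 /=; lra.
  apply: (@continuous_comp _ _ _ (fun x : R => 1 - x ^+ 2) (fun t => heat q `|t|)).
    by apply: cvgB; [exact: cvg_cst|exact: exprn_continuous].
  exact: heat_continuous.
have := @integration_by_substitution_increasing R F G 0 1 ler01.
rewrite F'E => /(_ _ _ _ _ _ cG) h.
rewrite /C0 /Rintegral; congr fine.
have F0 : F 0 = -1 by rewrite /F mulr0 sub0r.
have F1 : F 1 = 1 by rewrite /F mulr1; lra.
transitivity (\int[mu]_(x in `[F 0%R, F 1%R]) (G x)%:E)%E.
  rewrite h.
  - apply: eq_integral => t _.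
    have -> : ((G \o F) * cst 2) t = heat q `|1 - (2 * t - 1) ^+ 2| * 2 by [].
    have -> : 1 - (2 * t - 1) ^+ 2 = t * (1 - t) * 2 ^+ 2 by ring.
    by rewrite mulrC.
  - by move=> x y _ _ xy; rewrite /F ltrD2r ltr_pM2l.
  - by move=> t _; exact: cvg_cst.
  - by apply: is_cvg_cst.
  - by apply: is_cvg_cst.
  - split.
    + by move=> t _; apply: ex_derive.
    + by apply: cvg_at_right_filter; exact: cF.
    + by apply: cvg_at_left_filter; exact: cF.
rewrite F0 F1; apply: eq_integral => x; rewrite inE /= in_itv /= => /andP[x1 x2].
congr EFin; rewrite /G ger0_norm // subr_ge0 -real_normK ?num_real //.
by rewrite expr_le1 // ler_norml x1.
Qed.

Lemma itv_length (a b : R) : a < b -> mu `[a, b]%classic = (b - a)%:E.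
Proof. by move=> ab; rewrite lebesgue_measure_itv /= lte_fin ab -EFinB. Qed.

Lemma lb_lebesgue_integrable f : lbfun f -> mu.-integrable `[0, 1] (EFin \o f).
Proof.
move=> lf; have [C hC] := lf.2 1.
apply: measurable_bounded_integrable => //.
- by rewrite [ltLHS](itv_length ltr01) ltry.
- by apply: measurable_funTS; exact: lf.1.
- exists C; split=> [|z Cz y]; first exact: num_real.
  rewrite /= in_itv /= => /andP[y0 y1].
  by rewrite (le_trans (hC y _)) ?ger0_norm // ltW.
Qed.

Lemma lb_heat_path c : lbfun (fun t => c * heat q `|t * (1 - t) * 2 ^+ 2|).
Proof.
apply: lbZ; apply: (lb_comp lb_heat); apply: lb_norm.
apply: lb_continuous => t; apply: cvgM; last exact: cvg_cst.
by apply: cvgM; [exact: cvg_id|apply: cvgB; [exact: cvg_cst|exact: cvg_id]].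
Qed.

(** On [1/4, 3/4] the argument 4 t (1 - t) is at least 3/4. *)
Lemma C0_gt0 : 0 < C0 q.
Proof.
rewrite -C0_substitution.
pose c := 2 * heat q (3 / 4).
have c0 : 0 < c.
  by rewrite mulr_gt0 // /heat gt_eqF ?expR_gt0 // divr_gt0.
apply: (@lt_le_trans _ _ (c * 2^-1)); first by rewrite mulr_gt0 ?invr_gt0.
have lc : lbfun (fun t => c * \1_(`[4^-1, 3 / 4]) t).
  by apply/lbZ/lb_indic; exact: measurable_itv.
have -> : c * 2^-1 = \int[mu]_(t in `[0, 1]) (c * \1_(`[4^-1, 3 / 4]) t).
  rewrite RintegralZl //; last first.
    by apply: lb_lebesgue_integrable; apply: lb_indic; exact: measurable_itv.
  congr (_ * _); rewrite /Rintegral integral_indic //.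
  rewrite setIidl; last first.
    by move=> t /=; rewrite !in_itv /= => /andP[h1 h2]; apply/andP; split; lra.
  have h43 : 4^-1 < 3 / 4 :> R by lra.
  by rewrite (congr1 fine (itv_length h43)) /=; lra.
apply: le_Rintegral.
- exact: measurable_itv.
- exact: lb_lebesgue_integrable.
- by apply: lb_lebesgue_integrable; exact: lb_heat_path.
move=> t _; rewrite indicE; case: (boolP (t \in _)) => [|_]; last first.
  by rewrite mulr0 mulr_ge0 //; have /andP[] := heat_itv `|t * (1 - t) * 2 ^+ 2|.
rewrite inE /= in_itv /= mulr1 => /andP[h1 h2]; rewrite /c ler_wpM2l //.
apply: heat_nd; first by rewrite divr_ge0.
rewrite (le_trans _ (ler_norm _)) //; nra.
Qed.

End RealFunctions.

(** * Elementary functions of a self-adjoint operator *)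

Section OperatorFunctions.
Context {R : realType} {H : hilbertType R}.
Implicit Types (x y z : H) (T S A C : H -> H) (f g : R -> R) (a c t s : R).

Lemma compE T S x : (T \o S) x = T (S x). Proof. by []. Qed.

Lemma fc_sqr T : selfadjoint T -> fun_calc (fun t => t ^+ 2) T = T \o T.
Proof. by move=> sT; rewrite fc_X. Qed.

Lemma sa_sqr T : selfadjoint T -> selfadjoint (T \o T).
Proof. by move=> sT; exact: saM. Qed.

Lemma fc_scaled_sqr T c : selfadjoint T ->
  fun_calc (fun t => c * t ^+ 2) T = c%:C *: (T \o T).
Proof. by move=> sT; rewrite fcZ ?fc_sqr //; exact: lb_expr. Qed.

Lemma lb_abs : lbfun (fun t : R => `|t|).
Proof. exact/lb_norm/lb_id. Qed.

Lemma op_absE T : selfadjoint T -> op_abs T = fun_calc (fun t => `|t|) T.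
Proof.
move=> sT; rewrite /op_abs; have [_ ->] := sT.
rewrite -fc_sqr // fc_comp //; [|exact: lb_sqrt|exact: lb_expr].
by congr fun_calc; apply/funext => t /=; rewrite sqrtr_sqr.
Qed.

Lemma op_abs_fc T f : selfadjoint T -> lbfun f ->
  op_abs (fun_calc f T) = fun_calc (fun t => `|f t|) T.
Proof.
by move=> sT lf; rewrite op_absE ?fc_comp //; [exact: lb_abs|exact: fc_sa].
Qed.

Lemma fc_idem_proj T f : selfadjoint T -> lbfun f ->
  (forall t, `|t| <= opnorm T -> f t * f t = f t) -> projection (fun_calc f T).
Proof.
move=> sT lf ff; split; first exact: fc_sa.
by rewrite -fcM //; apply: fc_ext => //; exact: lbM.
Qed.

Lemma fc_indic_proj T (A : set (measurableTypeR R)) : selfadjoint T ->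
  measurable A -> projection (fun_calc (\1_A) T).
Proof.
move=> sT mA; apply: fc_idem_proj => //; first exact: lb_indic.
by move=> t _; rewrite indicE; case: (_ \in _); rewrite ?mulr1 ?mulr0.
Qed.

Lemma fc_pt_eigen T a x : selfadjoint T ->
  fun_calc (\1_[set a]) T x = x <-> T x = a%:C *: x.
Proof.
move=> sT; have lp := lb_pt a; split=> [<-|e]; last first.
  by rewrite (fc_eigen sT lp e) indicE mem_set // scale1r.
rewrite -{1}(fc_id sT) -compE -fcM //; last exact: lb_id.
rewrite -[RHS]opZE -fcZ //; congr (fun_calc _ T x); apply/funext => t /=.
rewrite indicE; case: (boolP (t \in _)); first by rewrite inE /= => ->.
by rewrite !mulr0.
Qed.

Lemma opnorm0 : opnorm (0 : H -> H) = 0.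
Proof.
apply/eqP; rewrite eq_le opnorm_ge0 ?andbT; last exact: bop0.
by apply: opnorm_le => // x; rewrite mul0r hnrm0.
Qed.

Lemma opnorm_eq0 T : bounded_op T -> opnorm T = 0 -> T = 0.
Proof.
move=> bT T0; apply/funext => x; apply/eqP; rewrite -hnrm_eq0 eq_le hnrm_ge0 andbT.
by have := le_opnorm x bT; rewrite T0 mul0r.
Qed.

Lemma opnormZ (c : R) T : bounded_op T -> opnorm (c%:C *: T) <= `|c| * opnorm T.
Proof.
move=> bT; apply: opnorm_le => [|x]; first by rewrite mulr_ge0 // opnorm_ge0.
by rewrite opZE hnrmZR -mulrA ler_wpM2l // le_opnorm.
Qed.

(* [(sg y - y) / 2 = sg y / (2 (1 + |y|)) * (1 - y^2)], with [sg 0 = 1]. *)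
Lemma pos_proj_defect T : selfadjoint T -> exists2 g : R -> R, lbfun g &
  fun_calc (\1_(`[0, +oo[)) T - (2^-1)%:C *: (id + T) =
  fun_calc g T \o (id - (T \o T)).
Proof.
move=> sT; have lg := @lb_ge0 R; have l1 := lb_cst (1 : R); have l2 := lb_expr (R := R) 2.
pose g (y : R) := (\1_(`[0, +oo[) y - 2^-1) * (1 + `|y|)^-1.
have l3 : lbfun g by apply: lbM; [exact: lbB lg (lb_cst _)|exact: lb_inv].
have l4 : lbfun (fun y : R => 2^-1 * (1 + y)) by apply: lbZ; exact: (lbD l1 (@lb_id R)).
exists g => //.
have -> : (2^-1)%:C *: (id + T) = fun_calc (fun y : R => 2^-1 * (1 + y)) T.
  by rewrite (fcZ _ sT (lbD l1 (@lb_id R))) (fcD sT l1 (@lb_id R)) fc1 // fc_id.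
have -> : id - (T \o T) = fun_calc ((fun=> 1) \- (fun y : R => y ^+ 2)) T.
  by rewrite (fcB sT l1 l2) fc1 // fc_sqr.
rewrite -(fcB sT lg l4) -(fcM sT l3 (lbB l1 l2)); congr fun_calc.
apply/funext => y; rewrite /g /= indicE mem_setE in_itv /= andbT.
have y1 : 1 + `|y| != 0 by rewrite gt_eqF // ltr_wpDr.
have [y0|y0] := leP 0 y; [rewrite ger0_norm // in y1 *|rewrite ltr0_norm // in y1 *].
  by rewrite /=; field.
by rewrite /=; field.
Qed.

End OperatorFunctions.

(** The square of A1 G2 + A2 G1, to be used with A1, A2 the moduli of two points G1, G2 of the path:
    noncommuting factors survive only in the anticommutator G1 G2 + G2 G1, which [path_cross]
    computes. *)
Lemma cross_square {R : realType} {H : hilbertType R} (G1 G2 A1 A2 : H -> H) (x : H) :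
  linear A1 -> linear A2 -> linear G1 -> linear G2 ->
  (forall w, A1 (A2 w) = A2 (A1 w)) ->
  (forall w, G1 (A1 w) = A1 (G1 w)) -> (forall w, G1 (A2 w) = A2 (G1 w)) ->
  (forall w, G2 (A1 w) = A1 (G2 w)) -> (forall w, G2 (A2 w) = A2 (G2 w)) ->
  (forall w, A1 (A1 w) = G1 (G1 w)) -> (forall w, A2 (A2 w) = G2 (G2 w)) ->
  let B w := A1 (G2 w) + A2 (G1 w) in
  B (B x) = A1 (A2 (A1 (A2 x) + A1 (A2 x) + (G1 (G2 x) + G2 (G1 x)))).
Proof.
move=> lA1 lA2 lG1 lG2 c g11 g12 g21 g22 s1 s2 B; rewrite /B.
rewrite (linD lG1) (linD lG2) g11 g12 g21 g22.
rewrite !(linD lA1) !(linD lA2) !(linD lA1) -s1 -s2.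
rewrite -[A2 (A1 (G1 (G2 x)))]c.
have -> : A1 (A1 (A2 (A2 x))) = A1 (A2 (A1 (A2 x))) by rewrite [A1 (A2 (A2 x))]c.
have -> : A2 (A2 (A1 (A1 x))) = A1 (A2 (A1 (A2 x))).
  by rewrite -!c.
rewrite -!addrA; congr +%R; rewrite addrC -!addrA addrC -!addrA; congr +%R.
by rewrite addrC.
Qed.

(** * Two symmetries *)

Section TwoSymmetries.
Context {R : realType} {H : hilbertType R}.
Implicit Types (x z w : H) (f g : R -> R) (a c t s r y : R).
Variables (F0 F1 : H -> H).
Hypotheses (sF0 : selfadjoint F0) (sF1 : selfadjoint F1).
Hypotheses (F00 : forall x, F0 (F0 x) = x) (F11 : forall x, F1 (F1 x) = x).

Let l0 := bop_lin (sa_bop sF0).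
Let l1 := bop_lin (sa_bop sF1).
Let D : H -> H := F1 - F0.
Let S : H -> H := F0 + F1.
Let Ft t : H -> H := F0 + t%:C *: D.

Let sD : selfadjoint D. Proof. exact: saB. Qed.
Let sS : selfadjoint S. Proof. exact: saD. Qed.
Let sF t : selfadjoint (Ft t). Proof. by apply: saD => //; exact: saZ. Qed.
Let lD := bop_lin (sa_bop sD).
Let lS := bop_lin (sa_bop sS).
Let lF t := bop_lin (sa_bop (sF t)).

Lemma symmetry_isometry F x : selfadjoint F -> (forall x, F (F x) = x) ->
  hnrm (F x) = hnrm x.
Proof.
move=> sF' FF; apply/eqP; rewrite -(eqrXn2 (n:=2)) ?hnrm_ge0 //.
by rewrite !sqr_hnrm sa_rip // FF.
Qed.

Let ripE := (@ripDl R H, @ripNl R H, @ripZl R H, @rip0l R H).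

Lemma diff_norm : opnorm D <= 2.
Proof.
apply: opnorm_le => // x; rewrite /D opBE (le_trans (hnrmB _ _)) //.
by rewrite !symmetry_isometry //; lra.
Qed.

Lemma diff_sqr x : D (D x) = 2%:C *: x - (F0 (F1 x) + F1 (F0 x)).
Proof.
rewrite /D !opBE (linB l1) (linB l0) F00 F11.
by apply: rip_eq => z; rewrite !ripE; ring.
Qed.

Lemma diff_sum_anticomm x : D (S x) = - S (D x).
Proof.
rewrite /D /S !(opBE, opDE) (linD l1) (linD l0) (linB l1) (linB l0) F00 F11.
by apply: rip_eq => z; rewrite !ripE; ring.
Qed.

Lemma sum_sqr x : S (S x) = 4%:C *: x - D (D x).
Proof.
rewrite diff_sqr /S !opDE (linD l1) (linD l0) F00 F11.
by apply: rip_eq => z; rewrite !ripE; ring.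
Qed.

Lemma diff_sqr_comm t x : Ft t (D (D x)) = D (D (Ft t x)).
Proof.
have c0 w : F0 (D (D w)) = D (D (F0 w)).
  rewrite !diff_sqr (linB l0) (linD l0) (linZ l0) !F00.
  by apply: rip_eq => z; rewrite !ripE; ring.
have FE w : Ft t w = F0 w + t%:C *: D w by [].
by rewrite !FE c0 (linD lD) (linZ lD) (linD lD) (linZ lD).
Qed.

Lemma path_sum t x : Ft t x = (2^-1)%:C *: S x + (t - 2^-1)%:C *: D x.
Proof.
rewrite /Ft /S /D !(opDE, opZE) !opNE.
by apply: rip_eq => z; rewrite !ripE; field.
Qed.

Lemma path_cross t s x : Ft t (Ft s x) + Ft s (Ft t x) =
  2%:C *: x - (t + s - 2 * t * s)%:C *: D (D x).
Proof.
have FE r w : Ft r w = (1 - r)%:C *: F0 w + r%:C *: F1 w.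
  rewrite /Ft /D !(opDE, opZE) !opNE.
  by apply: rip_eq => z; rewrite !ripE; ring.
rewrite !FE !(linD l0) !(linD l1) !(linZ l0) !(linZ l1) !F00 !F11 diff_sqr.
by apply: rip_eq => z; rewrite !ripE; ring.
Qed.

Lemma path_sqr t x : Ft t (Ft t x) = x - (t * (1 - t))%:C *: D (D x).
Proof.
have := path_cross t t x => e; apply: rip_eq => z.
by have := congr1 (rip^~ z) e; rewrite !ripE; lra.
Qed.

Let c_ t : R := t * (1 - t).

Lemma path_sqr_fc t : Ft t \o Ft t = fun_calc (fun y => 1 - c_ t * y ^+ 2) D.
Proof.
have -> : (fun y => 1 - c_ t * y ^+ 2) = (fun=> 1) \- (fun y => c_ t * y ^+ 2) by [].
rewrite fcB ?fc1 ?fc_scaled_sqr //; [|exact: lb_cst|exact/lbZ/lb_expr].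
by apply/funext => x; rewrite /= path_sqr.
Qed.

Lemma defect_fc t : id - (Ft t \o Ft t) = fun_calc (fun y => c_ t * y ^+ 2) D.
Proof.
rewrite fc_scaled_sqr //; apply/funext => x; rewrite opBE /= path_sqr.
by rewrite opprB addrCA subrr addr0.
Qed.

Definition flow_fun (q : R) t y := y * heat q `|t * (1 - t) * y ^+ 2|.

Lemma lb_flow_fun q t : 0 < q -> lbfun (flow_fun q t).
Proof.
move=> q0; apply: (lbM lb_id); apply: (lb_comp (lb_heat q)); apply: lb_norm.
exact/lbZ/lb_expr.
Qed.

Lemma flow_op_fc q t : 0 < q ->
  D \o fun_calc (heat q) (op_abs (id - (Ft t \o Ft t))) = fun_calc (flow_fun q t) D.
Proof.
move=> q0; have lc : lbfun (fun y => c_ t * y ^+ 2) by exact/lbZ/lb_expr.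
rewrite defect_fc op_abs_fc // fc_comp //; [|exact: lb_heat|exact: lb_norm].
rewrite -{1}(fc_id sD) -fcM //; first exact: lb_id.
by apply: (lb_comp (lb_heat q)); exact: lb_norm.
Qed.

(** The modulus of [Ft t] as a function of [D]; see [path_abs]. *)
Let al t y : R := Num.sqrt (1 - c_ t * y ^+ 2).
Let lb_poly2 t : lbfun (fun y => 1 - c_ t * y ^+ 2).
Proof. by apply: lbB; [exact: lb_cst|exact/lbZ/lb_expr]. Qed.
Let lb_al t : lbfun (al t).
Proof. exact: (lb_comp lb_sqrt (lb_poly2 t)). Qed.

Lemma path_abs t : fun_calc (fun y => `|y|) (Ft t) = fun_calc (al t) D.
Proof.
rewrite (_ : (fun y => `|y|) = Num.sqrt \o (fun y => y ^+ 2)).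
  rewrite -(fc_comp (sF t) lb_sqrt (lb_expr 2)) (fc_sqr (sF t)) path_sqr_fc.
  by rewrite (fc_comp sD lb_sqrt (lb_poly2 t)).
by apply/funext => y /=; rewrite sqrtr_sqr.
Qed.

(** Points of the path commute with D^2, not with D, so commutation with the modulus requires
    writing it as a function of D^2. *)
Lemma path_modulus_fc t :
  fun_calc (al t) D = fun_calc (fun y => Num.sqrt (1 - c_ t * y)) (D \o D).
Proof.
have l : lbfun (fun y => Num.sqrt (1 - c_ t * y)).
  apply: (lb_comp lb_sqrt); apply: lbB; [exact: lb_cst|exact/lbZ/lb_id].
by rewrite -(fc_sqr sD) (fc_comp sD l (lb_expr 2)).
Qed.

Lemma path_abs_comm t s x :
  Ft s (fun_calc (al t) D x) = fun_calc (al t) D (Ft s x).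
Proof.
rewrite path_modulus_fc.
have := @fc_comm R H (D \o D) (Ft s) (fun y => Num.sqrt (1 - c_ t * y)).
move=> /(_ (sa_sqr sD) (sa_bop (sF s))) h; apply: (congr1 (fun F => F x) (h _ _)).
  by apply/funext => y /=; rewrite diff_sqr_comm.
by apply: (lb_comp lb_sqrt); apply: lbB; [exact: lb_cst|exact/lbZ/lb_id].
Qed.

Let P t : H -> H := fun_calc (\1_(`[0, +oo[)) (Ft t).

(** Polar decomposition, with the sign taken to be 1 at 0: y = |y| (2 chi(y) - 1) for chi the
    indicator of [0, +oo[. *)
Lemma path_polar t x : Ft t x = fun_calc (al t) D (2%:C *: P t x - x).
Proof.
have lg := @lb_ge0 R.
rewrite -path_abs (linB (fc_lin (sF t) lb_abs)) (linZ (fc_lin (sF t) lb_abs)).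
rewrite -[fun_calc _ _ (P t x)]compE -fcM //; last exact: lb_abs.
rewrite -opZE -fcZ //; last by apply: lbM => //; exact: lb_abs.
rewrite -opBE -fcB //; [|apply: lbZ; apply: lbM => //; exact: lb_abs|exact: lb_abs].
rewrite -{1}(fc_id (sF t)); congr (fun_calc _ _ x); apply/funext => y /=.
rewrite indicE mem_setE in_itv /= andbT; case: leP => h /=.
  by rewrite ger0_norm //; ring.
by rewrite ltr0_norm //; ring.
Qed.

(** S^2 = 4 - D^2 kills [x], hence so does S, and F1 x = - F0 x is half of D x. *)
Lemma diff_eigen x a : a ^+ 2 = 4 -> D x = a%:C *: x ->
  [/\ S x = 0, F1 x = (a / 2)%:C *: x & F0 x = (- (a / 2))%:C *: x].
Proof.
move=> a4 e.
have Sx : S x = 0.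
  apply: rip_eq0; rewrite sa_rip // sum_sqr e (linZ lD) e scalerA -rmorphM /=.
  by rewrite -expr2 a4 subrr rip0r.
split=> //; apply: rip_eq => z.
  have := congr1 (rip^~ z) Sx; have := congr1 (rip^~ z) e.
  by rewrite /S /D !opDE !opNE !ripE; lra.
have := congr1 (rip^~ z) Sx; have := congr1 (rip^~ z) e.
by rewrite /S /D !opDE !opNE !ripE; lra.
Qed.

Lemma path_proj_eigen t x a : a ^+ 2 = 4 -> D x = a%:C *: x ->
  P t x = ((0 <= (t - 2^-1) * a)%R%:R : R)%:C *: x.
Proof.
move=> a4 e; have [Sx _ _] := diff_eigen a4 e.
have Fx : Ft t x = ((t - 2^-1) * a)%:C *: x.
  by rewrite path_sum Sx scaler0 add0r e scalerA -rmorphM.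
rewrite /P (fc_eigen (sF t) (@lb_ge0 R) Fx) indicE mem_setE in_itv /= andbT //.
Qed.

Lemma path_modulus_ge t y : y ^+ 2 <= 4 -> 0 <= t <= 1 -> `|1 - 2 * t| <= al t y.
Proof.
move=> y4 /andP[t0 t1]; rewrite -sqrtr_sqr; apply: ler_wsqrtr.
have c0 : 0 <= c_ t by rewrite /c_ mulr_ge0 // subr_ge0.
by rewrite /c_ in c0 *; nra.
Qed.

Lemma path_modulus_gt0 t y : y ^+ 2 < 4 -> 0 <= t <= 1 -> 0 < al t y.
Proof.
move=> y4 /andP[t0 t1]; rewrite sqrtr_gt0.
have c0 : 0 <= c_ t by rewrite /c_ mulr_ge0 // subr_ge0.
have : c_ t <= 4^-1 by have := sqr_ge0 (t - 2^-1); rewrite /c_; lra.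
have := sqr_ge0 y; move: (y ^+ 2) (c_ t) c0 y4 => v c; nra.
Qed.

(** [ga] is the coefficient of D^2 in [path_cross]. [Th] is the function of D that the square of |Ft
    s| Ft t + |Ft t| Ft s turns out to be. *)
Let ga t s : R := t + s - 2 * t * s.
Let Th t s y : R := al s y * al t y * (2 * (al s y * al t y) + 2 - ga t s * y ^+ 2).

(** The moduli are at least |1 - 2 s| and |1 - 2 t|, so their product is at least - (1 - 2 s) (1 - 2
    t) = 2 ga - 1, and the last factor is at least ga (4 - y^2). Finally ga >= (t - s)^2 > 0. *)
Lemma cross_factor_gt0 t s y : 0 <= t <= 1 -> 0 <= s <= 1 -> t != s ->
  y ^+ 2 < 4 -> 0 < Th t s y.
Proof.
move=> ht hs ts y4.
have := path_modulus_gt0 y4 ht; have := path_modulus_gt0 y4 hs.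
have := path_modulus_ge (ltW y4) ht; have := path_modulus_ge (ltW y4) hs.
rewrite /Th; move: (al s y : R) (al t y : R) => u v us vt u0 v0.
have g0 : 0 < ga t s.
  have : 0 < (t - s) ^+ 2 by rewrite exprn_even_gt0 // subr_eq0.
  by rewrite /ga; move: ht hs => /andP[t0 t1] /andP[s0 s1]; nra.
have uv : - ((1 - 2 * s) * (1 - 2 * t)) <= u * v.
  rewrite (le_trans (ler_norm _)) // normrN normrM.
  by apply: ler_pM.
have e : - ((1 - 2 * s) * (1 - 2 * t)) = 2 * ga t s - 1 by rewrite /ga; ring.
rewrite e in uv; apply: mulr_gt0; first exact: mulr_gt0.
have : 0 < ga t s * (4 - y ^+ 2) by rewrite mulr_gt0 // subr_gt0.
by move: (u * v) (ga t s) (y ^+ 2) uv => p g w; lra.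
Qed.

Lemma lb_cross_factor t s : lbfun (Th t s).
Proof.
apply: lbM; first exact: lbM.
apply: (@lbB _ (fun y => 2 * (al s y * al t y) + 2) (fun y => ga t s * y ^+ 2)).
  by apply: (@lbD _ (fun y => 2 * (al s y * al t y))); [apply/lbZ; exact: lbM|exact: lb_cst].
exact/lbZ/lb_expr.
Qed.

Let A r : H -> H := fun_calc (al r) D.
Let lA r : linear (A r). Proof. exact: fc_lin. Qed.

Lemma path_modulus_comm s t x : A s (A t x) = A t (A s x).
Proof.
have e : al s \* al t = al t \* al s by apply/funext => y; exact: mulrC.
have := congr1 (fun f => fun_calc f D x) e.
by rewrite (fcM sD (lb_al s) (lb_al t)) (fcM sD (lb_al t) (lb_al s)).
Qed.

Lemma path_modulus_sqr r x : 0 <= r <= 1 -> A r (A r x) = Ft r (Ft r x).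
Proof.
move=> /andP[r0 r1]; rewrite -[RHS]/((Ft r \o Ft r) x) path_sqr_fc -compE -fcM //.
apply: (congr1 (fun F => F x)); apply: fc_ext => //; first exact: lbM.
move=> y yD; rewrite /= /al -expr2 sqr_sqrtr //.
have y4 : y ^+ 2 <= 4.
  rewrite -real_normK ?num_real //; have := le_trans yD diff_norm.
  by have := normr_ge0 y; nra.
have c0 : 0 <= c_ r by rewrite /c_ mulr_ge0 // subr_ge0.
have : c_ r <= 4^-1 by have := sqr_ge0 (r - 2^-1); rewrite /c_; lra.
have := sqr_ge0 y; move: (y ^+ 2) (c_ r) c0 y4 => v c; nra.
Qed.

Lemma cross_factor_fc t s x : fun_calc (Th t s) D x =
  A s (A t (2%:C *: A s (A t x) + 2%:C *: x - (ga t s)%:C *: D (D x))).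
Proof.
have l2 : lbfun (fun y => 2 * (al s y * al t y)) by apply: lbZ; exact: lbM.
have l3 := lb_cst (2 : R).
have l4 : lbfun (fun y => ga t s * y ^+ 2) by exact/lbZ/lb_expr.
have -> : Th t s = (al s \* al t) \*
  ((fun y => 2 * (al s y * al t y)) \+ (fun=> 2) \- (fun y => ga t s * y ^+ 2)) by [].
rewrite (fcM sD (lbM (lb_al s) (lb_al t)) (lbB (lbD l2 l3) l4)).
rewrite (fcM sD (lb_al s) (lb_al t)) (fcB sD (lbD l2 l3) l4) (fcD sD l2 l3).
rewrite (fcZ _ sD (lbM (lb_al s) (lb_al t))) (fcM sD (lb_al s) (lb_al t)).
rewrite fc_scaled_sqr // fc_cst // !compE opBE opDE !opZE //.
Qed.

(* For [x] in the intersection, [Ft t x = |Ft t| x] and [Ft s x = - |Ft s| x], so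
   [|Ft s| Ft t + |Ft t| Ft s] kills [x]; its square is a function of D that
   vanishes on the spectrum only at 2 and - 2. *)
Lemma inter_diff_sqr t s x : 0 <= t <= 1 -> 0 <= s <= 1 -> t != s ->
  P t x = x -> P s x = 0 -> D (D x) = 4%:C *: x.
Proof.
move=> ht hs ts Ptx Psx.
have Ftx : Ft t x = A t x.
  by rewrite path_polar Ptx -/(A t); congr (A t _); apply: rip_eq => z; rewrite !ripE; ring.
have Fsx : Ft s x = - A s x.
  by rewrite path_polar Psx scaler0 sub0r -/(A s) (linN (lA s)).
have FA r1 r2 w : Ft r1 (A r2 w) = A r2 (Ft r1 w) by exact: path_abs_comm.
pose B (w : H) : H := A s (Ft t w) + A t (Ft s w).
have Bx : B x = 0 by rewrite /B Ftx Fsx (linN (lA t)) path_modulus_comm subrr.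
have lB0 : B 0 = 0 by rewrite /B !(lin0 (lF _)) !(lin0 (lA _)) addr0.
have BB : fun_calc (Th t s) D x = B (B x).
  rewrite cross_factor_fc.
  have -> : B (B x) =
      A s (A t (A s (A t x) + A s (A t x) + (Ft s (Ft t x) + Ft t (Ft s x)))).
    apply: (@cross_square R H _ _ _ _ x (lA s) (lA t) (lF s) (lF t)).
    - exact: path_modulus_comm.
    - exact: FA.
    - exact: FA.
    - exact: FA.
    - exact: FA.
    - by move=> w; exact: path_modulus_sqr.
    - by move=> w; exact: path_modulus_sqr.
  rewrite path_cross; congr (A s (A t _)).
  by apply: rip_eq => z; rewrite !ripE /ga; ring.
have T0 : fun_calc (Th t s) D x = 0 by rewrite BB Bx lB0.
have := @fc_ker R H D (Th t s) (fun y => 4 - y ^+ 2) x sD (lb_cross_factor t s).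
have l4 : lbfun (fun y : R => 4 - y ^+ 2) by apply: lbB; [exact: lb_cst|exact: lb_expr].
move=> /(_ l4); have -> : (fun y : R => 4 - y ^+ 2) = (fun=> 4) \- (fun y => y ^+ 2) by [].
rewrite (fcB sD (lb_cst 4) (lb_expr 2)) fc_sqr // fc_cst // opBE opZE compE => h.
apply/esym/eqP; rewrite -subr_eq0; apply/eqP; apply: h => // y yD Ty.
apply/eqP; rewrite subr_eq0 eq_sym; apply/negPn/negP => y4.
have y4' : y ^+ 2 < 4.
  rewrite lt_neqAle y4 -real_normK ?num_real //=; have := le_trans yD diff_norm.
  by have := normr_ge0 y; nra.
by have := cross_factor_gt0 ht hs ts y4'; rewrite Ty ltxx.
Qed.

(** Since D^2 x = 4 x, S kills x and the modulus of Ft r acts on x as |1 - 2 r|. Subtracting the two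
    values of the path gives (t - s) D x = (|1 - 2 t| + |1 - 2 s|) x, which fixes the sign of the
    eigenvalue. *)
Lemma path_inter_eigen t s x : 0 <= t <= 1 -> 0 <= s <= 1 -> t != s ->
  P t x = x -> P s x = 0 -> D x = (2 * Num.sg (t - s))%:C *: x.
Proof.
move=> ht hs ts Ptx Psx; have D4 := inter_diff_sqr ht hs ts Ptx Psx.
have Sx : S x = 0 by apply: rip_eq0; rewrite sa_rip // sum_sqr D4 subrr rip0r.
have Ax r : A r x = `|1 - 2 * r|%:C *: x.
  rewrite /A path_modulus_fc (fc_eigen (sa_sqr sD) _ D4).
    by congr (_%:C *: x); rewrite -sqrtr_sqr; congr Num.sqrt; rewrite /c_; ring.
  by apply: (lb_comp lb_sqrt); apply: lbB; [exact: lb_cst|exact/lbZ/lb_id].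
have Ftx : Ft t x = `|1 - 2 * t|%:C *: x.
  rewrite -Ax path_polar Ptx; congr (A t _).
  by apply: rip_eq => z; rewrite !ripE; ring.
have Fsx : Ft s x = - (`|1 - 2 * s|%:C *: x).
  by rewrite path_polar Psx scaler0 sub0r -/(A s) (linN (lA s)) Ax.
have [->|x0] := eqVneq x 0; first by rewrite (lin0 lD) scaler0.
have ts0 : t - s != 0 by rewrite subr_eq0.
pose a : R := (`|1 - 2 * t| + `|1 - 2 * s|) / (t - s).
have Dx : D x = a%:C *: x.
  apply: rip_eq => z; have := congr1 (rip^~ z) Ftx; have := congr1 (rip^~ z) Fsx.
  rewrite !path_sum Sx scaler0 !add0r !ripE => e1 e2.
  apply: (mulfI ts0); rewrite /a mulrA [_ * (_ / _)]mulrC divfK //.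
  by move: e1 e2; lra.
have a4 : a ^+ 2 = 4.
  have := congr1 (rip^~ x) D4; rewrite /= Dx (linZ lD) Dx !ripE mulrA -expr2.
  by apply: mulIf; rewrite -sqr_hnrm expf_neq0 // hnrm_eq0.
rewrite Dx; congr (_%:C *: x).
have h0 : 0 <= `|1 - 2 * t| + `|1 - 2 * s| by rewrite addr_ge0.
have [s0|t0|e] := ltgtP s t; last by rewrite e eqxx in ts.
  rewrite gtr0_sg ?subr_gt0 //; have : 0 <= a by rewrite divr_ge0 // subr_ge0 ltW.
  by move=> a0; nra.
rewrite ltr0_sg ?subr_lt0 //; have : a <= 0.
  by rewrite mulr_ge0_le0 // invr_le0 subr_le0 ltW.
by move=> a0; nra.
Qed.

Lemma path_spectral_proj t : projection (P t).
Proof. by apply: fc_indic_proj => //; exact: measurable_itv. Qed.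

Let lP0 t : P t 0 = 0.
Proof. exact: lin0 (fc_lin (sF t) (@lb_ge0 R)). Qed.

Let E a : H -> H := fun_calc (\1_[set a]) D.

Lemma diff_eigenproj a : projection (E a).
Proof. by apply: fc_indic_proj => //; exact: measurable_set1. Qed.

Lemma proj_onto_eigen (V : set H) (c : bool) a :
  (forall x, V x <-> c /\ D x = a%:C *: x \/ x = 0) ->
  proj_onto V = if c then E a else 0.
Proof.
case: ifP => _ hV; apply: proj_ontoE; [exact: diff_eigenproj| |exact: proj0|] => x.
  rewrite hV /E fc_pt_eigen //; split=> [e|[[]//|->]]; first by left.
  by rewrite (lin0 lD) scaler0.
by rewrite hV; split=> [<-|[[]//|->]]; [right|].
Qed.

(** On the eigenspace for 2, [Ft t] is the scalar 2 t - 1, and 0 counts as nonnegative in [P t]: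
    these vectors enter the range at t = 1/2 included. On the eigenspace for - 2 the scalar is 1 - 2
    t, and vectors leave only after 1/2; hence the different strict inequalities in the companion
    statement. *)
Lemma pair_range_ker s t : 0 <= s -> s < t -> t <= 1 ->
  proj_onto (range (P t) `&` ker (P s)) = if s < 2^-1 <= t then E 2 else 0.
Proof.
move=> s0 st t1; have hs : 0 <= s <= 1 by lra.
have ht : 0 <= t <= 1 by lra.
have sq2 : (2 : R) ^+ 2 = 4 by ring.
apply: proj_onto_eigen => x.
split=> [[/(range_proj _ (path_spectral_proj t)) Ptx Psx]|].
  have [->|x0] := eqVneq x 0; [by right|left].
  have Dx : D x = 2%:C *: x.
    have := path_inter_eigen ht hs (negbT (gt_eqF st)) Ptx Psx.
    by rewrite gtr0_sg ?subr_gt0 // mulr1.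
  have sE : (0 <= (s - 2^-1) * 2) = (2^-1 <= s) by rewrite pmulr_lge0 // subr_ge0.
  have tE : (0 <= (t - 2^-1) * 2) = (2^-1 <= t) by rewrite pmulr_lge0 // subr_ge0.
  split=> //; have := path_proj_eigen t sq2 Dx; have := path_proj_eigen s sq2 Dx.
  rewrite Ptx Psx sE tE ltNge; case: leP => h1.
    by rewrite scale1r => e; rewrite -e eqxx in x0.
  case: (leP 2^-1 t) => h2; first by move=> _ _; apply/andP.
  by rewrite scale0r => _ e; rewrite e eqxx in x0.
case=> [[/andP[h1 h2] Dx]|->]; last first.
  by split; [apply/(range_proj _ (path_spectral_proj t))|]; exact: lP0.
split; first apply/(range_proj _ (path_spectral_proj t)).
  by rewrite (path_proj_eigen t sq2 Dx) mulr_ge0 ?subr_ge0 // scale1r.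
by rewrite /ker /= (path_proj_eigen s sq2 Dx) leNgt (_ : _ < 0) ?scale0r //; lra.
Qed.

Lemma pair_ker_range s t : 0 <= s -> s < t -> t <= 1 ->
  proj_onto (ker (P t) `&` range (P s)) = if s <= 2^-1 < t then E (- 2) else 0.
Proof.
move=> s0 st t1; have hs : 0 <= s <= 1 by lra.
have ht : 0 <= t <= 1 by lra.
have sq2 : (- 2 : R) ^+ 2 = 4 by ring.
apply: proj_onto_eigen => x.
split=> [[Ptx /(range_proj _ (path_spectral_proj s)) Psx]|].
  have [->|x0] := eqVneq x 0; [by right|left].
  have Dx : D x = (- 2)%:C *: x.
    have := path_inter_eigen hs ht (negbT (lt_eqF st)) Psx Ptx.
    by rewrite ltr0_sg ?subr_lt0 // mulrN1.
  have n2 : (- 2 : R) < 0 by rewrite oppr_lt0.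
  have sE : (0 <= (s - 2^-1) * - 2) = (s <= 2^-1) by rewrite nmulr_lge0 // subr_le0.
  have tE : (0 <= (t - 2^-1) * - 2) = (t <= 2^-1) by rewrite nmulr_lge0 // subr_le0.
  split=> //; have := path_proj_eigen t sq2 Dx; have := path_proj_eigen s sq2 Dx.
  rewrite Ptx Psx sE tE; case: (leP s) => h1; last first.
    by rewrite scale0r => e; rewrite e eqxx in x0.
  case: (leP t) => h2; last by move=> _ _; apply/andP.
  by rewrite scale1r => _ e; rewrite -e eqxx in x0.
case=> [[/andP[h1 h2] Dx]|->]; last first.
  by split; [|apply/(range_proj _ (path_spectral_proj s))]; exact: lP0.
split; last apply/(range_proj _ (path_spectral_proj s)).
  by rewrite /ker /= (path_proj_eigen t sq2 Dx) leNgt (_ : _ < 0) ?scale0r //; lra.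
by rewrite (path_proj_eigen s sq2 Dx) (_ : 0 <= _) ?scale1r //; lra.
Qed.

End TwoSymmetries.

(** * Trace estimates *)

Section TraceEstimates.
Context {R : realType} {H : hilbertType R}.
Implicit Types (x z w : H) (T E G Q : H -> H) (f g : R -> R) (a c e s t y : R).
Variables (N : set (H -> H)) (hN : von_neumann_algebra N).
Variables (tau : (H -> H) -> \bar R) (htau : fns_trace N tau).

Section UnitaryConjugation.
Variables (U : H -> H) (NU : N U) (UU : adjoint U \o U = id) (UV : U \o adjoint U = id).

Let bU : bounded_op U. Proof. exact: vna_bop NU. Qed.
Let NV : N (adjoint U). Proof. exact: vna_adj. Qed.

Lemma projection_conj Q : projection Q -> projection (U \o Q \o adjoint U).
Proof.
move=> [sQ QQ]; split; first exact: sa_conj.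
apply/funext => x /=; rewrite -[adjoint U (U _)]/((adjoint U \o U) _) UU /=.
by rewrite -[Q (Q _)]/((Q \o Q) _) QQ.
Qed.

(** Traciality for V = U Q, as V* V = Q and V V* = U Q U*. *)
Lemma tau_projection_conj Q : N Q -> projection Q -> tau (U \o Q \o adjoint U) = tau Q.
Proof.
move=> NQ [[bQ aQ] QQ]; have NUQ : N (U \o Q) by exact: vnaM.
have aUQ : adjoint (U \o Q) = Q \o adjoint U by rewrite adjointM // aQ.
have := tau_conj htau NUQ; rewrite aUQ => e.
have -> : U \o Q \o adjoint U = (U \o Q) \o (Q \o adjoint U).
  by apply/funext => x /=; rewrite -[Q (Q _)]/((Q \o Q) _) QQ.
rewrite -e; congr tau; apply/funext => x /=.
rewrite -[adjoint U (U _)]/((adjoint U \o U) _) UU /=.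
by rewrite -[Q (Q _)]/((Q \o Q) _) QQ.
Qed.

End UnitaryConjugation.

Section SpectralGap.
Variables (U D X : H -> H).
Hypotheses (NU : N U) (UU : adjoint U \o U = id) (UV : U \o adjoint U = id).
Hypotheses (ND : N D) (sD : selfadjoint D) (DU : forall x, D (U x) = - X x).
Hypothesis bX : bounded_op X.

Let far c : set R := [set y : R | c <= `|y|].

Lemma measurable_far c : measurable (far c : set (measurableTypeR R)).
Proof.
rewrite (_ : far c = (fun y : R => `|y|) @^-1` `[c, +oo[).
  rewrite -[X in measurable X]setTI; have [+ _] := @lb_abs R.
  by apply => //; exact: measurable_itv.
by apply/seteqP; split=> y /=; rewrite in_itv /= andbT.
Qed.

Let G c : H -> H := fun_calc (\1_(far c)) D.

Lemma far_proj c : projection (G c).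
Proof. by apply: fc_indic_proj => //; exact: measurable_far. Qed.

(** Functional calculus applied to c^2 chi(y) <= y^2, for chi the indicator of [far c]. *)
Lemma far_norm_le c x : 0 <= c -> c * hnrm (G c x) <= hnrm (D x).
Proof.
move=> c0; rewrite -(ler_pXn2r (n:=2)) ?nnegrE ?mulr_ge0 ?hnrm_ge0 // exprMn !sqr_hnrm.
have lG := lb_indic (measurable_far c); have l2 := lb_expr (R := R) 2.
have := @fc_pos R H D sD ((fun y => y ^+ 2) \- (fun y => c ^+ 2 * (\1_(far c) y))) x.
rewrite (fcB sD l2 (lbZ _ lG)) fcZ // fc_sqr // opBE opZE ripBl ripZl subr_ge0 /=.
rewrite [rip (D (D x)) x]sa_rip // -!sqr_hnrm -(rip_proj x (far_proj c)) => h.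
apply: h; first exact: lbB l2 (lbZ _ lG).
move=> y _ /=; rewrite indicE subr_ge0; case: (boolP (y \in far c)).
  rewrite inE /= mulr1 => cy; rewrite -[leRHS]real_normK ?num_real //.
  by rewrite lerXn2r ?nnegrE.
by rewrite mulr0 sqr_ge0.
Qed.

(* The projection [E' = U E U*] has the trace of [E] and [|D E'| < c / 2], whereas
   [|D x| >= c |x|] on the range of [G c]. *)
Lemma tau_far_le c s : 0 < c -> 0 <= s -> mu N tau s X < c / 2 ->
  (tau (G c) <= 2%:E * s%:E)%E.
Proof.
move=> c0 s0 muX.
have [] := inf_lt _ muX.
  exists (opnorm (X \o id)), id => //; split; [exact: vna_id|exact: proj_id|].
  by rewrite subrr (tau0 hN htau) lee_fin.
move=> _ [E [NE hE tE] <-] XE.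
pose E' := U \o E \o adjoint U.
have hE' : projection E' by exact: projection_conj.
have NE' : N E' by apply: vnaM => //; [exact: vnaM|exact: vna_adj].
have tE' : tau (id - E') = tau (id - E).
  rewrite -(tau_projection_conj NU UU (vnaB hN (vna_id hN) NE) (projC hE)).
  congr tau; apply/funext => x; rewrite /= !opBE (linB (bop_lin (vna_bop hN NU))).
  by rewrite -[U (adjoint U _)]/((U \o adjoint U) _) UV.
have DE' x : hnrm (D (E' x)) <= c / 2 * hnrm x.
  have bXE : bounded_op (X \o E) by apply: bopM => //; exact: vna_bop NE.
  rewrite /E' /= DU hnrmN (le_trans (le_opnorm (adjoint U x) bXE)) //.
  rewrite ler_pM ?opnorm_ge0 ?hnrm_ge0 // ?(ltW XE) //.
  have bU := vna_bop hN NU.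
  rewrite -(ler_pXn2r (n:=2)) ?nnegrE ?hnrm_ge0 // !sqr_hnrm -rip_adjointr //.
  by rewrite -[U (adjoint U _)]/((U \o adjoint U) _) UV.
apply: le_trans (tau_proj_le hN htau _ (far_proj c) NE' hE' _) _.
- apply: vna_fc => //; exact: lb_indic (measurable_far c).
- move=> x; set y := G c x.
  have Gy : G c y = y by have [_] := far_proj c; move=> /(congr1 (fun F => F x)).
  have [->|E0] := eqVneq (hnrm (E' y)) 0; first by rewrite mulr_ge0 ?hnrm_ge0.
  have Ep : 0 < hnrm (E' y) by rewrite lt_neqAle eq_sym E0 hnrm_ge0.
  have h1 : c * hnrm (G c (E' y)) <= c / 2 * hnrm (E' y).
    apply: le_trans (far_norm_le _ (ltW c0)) _.
    have EE : E' (E' y) = E' y by have [_] := hE'; move=> /(congr1 (fun F => F y)).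
    by have := DE' (E' y); rewrite EE.
  have h2 : hnrm (E' y) ^+ 2 <= hnrm (G c (E' y)) * hnrm y.
    rewrite -rip_proj // -[X in rip _ X]Gy -(sa_rip _ _ (far_proj c).1).
    exact: rip_le.
  have h3 : hnrm (G c (E' y)) <= 2^-1 * hnrm (E' y).
    by rewrite -(ler_pM2l c0) (le_trans h1) // mulrA.
  rewrite -(ler_pM2l Ep) -expr2 (le_trans h2) //.
  by rewrite mulrCA mulrA ler_wpM2r ?hnrm_ge0 // .
- by rewrite tE' lee_pmul2l.
Qed.

Variables (q : R) (q0 : 0 < q) (q1 : q <= 1).
Hypothesis hLi : Li0 N tau (q / 2) X.

(** Chosen so that (c_ n)^2 / 4 = (n + 1)^(- q), the point at which [heat] equals exp (- n - 1). *)
Let c_ n : R := 2 * n.+1%:R `^ (- (q / 2)).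

(** At s = exp ((n + 1) / 2) the logarithm is (n + 1) / 2, and the asymptotic bound with constant
    1/2 reads mu_s <= 2^(q/2) / 2 * (n + 1)^(- q/2). As 2^(q/2) < 2, this is below half the
    cut-off. *)
Lemma tau_far_seq_le : exists m, forall n, (m <= n)%N ->
  (tau (G (c_ n)) <= (2 * expR (n.+1%:R / 2))%:E)%E.
Proof.
have [_ /eqoP /(_ 2^-1)] := hLi.
have h2 : 0 < (2^-1 : R) by rewrite invr_gt0.
(* This bound on n makes exp ((n + 1) / 2) exceed the threshold [M] of the asymptotic estimate. *)
move=> /(_ h2) [M [_ hM]]; exists (Num.bound (2 * `|M|)) => n mn.
have n0 : 0 < (n.+1%:R : R) by [].
have Mn : M < expR (n.+1%:R / 2).
  have h1 : 2 * `|M| < n.+1%:R.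
    rewrite (lt_le_trans (archi_boundP _)) ?mulr_ge0 // ler_nat; exact: leqW.
  apply: lt_le_trans (expR_ge1Dx _); have := ler_norm M.
  by move: h1; move: (n.+1%:R : R) => k; lra.
rewrite EFinM; apply: tau_far_le; [by rewrite /c_ mulr_gt0 // powR_gt0|exact: expR_ge0|].
have := le_trans (ler_norm _) (hM _ Mn); rewrite expRK => h; apply: le_lt_trans h _.
have e : (n.+1%:R^-1) `^ (q / 2) = n.+1%:R `^ (- (q / 2)) :> R.
  by rewrite -powR_inv1 ?ltW // -powRrM mulN1r.
have p0 : 0 < (n.+1%:R `^ (- (q / 2)) : R) by rewrite powR_gt0.
rewrite ger0_norm ?powR_ge0 // /c_ invf_div powRM // ?invr_ge0 // e.
rewrite [X in _ < X / 2]mulrC -[X in _ < X]mulrA divff // mulr1 mulrA gtr_pMl //.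
have : 2 `^ (q / 2) < 2 `^ 1 :> R.
  rewrite /powR gt_eqF // ltr_expR ltr_pM2r; last by rewrite ln_gt0 // ltr1n.
  by move: q1; lra.
by rewrite powRr1 //; lra.
Qed.

(** A majorant independent of t: for |y| <= 2, t (1 - t) <= 1/4 and monotonicity of [heat] bound |y|
    heat(t (1 - t) y^2) by it for all t in [0, 1]. *)
Let v y : R := 2 * heat q (4^-1 * y ^+ 2).

Lemma lb_weight : lbfun v.
Proof. by apply: lbZ; apply: (lb_comp (lb_heat q)); exact/lbZ/lb_expr. Qed.

Lemma weight_itv y : 0 <= v y <= 2.
Proof. by have /andP[h0 h1] := heat_itv q (4^-1 * y ^+ 2); rewrite /v; apply/andP; split; lra. Qed.

Lemma weight_le (y1 y2 : R) : `|y1| <= `|y2| -> v y1 <= v y2.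
Proof.
move=> yz; rewrite /v ler_pM2l //; apply: heat_nd => //.
  by rewrite mulr_ge0 ?sqr_ge0.
rewrite ler_pM2l //.
by rewrite -(real_normK (num_real y1)) -(real_normK (num_real y2)) lerXn2r ?nnegrE.
Qed.

Let farE c y : (\1_(far c) y : R) = (c <= `|y|)%R%:R.
Proof.
rewrite indicE; have -> // : (y \in far c) = (c <= `|y|).
by apply/idP/idP; rewrite inE. Qed.

(** In the layer c' <= |y| < c the weight is at most v(c); this bounds the gain when the cut-off is
    lowered. *)
Lemma weight_cut c c' y : 0 <= c ->
  v y * \1_(far c') y <= v y * \1_(far c) y + v c * \1_(far c') y.
Proof.
move=> c0; have /andP[v0 _] := weight_itv y; have /andP[vc _] := weight_itv c.
rewrite !farE; have vle : `|y| < c -> v y <= v c.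
  by move=> h; apply: weight_le; rewrite [`|c|]ger0_norm // ltW.
move: (v y) (v c) v0 vc vle => a b a0 b0 ab; have [h|h] := leP c `|y|.
  by case: (c' <= _); rewrite /= ?mulr1 ?mulr0 ?addr0 ?lerDl.
by rewrite mulr0 add0r; apply: ler_wpM2r => //; exact: ab.
Qed.

Lemma weight_cut_homo c c' y : c' <= c -> v y * \1_(far c) y <= v y * \1_(far c') y.
Proof.
move=> cc; have /andP[v0 _] := weight_itv y.
rewrite !farE; move: (v y) v0 => a a0; apply: ler_wpM2l => //; rewrite ler_nat.
by case: (leP c) => // /(le_trans cc) ->.
Qed.

Lemma weight_cut_ge c y : v y * \1_(far c) y <= v y.
Proof.
have /andP[v0 _] := weight_itv y.
by rewrite farE; move: (v y) v0 => a a0; case: (c <= _); rewrite /= ?mulr1 ?mulr0.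
Qed.

Lemma weight_cut_le c y : 0 <= c -> v y <= v y * \1_(far c) y + v c.
Proof.
move=> c0; have /andP[v0 _] := weight_itv y; have /andP[vc _] := weight_itv c.
rewrite farE; have [h|h] := leP c `|y|; first by rewrite mulr1 lerDl.
by rewrite mulr0 add0r; apply: weight_le; rewrite [`|c|]ger0_norm // ltW.
Qed.

Lemma weight_seq n : v (c_ n) = 2 * expR (- n.+1%:R).
Proof.
rewrite /v -(heat_natpow q0) /c_ exprMn mulrA; congr (2 * heat q _).
have -> : 4^-1 * 2 ^+ 2 = 1 :> R by field.
by rewrite mul1r -powR_mulrn ?powR_ge0 // -powRrM; congr (_ `^ _); field.
Qed.

Lemma far_seq_ni n k : (n <= k)%N -> c_ k <= c_ n.
Proof.
move=> nk; rewrite /c_ ler_pM2l // !powRN lef_pV2 ?posrE ?powR_gt0 //.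
by rewrite ge0_ler_powR ?nnegrE ?ler_nat // divr_ge0 ?ltW.
Qed.

(* [tau (G (c_ n))] is at most of the order [exp (n / 2)], while the weight is
   [2 exp (- n - 1)] at [c_ n]. *)
Lemma weight_finite : finite_pos N tau (fun_calc v D).
Proof.
have [m hm] := tau_far_seq_le.
have lG n : lbfun (\1_(far (c_ n)) : R -> R) by exact: lb_indic (measurable_far _).
have l_ n : lbfun (v \* \1_(far (c_ (m + n)))) by exact: lbM lb_weight (lG _).
pose A_ n : H -> H := fun_calc (v \* \1_(far (c_ (m + n)))) D.
have c0 n : 0 <= c_ n by rewrite /c_ mulr_ge0 // powR_ge0.
have far01 c y : 0 <= (\1_(far c) y : R) <= 1.
  by rewrite indicE; case: (_ \in _); rewrite ?lexx ?ler01.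
have pG n : pos_part N (G (c_ n)).
  by apply: pos_proj => //; [apply: vna_fc|exact: far_proj].
have pA_ n : pos_part N (A_ n).
  apply: pos_fc => // y _; have /andP[v0 _] := weight_itv y.
  by have /andP[i0 _] := far01 (c_ (m + n)) y; rewrite mulr_ge0.
have pA : pos_part N (fun_calc v D).
  by apply: pos_fc => //; [exact: lb_weight|move=> y _; have /andP[] := weight_itv y].
pose r : R := expR (- 2^-1).
have r0 : 0 < r by exact: expR_gt0.
have r1 : r < 1 by rewrite /r expR_lt1 oppr_lt0.
pose B : R := 2 * (2 * expR (m.+1%:R / 2)).
(* The sum of the geometric series 4 r^n with r = exp (- 1/2); its partial sums are L (1 - r^n). *)
pose L : R := 4 / (1 - r).
have L0 : 0 <= L by rewrite divr_ge0 // subr_ge0 ltW.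
(* A new layer costs at most 2 exp (- (m + n + 1)) times 2 exp ((m + n + 2) / 2), that is 4 exp (-
   (m + n) / 2). *)
have step n : (tau (A_ n.+1) <= tau (A_ n) + (4 * r ^+ n)%:E)%E.
  pose c := v (c_ (m + n)).
  have vc0 : 0 <= c by have /andP[] := weight_itv (c_ (m + n)).
  apply: (@le_trans _ _ (tau (A_ n + c%:C *: G (c_ (m + n.+1))))).
    apply: (tau_le hN htau) => //; first by apply: (posD hN) => //; exact: (posZ hN).
    rewrite /A_ /G -fcZ // -fcD //; last exact: lbZ.
    apply: fc_le => //; first by apply: lbD => //; exact: lbZ.
    move=> y _ /=.
    exact: weight_cut.
  rewrite (traceD htau) //; last exact: (posZ hN).
  rewrite (traceZ htau) //; apply: leeD => //.
  apply: (@le_trans _ _ (c%:E * (2 * expR ((m + n.+1).+1%:R / 2))%:E)%E).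
    by apply: lee_wpmul2l; [rewrite lee_fin|exact: hm (leq_addr _ _)].
  rewrite -EFinM lee_fin /c weight_seq.
  rewrite (_ : 2 * _ * (2 * _) = 4 * (expR (- (m + n).+1%:R) * expR ((m + n.+1).+1%:R / 2))); last by ring.
  rewrite ler_pM2l // -expRD /r -expRM_natl ler_expR.
  have -> : (m + n.+1).+1%:R = m%:R + n%:R + 2 :> R by rewrite addnS -addn2 !natrD.
  have -> : (m + n).+1%:R = m%:R + n%:R + 1 :> R by rewrite -addn1 !natrD.
  by have : 0 <= (m%:R : R) by []; lra.
have bnd n : (tau (A_ n) <= (B + L * (1 - r ^+ n))%:E)%E.
  elim: n => [|n IH].
    rewrite expr0 subrr mulr0 addr0 /B EFinM.
    apply: (@le_trans _ _ (2%:E * tau (G (c_ m)))%E); last first.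
      by apply: lee_wpmul2l; [rewrite lee_fin|exact: hm].
    rewrite -(traceZ htau) //; apply: (tau_le hN htau) => //; first exact: (posZ hN).
    rewrite /A_ /G -fcZ //; apply: fc_le => //; first exact: lbZ.
    move=> y _ /=; rewrite addn0; have /andP[_ v2] := weight_itv y.
    by have /andP[i0 _] := far01 (c_ m) y; rewrite ler_wpM2r.
  apply: le_trans (step n) _; apply: le_trans (leeD2r _ IH) _.
  rewrite -EFinD lee_fin exprS.
  have -> : 4 * r ^+ n = L * (1 - r) * r ^+ n.
    by rewrite /L divfK // subr_eq0 gt_eqF.
  by rewrite le_eqVlt; apply/orP; left; apply/eqP; ring.
split=> //; apply: (@le_lt_trans _ _ (B + L)%:E); last by rewrite ltry.
apply: (tau_normal_le htau pA pA_).
- move=> i j ij; apply: (fc_le sD (l_ i) (l_ j)) => y _.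
  by apply: weight_cut_homo; apply: far_seq_ni; rewrite leq_add2l.
- by move=> n; apply: (fc_le sD (l_ n) lb_weight) => y _; exact: weight_cut_ge.
- move=> x e e0; pose n := Num.bound (2 * rip x x / e); exists n.
  pose c := v (c_ (m + n)).
  have vc0 : 0 <= c by have /andP[] := weight_itv (c_ (m + n)).
  have : op_le (fun_calc v D) (A_ n + c%:C *: id).
    rewrite -(fc_cst c sD) -(fcD sD (l_ n) (lb_cst c)).
    apply: fc_le => //; [exact: lb_weight|exact: lbD (lb_cst _)|move=> y _ /=].
    exact: weight_cut_le.
  have sAn : selfadjoint (A_ n + c%:C *: id).
    by apply: saD; [exact: pos_sa (pA_ n)|exact/saZ/sa_id].
  move=> h; apply: le_trans ((op_leP (pos_sa pA) sAn).1 h x) _.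
  rewrite opDE opZE ripDl ripZl lerD2l /c weight_seq expRN mulrAC.
  rewrite ler_pdivrMr ?expR_gt0 //.
  have h1 : 2 * rip x x < e * n%:R.
    rewrite [X in _ < X]mulrC -ltr_pdivrMr // /n; apply: archi_boundP.
    by rewrite divr_ge0 ?mulr_ge0 ?rip_ge0 // ltW.
  apply: le_trans (ltW h1) _; rewrite ler_pM2l //.
  apply: le_trans (expR_ge1Dx _); rewrite -natr1 natrD addrCA.
  by have : 0 <= (m%:R : R) by []; lra.
- move=> n; apply: le_trans (bnd n) _; rewrite lee_fin lerD2l ler_piMr //.
  by rewrite lerBlDr lerDl exprn_ge0 // ltW.
Qed.

End SpectralGap.
End TraceEstimates.

(** * The trace of an odd function of the difference *)

Section OddTrace.
Context {R : realType} {H : hilbertType R}.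
Implicit Types (x z : H) (A : H -> H) (f : R -> R) (a y : R).
Variables (N : set (H -> H)) (hN : von_neumann_algebra N).
Variables (tau : (H -> H) -> \bar R) (htau : fns_trace N tau).

Lemma finite_posZ a A : 0 <= a -> finite_pos N tau A -> finite_pos N tau (a%:C *: A).
Proof.
move=> a0 [pA fA]; split; first exact: posZ.
by rewrite (traceZ htau) // lte_mul_pinfty // ?lee_fin.
Qed.

Lemma fine_tauZ a A : 0 <= a -> finite_pos N tau A ->
  fine (tau (a%:C *: A)) = a * fine (tau A).
Proof.
move=> a0 fA; have [pA _] := fA.
by rewrite (traceZ htau a0 pA) (tau_fin htau fA).
Qed.

Lemma in_pt a y : (y \in [set a]) = (y == a).
Proof. by apply/idP/eqP => [|->]; rewrite inE. Qed.

Lemma opN_scale A : - A = (-1)%:C *: A.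
Proof.
rewrite -scaleN1r; congr (_ *: A).
by apply/eqP; rewrite eq_complex /= oppr0 !eqxx.
Qed.

Variables (S D : H -> H).
Hypotheses (NS : N S) (sS : selfadjoint S) (ND : N D) (sD : selfadjoint D).
Hypothesis anti : forall x, D (S x) = - S (D x).
Hypothesis sqrS : forall x, S (S x) = 4%:C *: x - D (D x).

(** The indicator of y^2 <> 4, written through 4 - y^2 so that S^2 = 4 - D^2 identifies it with a
    function of S. *)
Let om y : R := 1 - \1_[set 0] (4 - y ^+ 2).

Let omE y : om y = (y ^+ 2 != 4)%:R.
Proof.
rewrite /om indicE in_pt subr_eq0 [4 == _]eq_sym.
by case: eqP => _; rewrite /= ?subrr ?subr0.
Qed.

Let l4 : lbfun (fun y : R => 4 - y ^+ 2).
Proof. exact: lbB (lb_cst 4) (lb_expr 2). Qed.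

Let lbom : lbfun om.
Proof. exact: lbB (lb_cst 1) (lb_comp (lb_pt 0) l4). Qed.

Let W : H -> H := fun_calc Num.sg S.

Let sW : selfadjoint W. Proof. by apply: fc_sa => //; exact: lb_sg. Qed.

(** sg^2 is 1 off 0, so W^2 projects onto the complement of the kernel of S, which is the kernel of
    S^2 = 4 - D^2. *)
Lemma sign_sqr : W \o W = fun_calc om D.
Proof.
have lsg := @lb_sg R.
have l1 : lbfun (fun y : R => 1 - \1_[set 0] y) by exact: lbB (lb_cst 1) (lb_pt 0).
have -> : fun_calc om D = fun_calc ((fun y : R => 1 - \1_[set 0] y) \o (fun y => 4 - y ^+ 2)) D by [].
rewrite -(fc_comp sD l1 l4) -(fcM sS lsg lsg).
have -> : fun_calc (fun y => 4 - y ^+ 2) D = fun_calc (fun y => y ^+ 2) S.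
  have -> : (fun y : R => 4 - y ^+ 2) = (fun=> 4) \- (fun y => y ^+ 2) by [].
  rewrite (fcB sD (lb_cst 4) (lb_expr 2)) !fc_sqr // fc_cst //.
  by apply/funext => x /=; rewrite sqrS.
rewrite (fc_comp sS l1 (lb_expr 2)); congr fun_calc; apply/funext => y /=.
rewrite -expr2 sqr_sg indicE in_pt sqrf_eq0.
by case: eqP => _; rewrite /= ?subrr ?subr0.
Qed.

(** Two intertwinings: D carries S to - S, hence sg(S) to - sg(S), so W anticommutes with D; then W
    carries D to - D, hence f(D) to f(- D). *)
Lemma sign_anticomm f : lbfun f ->
  W \o fun_calc f D = fun_calc (fun y => f (- y)) D \o W.
Proof.
move=> lf; have lsg := @lb_sg R; have lN := lbN (@lb_id R).
have lfN : lbfun (f \o (fun y => - y)) by exact: lb_comp lf lN.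
have sND : selfadjoint (- D) by rewrite opN_scale; exact: saZ.
have sNS : selfadjoint (- S) by rewrite opN_scale; exact: saZ.
have fcN (T : H -> H) (g : R -> R) : selfadjoint T -> lbfun g ->
    fun_calc g (- T) = fun_calc (g \o (fun y : R => - y)) T.
  move=> sT lg; rewrite -(fc_comp sT lg lN); congr fun_calc.
  have -> : (fun y : R => - y) = (fun y => -1 * y) by apply/funext => y; rewrite mulN1r.
  by rewrite (fcZ _ sT (@lb_id R)) fc_id // -opN_scale.
have DW : D \o W = (- W) \o D.
  have := @fc_intertwine R H S (- S) D Num.sg sS sNS (sa_bop sD).
  move=> -> //; last by apply/funext => x; exact: anti.
  rewrite fcN //; congr (_ \o D).
  have -> : Num.sg \o (fun y : R => - y) = (fun y => -1 * Num.sg y).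
    by apply/funext => y /=; rewrite sgrN mulN1r.
  by rewrite (fcZ _ sS lsg) -opN_scale.
have WD : W \o D = (- D) \o W.
  apply/funext => x /=; have := congr1 (fun F => F x) DW; rewrite /= !opNE => ->.
  by rewrite opprK.
by rewrite (fc_intertwine sD sND (sa_bop sW) WD lf) fcN.
Qed.

Let E a : H -> H := fun_calc (\1_[set a]) D.

Variable w : R -> R.
Hypotheses (lw : lbfun w) (hw : finite_pos N tau (fun_calc w D)).

Lemma finite_pos_fc f : lbfun f ->
  (forall y, `|y| <= opnorm D -> 0 <= f y <= w y) -> finite_pos N tau (fun_calc f D).
Proof.
move=> lf fw; apply: (finite_pos_le hN htau _ hw).
  by apply: pos_fc => // y /fw /andP[].
by apply: fc_le => // y /fw /andP[].
Qed.

(* [W] intertwines [f(D)] with [f(- D)], and [W^2 = om(D)] vanishes exactly on the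
   eigenspaces of D for 2 and - 2.  With [X = p(D)^(1/2) W], where p and m are the
   positive and negative parts of f, [X X*] and [X* X] are [(p om)(D)] and
   [(m om)(D)], so that only these two eigenspaces contribute. *)
Lemma odd_trace f : lbfun f -> (forall y, f (- y) = - f y) ->
  (forall y, `|y| <= opnorm D -> `|f y| <= w y) ->
  finite_pos N tau (E 2) -> finite_pos N tau (E (- 2)) ->
  trace N tau (fun_calc f D) = (f 2 * (fine (tau (E 2)) - fine (tau (E (- 2)))))%:C.
Proof.
move=> lf odd fw hE hE'.
pose p y := Num.max (f y) 0; pose m y := Num.max (f (- y)) 0.
have lp : lbfun p by exact: lb_max0.
have lm : lbfun m by exact: (lb_max0 (lb_comp lf (lbN (@lb_id R)))).
have p0 y : 0 <= p y by rewrite /p le_max lexx orbT.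
have m0 y : 0 <= m y by rewrite /m le_max lexx orbT.
have le_w g y : `|g| <= w y -> 0 <= Num.max g 0 <= w y.
  move=> gw; rewrite le_max lexx orbT ge_max (le_trans (ler_norm _) gw) /=.
  exact: le_trans gw.
have pw y : `|y| <= opnorm D -> 0 <= p y <= w y by move=> /fw; exact: le_w.
have mw y : `|y| <= opnorm D -> 0 <= m y <= w y.
  by move=> /fw h; apply: le_w; rewrite odd normrN.
have fE : f = p \- m.
  by apply/funext => y; rewrite /p /m /= odd; case: (leP (f y) 0) => h;
    case: (leP (- f y) 0) => h'; lra.
have om01 y : 0 <= om y <= 1 by rewrite omE; case: (_ != _); rewrite ?lexx ?ler01.
have cut g : lbfun g -> (forall y, `|y| <= opnorm D -> 0 <= g y <= w y) ->
    finite_pos N tau (fun_calc (g \* om) D).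
  move=> lg gw; apply: finite_pos_fc; first exact: lbM.
  move=> y /gw /andP[g0 gwy] /=; have /andP[i0 i1] := om01 y.
  by rewrite mulr_ge0 //= (le_trans (ler_piMr g0 i1)).
have splitE g : lbfun g -> (forall y, 0 <= g y) ->
    (forall y, `|y| <= opnorm D -> 0 <= g y <= w y) ->
    fine (tau (fun_calc g D)) = fine (tau (fun_calc (g \* om) D)) +
      g 2 * fine (tau (E 2)) + g (- 2) * fine (tau (E (- 2))).
  move=> lg g0 gw.
  have e : g = (g \* om) \+ (fun y => g 2 * \1_[set 2] y)
                \+ (fun y => g (- 2) * \1_[set - 2] y).
    apply/funext => y /=; rewrite omE !indicE.
    rewrite !in_pt; have [->|y2] := eqVneq y 2.
      have -> : (2 == - 2 :> R) = false by apply/eqP; lra.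
      have -> : (2 : R) ^+ 2 = 4 by ring.
      by rewrite eqxx /= mulr0 mulr1 mulr0 add0r addr0.
    have [->|y2'] := eqVneq y (- 2).
      have -> : (- 2 : R) ^+ 2 = 4 by ring.
      by rewrite eqxx /= !mulr0 mulr1 !add0r.
    have -> : y ^+ 2 != 4.
      by rewrite (_ : 4 = 2 ^+ 2) ?eqf_sqr ?negb_or ?y2 //; ring.
    by rewrite /= mulr1 !mulr0 !addr0.
  rewrite {1}e fcD //; last 2 first.
  - by apply: lbD; [exact: lbM|exact/lbZ/lb_pt].
  - exact/lbZ/lb_pt.
  rewrite (fcD sD (lbM lg lbom) (lbZ _ (lb_pt 2))) !(fcZ _ sD (lb_pt _)).
  have f1 := cut g lg gw; have f2 := finite_posZ (g0 2) hE.
  have f3 := finite_posZ (g0 (- 2)) hE'.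
  rewrite (fine_tauD htau (finite_posD hN htau f1 f2) f3).
  by rewrite (fine_tauD htau f1 f2) !fine_tauZ.
have swap : tau (fun_calc (m \* om) D) = tau (fun_calc (p \* om) D).
  have lsp : lbfun (Num.sqrt \o p) by exact: lb_comp (@lb_sqrt R) lp.
  pose Q := fun_calc (Num.sqrt \o p) D.
  have sQ : selfadjoint Q by exact: fc_sa.
  have NW : N W by apply: vna_fc => //; exact: lb_sg.
  have NX : N (Q \o W) by apply: vnaM => //; exact: vna_fc.
  have QQ : Q \o Q = fun_calc p D.
    rewrite -(fcM sD lsp lsp); congr fun_calc; apply/funext => y /=.
    by rewrite -expr2 sqr_sqrtr.
  have := tau_conj htau NX.
  rewrite (adjointM (sa_bop sQ) (sa_bop sW)) sQ.2 sW.2.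
  have -> : (W \o Q) \o (Q \o W) = fun_calc (m \* om) D.
    have -> : (W \o Q) \o (Q \o W) = (W \o (Q \o Q)) \o W by [].
    rewrite QQ sign_anticomm // (_ : (fun y => p (- y)) = m) //.
    by rewrite (fcM sD lm lbom) -sign_sqr.
  have -> // : (Q \o W) \o (W \o Q) = fun_calc (p \* om) D.
  have -> : (Q \o W) \o (W \o Q) = Q \o ((W \o W) \o Q) by [].
  rewrite sign_sqr -(fcM sD lbom lsp) -(fcM sD lsp (lbM lbom lsp)).
  by congr fun_calc; apply/funext => y /=; rewrite mulrCA -expr2 sqr_sqrtr // mulrC.
rewrite fE fcB // (trace_sub hN htau (finite_pos_fc lp pw) (finite_pos_fc lm mw)).
congr (_%:C); rewrite (splitE p lp p0 pw) (splitE m lm m0 mw) swap.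
have m2 : m 2 = p (- 2) by [].
have m2' : m (- 2) = p 2 by rewrite /m opprK.
have -> : (p \- m) 2 = p 2 - p (- 2) by rewrite /= m2.
rewrite m2 m2'; ring.
Qed.

End OddTrace.

(** * Spectral flow and index *)

Section OperatorPaths.
Context {R : realType} {H : hilbertType R}.
Implicit Types (x z : H) (T D E : H -> H) (a b s t : R).

(** The difference quotient equals D for every nonzero h. For the operator E picked by [op_derive],
    the constant [opnorm (D - E)] must then tend to 0. *)
Lemma op_derive_affine T D t : bounded_op D ->
  op_derive (fun s => T + s%:C *: D) t = D.
Proof.
move=> bD; pose F s : H -> H := T + s%:C *: D.
have dE (h : R) E : h != 0 -> (h^-1)%:C *: (F (t + h) - F t) - E = D - E.
  move=> h0; congr (_ - E); apply/funext => x; apply: rip_eq => z.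
  rewrite /F !(opZE, opBE, opDE) !(ripZl, ripBl, ripDl).
  by field.
have near_eq E : \forall h \near (0 : R)^',
    opnorm ((h^-1)%:C *: (F (t + h) - F t) - E) = opnorm (D - E).
  by near=> h; rewrite dE //; near: h; exact: nbhs_dnbhs_neq.
have hD : [set E | bounded_op E /\
    opnorm ((h^-1)%:C *: (F (t + h) - F t) - E) @[h --> (0 : R)^'] --> (0 : R)] D.
  split=> //; apply: cvg_near_cst; near=> h.
  by rewrite dE ?subrr ?opnorm0 //; near: h; exact: nbhs_dnbhs_neq.
have [bE cE] := xgetI 0 hD; rewrite -/(op_derive F t) in bE cE *.
have h0 : opnorm (D - op_derive F t) = 0.
  apply: (@cvg_unique _ _ _ _ _ _ _ cE); first exact: norm_hausdorff.
  exact: cvg_near_cst.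
by apply/esym/eqP; rewrite -subr_eq0; apply/eqP/opnorm_eq0 => //; exact: bopB.
Unshelve. all: by end_near. Qed.

Lemma norm_continuous_affine T D a b : bounded_op D ->
  norm_continuous_on a b (fun s => T + s%:C *: D).
Proof.
move=> bD t _; apply: cvg_within_filter.
have e s : T + s%:C *: D - (T + t%:C *: D) = (s - t)%:C *: D.
  apply/funext => x; apply: rip_eq => z.
  by rewrite !(opZE, opBE, opDE) !(ripZl, ripBl, ripDl); ring.
apply: (@squeeze_cvgr _ _ _ _ (fun=> 0) (fun s => `|s - t| * opnorm D)).
- near=> s; rewrite e opnorm_ge0 ?opnormZ //; exact: bopZ.
- exact: cvg_cst.
- rewrite -[X in _ --> X](mul0r (opnorm D)); apply: cvgM; last exact: cvg_cst.
  rewrite [X in _ --> X](_ : 0 = `|t - t|); last by rewrite subrr normr0.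
  apply: cvg_norm.
  by apply: cvgB; [exact: cvg_id|exact: cvg_cst].
Unshelve. all: by end_near. Qed.

(** Compares two spectral projections through the affine operators (1 + F) / 2, from which each
    differs by a compact operator and which differ among themselves by a multiple of D. *)
Lemma affine_diff (A B T D : H -> H) s t : A - B =
  (A - (2^-1)%:C *: (id + (T + s%:C *: D)))
  - (B - (2^-1)%:C *: (id + (T + t%:C *: D))) + (2^-1 * (s - t))%:C *: D.
Proof.
apply/funext => x; apply: rip_eq => z.
by rewrite !(opDE, opNE, opZE) !(ripDl, ripNl, ripZl); field.
Qed.

Lemma partition_telescope (I : R -> R -> \bar R) (g : R -> R) a b (s : seq R) :
  (forall c d : R, a <= c -> c < d -> d <= b -> I c d = (g d - g c)%:E) ->
  itv_partition a b s ->
  (\sum_(i < size s) I (nth b (a :: s) i) (nth b s i))%E = (g b - g a)%:E.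
Proof.
elim: s a => [|c s IH] a hI [].
  by move=> _ /eqP /= <-; rewrite big_ord0 subrr.
move=> /= /andP[ac pcs] lcs; rewrite big_ord_recl /=.
have cb : c <= b.
  have /= -> := esym (eqP lcs); case: s pcs {IH lcs} => [|d s] // pcs.
  by have /allP h := lt_path_min pcs; apply/ltW/h; rewrite /= mem_last.
rewrite (IH c); last 2 first.
- by move=> d d' cd; apply: hI; exact: le_trans (ltW ac) cd.
- by split.
by rewrite hI // -EFinD; congr (_%:E); ring.
Qed.

End OperatorPaths.

(** * The path defined by a unitary *)

Section UnitaryFlow.
Context {R : realType} {H : hilbertType R}.
Implicit Types (x z : H) (T : H -> H) (a s t y : R).
Variables (N : set (H -> H)) (hN : von_neumann_algebra N).
Variables (tau : (H -> H) -> \bar R) (htau : fns_trace N tau).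
Variables (F0 U : H -> H).
Hypotheses (NF0 : N F0) (sF0 : selfadjoint F0) (FF0 : F0 \o F0 = id).
Hypotheses (NU : N U) (UU : adjoint U \o U = id) (UV : U \o adjoint U = id).

Let F1 : H -> H := U \o F0 \o adjoint U.
Let D : H -> H := F1 - F0.
Let F : R -> H -> H := flow_path F0 U.
Let E a : H -> H := fun_calc (\1_[set a]) D.
Let X : H -> H := commutator F0 U.

Let bU : bounded_op U. Proof. exact: vna_bop NU. Qed.
Let NV : N (adjoint U). Proof. exact: vna_adj. Qed.
Let l0 := bop_lin (sa_bop sF0).
Let lU := bop_lin bU.
Let UK x : adjoint U (U x) = x. Proof. exact: (congr1 (fun T => T x) UU). Qed.
Let VK x : U (adjoint U x) = x. Proof. exact: (congr1 (fun T => T x) UV). Qed.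
Let F00 x : F0 (F0 x) = x. Proof. exact: (congr1 (fun T => T x) FF0). Qed.
Let F11 x : F1 (F1 x) = x. Proof. by rewrite /F1 /= UK F00 VK. Qed.
Let sF1 : selfadjoint F1. Proof. exact: sa_conj. Qed.
Let NF1 : N F1. Proof. by apply: vnaM => //; exact: vnaM. Qed.
Let ND : N D. Proof. exact: vnaB. Qed.
Let sD : selfadjoint D. Proof. exact: saB. Qed.
Let NF t : N (F t). Proof. by apply: vnaD => //; exact: vnaZ. Qed.
Let sF t : selfadjoint (F t). Proof. by apply: saD => //; exact: saZ. Qed.
Let NE a : N (E a). Proof. by apply: vna_fc => //; exact: lb_pt. Qed.
Let hE a : projection (E a). Proof. exact: diff_eigenproj. Qed.

Lemma diff_unitary x : D (U x) = - X x.
Proof. by rewrite /D /X /commutator !opBE /F1 /= UK opprB. Qed.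

Section CornerIndex.
Let half_real : (2^-1 : R[i]) = (2^-1)%:C.
Proof. by rewrite fmorphV rmorph_nat. Qed.

Let P : H -> H := (2^-1 : R[i]) *: (id + F0).

Let PE x : P x = x <-> F0 x = x.
Proof.
have e : P x = (2^-1)%:C *: (x + F0 x) by rewrite /P half_real.
rewrite e; split=> h; last first.
  by rewrite h; apply: rip_eq => z; rewrite ripZl ripDl; lra.
apply: rip_eq => z; have := congr1 (rip^~ z) h.
by rewrite ripZl ripDl; lra.
Qed.

Let P0 x : P x = 0 <-> F0 x = - x.
Proof.
have e : P x = (2^-1)%:C *: (x + F0 x) by rewrite /P half_real.
rewrite e; split=> h; last by rewrite h subrr scaler0.
apply: rip_eq => z; have := congr1 (rip^~ z) h.
by rewrite ripZl ripDl rip0l ripNl; lra.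
Qed.

Let hP : projection P.
Proof.
have eP : P = (2^-1)%:C *: (id + F0) by rewrite /P half_real.
split; first by rewrite eP; apply/saZ/saD => //; exact: sa_id.
apply/funext => x /=; apply/PE; rewrite eP opZE opDE (linZ l0) (linD l0) F00.
by rewrite addrC.
Qed.

(** For F0 x = x, the condition P U x = 0 means F0 U x = - U x, and then D U x = U F0 x - F0 U x = 2
    U x. Conversely, [diff_eigen] recovers both conditions from the eigenvalue equation. *)
Lemma corner_kernel : proj_onto (ker (P \o U \o P) `&` range P) =
  adjoint U \o E 2 \o U.
Proof.
have sq2 : (2 : R) ^+ 2 = 4 by ring.
have e : adjoint U \o E 2 \o U = adjoint U \o E 2 \o adjoint (adjoint U).
  by rewrite adjointK.
apply: proj_ontoE.
  rewrite e; apply: (projection_conj hN NV _ (hE 2)); by rewrite adjointK.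
move=> x; have -> : (adjoint U \o E 2 \o U) x = x <-> D (U x) = 2%:C *: U x.
  rewrite -(fc_pt_eigen 2 (U x) sD) /=; split=> [h|h]; last by rewrite -[RHS]UK -[in RHS]h.
  by rewrite -{2}h VK.
split=> [h|[]]; last first.
  rewrite /ker /= => k /(range_proj _ hP) Px; move: k; rewrite Px => /P0 k.
  move/PE in Px; rewrite /D opBE /F1 /= UK Px k opprK.
  by apply: rip_eq => z; rewrite ripDl ripZl; lra.
have [_ h1 h0] := diff_eigen sF0 sF1 F00 F11 sq2 h.
have Px : P x = x.
  apply/PE; move: h1; rewrite /F1 /= UK divff // scale1r => /(congr1 (adjoint U)).
  by rewrite !UK.
split; last by apply/range_proj.
rewrite /ker /= Px; apply/P0; rewrite h0 divff //.
by apply: rip_eq => z; rewrite ripZl ripNl; lra.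
Qed.

(** For F0 x = x, the condition P U* x = 0 means F1 x = - x, so D x = - 2 x; here the unitary moves
    no vector. *)
Lemma corner_cokernel : proj_onto (ker (adjoint (P \o U \o P)) `&` range P) = E (- 2).
Proof.
have sq2 : (- 2 : R) ^+ 2 = 4 by ring.
have bP := sa_bop hP.1; have aP := hP.1.2.
have -> : adjoint (P \o U \o P) = P \o (adjoint U \o P).
  by rewrite (adjointM (bopM bP bU) bP) (adjointM bP bU) aP.
apply: proj_ontoE; first exact: hE.
move=> x; rewrite fc_pt_eigen //; split=> [h|[]]; last first.
  rewrite /ker /= => k /(range_proj _ hP) Px; move: k; rewrite Px => /P0 k.
  move/PE in Px; rewrite /D opBE /F1 /= k Px (linN lU) VK.
  by apply: rip_eq => z; rewrite ripDl ripNl ripZl; lra.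
have [_ h1 h0] := diff_eigen sF0 sF1 F00 F11 sq2 h.
have Px : P x = x.
  by apply/PE; rewrite h0; apply: rip_eq => z; rewrite ripZl; lra.
split; last by apply/range_proj.
rewrite /ker /= Px; apply/P0.
have := congr1 (adjoint U) h1; rewrite /F1 /= UK => ->.
rewrite (linZ (bop_lin (vna_bop hN NV))).
by apply: rip_eq => z; rewrite ripZl ripNl; lra.
Qed.

Lemma corner_index_eigen :
  corner_index tau P (P \o U \o P) = (tau (E 2) - tau (E (- 2)))%E.
Proof.
rewrite /corner_index corner_kernel corner_cokernel; congr (_ - _)%E.
have := @tau_projection_conj R H N hN tau htau (adjoint U) NV _ (E 2) (NE 2) (hE 2).
by rewrite adjointK //; apply.
Qed.

End CornerIndex.

Section CompactPerturbation.
Let K : set (H -> H) := compact_ideal N tau.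
Hypothesis KX : K X.
Let idK := compact_ideal_closed hN tau.

Let KZ a T : K T -> K (a%:C *: T).
Proof.
move=> KT; have Na : N (a%:C *: id) by apply: vnaZ => //; exact: vna_id.
by have [+ _] := ideal_comp idK Na KT.
Qed.

Let KB T T' : K T -> K T' -> K (T - T').
Proof. by move=> KT KT'; rewrite (opN_scale T'); apply: (idealD idK) => //; exact: KZ. Qed.

Lemma diff_compact : K D.
Proof.
have -> : D = (-1)%:C *: (X \o adjoint U).
  by apply/funext => x; rewrite -opN_scale opNE /= -diff_unitary VK.
by apply: KZ; have [] := ideal_comp idK NV KX.
Qed.

Let KDD : K (D \o D).
Proof. by have [] := ideal_comp idK ND diff_compact. Qed.

Let defectE t : id - (F t \o F t) = (t * (1 - t))%:C *: (D \o D).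
Proof. by rewrite -(fc_scaled_sqr _ sD); exact: defect_fc. Qed.

(** Each point of the path is its own parametrix, since 1 - F_t^2 is a multiple of the compact
    D^2. *)
Lemma path_breuer_fredholm t : breuer_fredholm N tau (F t).
Proof.
split=> //; exists (F t); have h : K ((F t \o F t) - id).
  by rewrite -opprB defectE opN_scale; do 2!apply: KZ.
by split.
Qed.

(** By [pos_proj_defect] each projection differs from (1 + F_r) / 2 by a multiple, in the algebra,
    of 1 - F_r^2, which is compact. *)
Lemma spectral_proj_compact s t : K (spectral_proj F s - spectral_proj F t).
Proof.
have h r : K (spectral_proj F r - (2^-1)%:C *: (id + F r)).
  have [g lg ->] := pos_proj_defect (sF r).
  have Ng : N (fun_calc g (F r)) by exact: vna_fc.
  have Kd : K (id - (F r \o F r)) by rewrite defectE; exact: KZ.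
  by have [] := ideal_comp idK Ng Kd.
rewrite (affine_diff _ _ F0 D s t).
by apply: (idealD idK); [exact: KB|exact/KZ/diff_compact].
Qed.

Lemma path_fredholm_path : fredholm_path N tau 0 1 F.
Proof.
split=> [t _|t _|]; [exact: sF|exact: path_breuer_fredholm|].
exact/norm_continuous_affine/(sa_bop sD).
Qed.

(** All spectral projections have the same class modulo the compact ideal, so the whole interval
    already is a fine partition. *)
Lemma fine_partition_exists : exists p, fine_partition N tau 0 1 F p.
Proof.
exists [:: 1]; split; first by split; rewrite /= ?ltr01.
move=> i _ x y _ _; apply: le_lt_trans ltr01; apply: ge_inf.
  exists 0 => _ [T [NT _] <-]; apply: opnorm_ge0; apply: bopB; last exact: vna_bop NT.
  by apply: bopB; apply: fc_bop => //; exact: lb_ge0.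
exists (spectral_proj F x - spectral_proj F y); first exact: spectral_proj_compact.
by rewrite subrr opnorm0.
Qed.

End CompactPerturbation.

Variables (q : R) (q0 : 0 < q) (q1 : q <= 1) (hLi : Li0 N tau (q / 2) X).

Let w y : R := 2 * heat q (4^-1 * y ^+ 2).
Let lw : lbfun w. Proof. exact: lb_weight. Qed.

Let fw : finite_pos N tau (fun_calc w D).
Proof.
have bX : bounded_op X by apply: bopB; apply: bopM => //; exact: sa_bop.
exact: (weight_finite hN htau NU UU UV ND sD diff_unitary bX q0 q1 hLi).
Qed.

(** The indicator of {a} is at most w / w(a), and w(a) = 2 heat(1) is positive. *)
Lemma eigenproj_finite a : a ^+ 2 = 4 -> finite_pos N tau (E a).
Proof.
move=> a4; have wa : 0 < w a.
  rewrite /w a4 mulVf // mulr_gt0 // /heat oner_eq0; exact: expR_gt0.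
have lE : lbfun (fun y => (w a)^-1 * w y) by exact: lbZ.
have fE : finite_pos N tau (fun_calc (fun y => (w a)^-1 * w y) D).
  by rewrite fcZ //; apply: finite_posZ => //; rewrite invr_ge0 ltW.
apply: (finite_pos_fc hN htau ND sD lE fE); first exact: lb_pt.
move=> y _; rewrite indicE in_pt; case: eqP => [->|_].
  by rewrite mulVf ?lexx ?ler01 // gt_eqF.
have /andP[wy _] : 0 <= w y <= 2 by exact: weight_itv.
by rewrite lexx; apply: mulr_ge0 wy; rewrite invr_ge0 ltW.
Qed.

Lemma flow_fun_le t y : 0 <= t <= 1 -> `|y| <= 2 -> `|flow_fun q t y| <= w y.
Proof.
move=> /andP[t0 t1] y2; have /andP[h0 _] := heat_itv q `|t * (1 - t) * y ^+ 2|.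
rewrite /flow_fun normrM (ger0_norm h0); apply: (ler_pM (normr_ge0 y) h0 y2).
apply: heat_nd => //; have c0 : 0 <= t * (1 - t) by rewrite mulr_ge0 // subr_ge0.
have c4 : t * (1 - t) <= 4^-1 by have := sqr_ge0 (t - 2^-1); lra.
rewrite (ger0_norm (mulr_ge0 c0 (sqr_ge0 y))); apply: ler_wpM2r => //; exact: sqr_ge0.
Qed.

Let f2 : finite_pos N tau (E 2). Proof. by apply: eigenproj_finite; ring. Qed.
Let f2' : finite_pos N tau (E (- 2)). Proof. by apply: eigenproj_finite; ring. Qed.

Let k : R := fine (tau (E 2)) - fine (tau (E (- 2))).

(* The jump of the projections along the path occurs at t = 1/2, and the
   eigenspaces for 2 and - 2 jump on different sides of it. *)
Let crossing t : R := (2^-1 <= t)%R%:R * fine (tau (E 2))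
                    - (2^-1 < t)%R%:R * fine (tau (E (- 2))).

Lemma pair_index_path s t : 0 <= s -> s < t -> t <= 1 ->
  pair_index tau (spectral_proj F s) (spectral_proj F t) =
  (crossing t - crossing s)%:E.
Proof.
move=> s0 st t1; rewrite /pair_index.
have := pair_range_ker sF0 sF1 F00 F11 s0 st t1.
rewrite -/(spectral_proj F t) -/(spectral_proj F s) => ->.
have := pair_ker_range sF0 sF1 F00 F11 s0 st t1.
rewrite -/(spectral_proj F t) -/(spectral_proj F s) => ->.
have ifE (b : bool) a : finite_pos N tau (E a) ->
    tau (if b then E a else 0) = (b%:R * fine (tau (E a)))%:E.
  move=> fa; case: b; first by rewrite mul1r; exact: (tau_fin htau).
  by rewrite mul0r (tau0 hN htau).
rewrite (ifE _ _ f2) (ifE _ _ f2') -EFinB; congr (_%:E); rewrite /crossing.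
have e1 : ((s < 2^-1 <= t)%R%:R : R) = (2^-1 <= t)%R%:R - (2^-1 <= s)%R%:R.
  case: (leP 2^-1 s) => [h|h] /=; last by rewrite subr0.
  by rewrite (le_trans h (ltW st)) subrr.
have e2 : ((s <= 2^-1 < t)%R%:R : R) = (2^-1 < t)%R%:R - (2^-1 < s)%R%:R.
  case: (leP s 2^-1) => [h|h] /=; first by rewrite subr0.
  by rewrite (lt_trans h st) subrr.
by rewrite e1 e2; ring.
Qed.

Lemma path_spectral_flow : compact_ideal N tau X -> is_spectral_flow N tau 0 1 F k%:E.
Proof.
move=> KX; split; [exact: path_fredholm_path|exact: fine_partition_exists|].
move=> p [ps _]; rewrite /partition_index.
rewrite (@partition_telescope _ (fun a t => pair_index tau (spectral_proj F a)
  (spectral_proj F t)) crossing) //; last exact: pair_index_path.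
congr (_%:E); rewrite /crossing /k.
have h1 : (2^-1 : R) < 1 by rewrite invf_lt1 // ltr1n.
have h0 : (0 : R) < 2^-1 by rewrite invr_gt0.
by rewrite h1 (ltW h1) leNgt h0 ltNge (ltW h0) /=; ring.
Qed.

Let flowE t : flow_op q F t = fun_calc (flow_fun q t) D.
Proof.
rewrite -(flow_op_fc sF0 sF1 F00 F11 t q0) /flow_op /F /flow_path -/F1 -/D.
by rewrite op_derive_affine //; exact: sa_bop.
Qed.

Let D2 y : `|y| <= opnorm D -> `|y| <= 2.
Proof. by move=> /le_trans; apply; exact: diff_norm. Qed.

Lemma flow_trace_class t : 0 <= t <= 1 -> trace_class N tau (flow_op q F t).
Proof.
move=> t01; have lf := lb_flow_fun t q0; rewrite flowE; split; first exact: vna_fc.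
rewrite op_abs_fc //; have [] // := @finite_pos_fc R H N hN tau htau D ND sD w lw fw
  (fun y => `|flow_fun q t y|) (lb_norm lf) _.
by move=> y /D2 y2; rewrite normr_ge0 /=; exact: flow_fun_le.
Qed.

Lemma flow_trace t : 0 <= t <= 1 ->
  trace N tau (flow_op q F t) = (2 * heat q `|t * (1 - t) * 2 ^+ 2| * k)%:C.
Proof.
move=> t01; have lf := lb_flow_fun t q0; rewrite flowE.
have NS : N (F0 + F1) by exact: vnaD.
have sS : selfadjoint (F0 + F1) by exact: saD.
rewrite (odd_trace hN htau NS sS ND sD (diff_sum_anticomm sF0 sF1 F00 F11)
  (sum_sqr sF0 sF1 F00 F11) lw fw lf _ _ f2 f2') //.
- by move=> y; rewrite /flow_fun sqrrN mulNr.
- by move=> y /D2; exact: flow_fun_le.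
Qed.

Lemma path_index_formula : compact_ideal N tau X ->
  let P := (2^-1 : R[i]) *: (id + F0) in
  [/\ (forall t, t \in `[0, 1] -> selfadjoint (F t) /\ breuer_fredholm N tau (F t)),
      (forall t, t \in `[0, 1] -> trace_class N tau (flow_op q F t)),
      Cintegrable 0 1 (fun t => trace N tau (flow_op q F t)) &
      exists k : R,
        [/\ corner_index tau P (P \o U \o P) = k%:E,
            is_spectral_flow N tau 0 1 F k%:E &
            k%:C = ((C0 q)^-1)%:C
                   * Cintegral 0 1 (fun t => trace N tau (flow_op q F t))]].
Proof.
move=> KX P; pose g t : R := 2 * heat q `|t * (1 - t) * 2 ^+ 2|.
have lg : lbfun g by exact: lb_heat_path.
have trE t : t \in (`[0, 1]%classic : set R) ->
    trace N tau (flow_op q F t) = (k * g t)%:C.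
  by rewrite inE /= in_itv /= => t01; rewrite flow_trace // mulrC.
have ig : lebesgue_measure.-integrable `[0, 1] (EFin \o (fun t => k * g t)).
  by apply: lb_lebesgue_integrable; exact: lbZ.
have ig1 : lebesgue_measure.-integrable `[0, 1] (EFin \o g).
  exact: lb_lebesgue_integrable.
have mI : measurable (`[0, 1]%classic : set (measurableTypeR R)) by exact: measurable_itv.
split.
- by move=> t _; split; [exact: sF|exact: path_breuer_fredholm].
- by move=> t; rewrite in_itv /=; exact: flow_trace_class.
- split; first by apply: eq_integrable ig => // t /trE ->.
  apply: (@eq_integrable _ _ _ _ _ mI (cst 0%E)); last exact: integrable0.
  by move=> t /trE ->.
exists k; split; [|exact: path_spectral_flow|].
  rewrite corner_index_eigen /k EFinB.
  by rewrite -(tau_fin htau f2) -(tau_fin htau f2').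
rewrite /Cintegral (@eq_Rintegral _ _ _ lebesgue_measure _ (fun t => k * g t)); last first.
  by move=> t /trE ->.
(* The zero imaginary part is written as a multiple of [g] so that linearity evaluates both parts
   alike. *)
rewrite [X in _ +i* X](@eq_Rintegral _ _ _ lebesgue_measure _ (fun t => 0 * g t)); last first.
  by move=> t /trE ->; rewrite mul0r.
have := @RintegralZl _ _ R lebesgue_measure _ g k mI ig1.
rewrite (C0_substitution q0) => ->.
have := @RintegralZl _ _ R lebesgue_measure _ g 0 mI ig1; rewrite mul0r => ->.
by rewrite -[_ +i* 0]/(_%:C) -rmorphM /= mulrCA mulVf ?mulr1 // gt_eqF // C0_gt0.
Qed.

End UnitaryFlow.

Theorem theorem4p2 (R : realType) (H : hilbertType R)
    (N : set (H -> H)) (tau : (H -> H) -> \bar R)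
    (hN : von_neumann_algebra N) (hsep : separable_predual N)
    (htau : fns_trace N tau)
    (A : completeNormedModType R[i]) (B : banach_star_algebra A)
    (q : R) (hq0 : 0 < q) (hq1 : q <= 1)
    (rho : A -> H -> H) (F0 : H -> H)
    (hF : odd_theta_summable_module B N tau q rho F0)
    (u : A) (hu : bunitary B u)
    (hLi : Li0 N tau (q / 2) (commutator F0 (rho u))) :
  let P := (2^-1 : R[i]) *: (id + F0) in
  let F := flow_path F0 (rho u) in
  [/\ (forall t, t \in `[0, 1] ->
         selfadjoint (F t) /\ breuer_fredholm N tau (F t)),
      (forall t, t \in `[0, 1] -> trace_class N tau (flow_op q F t)),
      Cintegrable 0 1 (fun t => trace N tau (flow_op q F t)) &
      exists k : R,
        [/\ corner_index tau P (P \o rho u \o P) = k%:E,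
            is_spectral_flow N tau 0 1 F k%:E &
            k%:C = ((C0 q)^-1)%:C
                   * Cintegral 0 1 (fun t => trace N tau (flow_op q F t))]].
Proof.
move=> P F; have rep := fm_rep hF.
have UU : adjoint (rho u) \o rho u = id.
  by rewrite -(rep_star rep) -(repM rep) hu.2 (rep1 rep).
have UV : rho u \o adjoint (rho u) = id.
  by rewrite -(rep_star rep) -(repM rep) hu.1 (rep1 rep).
exact: (path_index_formula hN htau (fm_mem hF) (fm_selfadjoint hF) (fm_sqr hF)
  (rep_mem rep u) UU UV hq0 hq1 hLi (fm_compact hF u)).
Qed.
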